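(* For each $n\in\mathbb{N}\cup\{\infty\}$, let $\mathcal{X}_n=(X_n,r_n,\rho_n,\mu_n)\in\mathbb{X}$. Then $(\mathcal{X}_n)_{n\in\mathbb{N}}$ converges to $\mathcal{X}_\infty$ Gromov-vaguely if and only if there exist a pointed complete, separable metric space $(E,d,\rho)$ and isometries (isometric embeddings) $\varphi_n\colon\operatorname{supp}(\mu_n)\cup\{\rho_n\}\to E$ such that $\varphi_n(\rho_n)=\rho$ for $n\in\mathbb{N}\cup\{\infty\}$, and $$\big((\varphi_n)_*\mu_n\big){\upharpoonright}_{\overline{B}_d(\rho,R)}\ \Longrightarrow\ \big((\varphi_\infty)_*\mu_\infty\big){\upharpoonright}_{\overline{B}_d(\rho,R)}\quad\text{as } n\to\infty\qquad( * )$$ for all but countably many $R\ge0$. Furthermore, if $(\mathcal{X}_n)_{n\in\mathbb{N}}$ converges to $\mathcal{X}_\infty$ Gromov-vaguely and $\{\mathcal{X}_n:n\in\mathbb{N}\}$ satisfies the local lower mass-bound property, then $\mathcal{X}_\infty\in\mathbb{X}_{\mathrm{HB}}$ and $E$ can be chosen as a Heine-Borel space. In this case ($E$ Heine-Borel), the condition that $( * )$ holds for all but countably many $R\ge0$ is equivalent to $$(\varphi_n)_*\mu_n\to(\varphi_\infty)_*\mu_\infty\quad\text{vaguely as Radon measures on } E.$$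
   Context: A (pointed, complete, separable) metric measure space $(X,r,\rho,\mu)$ consists of a complete separable metric space $(X,r)$, a point $\rho\in X$ (the root) and a Borel measure $\mu$ on $X$; it is boundedly finite if $\mu$ is finite on all bounded sets. Two metric measure spaces are equivalent if there is a (surjective) isometry $\phi\colon\operatorname{supp}(\mu)\cup\{\rho\}\to\operatorname{supp}(\mu')\cup\{\rho'\}$ with $\phi(\rho)=\rho'$ and $\phi_*\mu=\mu'$; here $\phi_*\mu=\mu\circ\phi^{-1}$. $\mathbb{X}$ is the set of equivalence classes of metric boundedly finite measure spaces; classes and representatives are not distinguished. A Heine-Borel space is a metric space in which every bounded closed set is compact; $\mathbb{X}_{\mathrm{HB}}\subseteq\mathbb{X}$ consists of the classes containing a representative with $(X,r)$ Heine-Borel. $B$ and $\overline{B}$ denote open and closed balls; $\Longrightarrow$ denotes weak convergence of finite measures; for $R\ge0$, $\mathcal{X}{\upharpoonright}_R:=(X,r,\rho,\mu{\upharpoonright}_{\overline{B}_r(\rho,R)})$. Gromov-weak convergence (finite measures): for $m\in\mathbb{N}$ let $\nu_m(\mathcal{X})$ be the image of $\mu^{\otimes m}$ under $(x_1,\dots,x_m)\mapsto (r(x_i,x_j))_{0\le i<j\le m}$, $x_0:=\rho$; $\mathcal{X}_n\to\mathcal{X}$ Gromov-weakly iff $\nu_m(\mathcal{X}_n)\Rightarrow\nu_m(\mathcal{X})$ for all $m$. Gromov-vague convergence in $\mathbb{X}$: $\mathcal{X}_n\to\mathcal{X}$ iff $\mathcal{X}_n{\upharpoonright}_R\to\mathcal{X}{\upharpoonright}_R$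 Gromov-weakly for all but countably many $R>0$. Local lower mass-bound property of $\mathbb{K}\subseteq\mathbb{X}$: $\inf_{\mathcal{X}\in\mathbb{K}}\mathfrak{m}_\delta^R(\mathcal{X})>0$ for all $R>\delta>0$, where $\mathfrak{m}_\delta^R((X,r,\rho,\mu)):=\inf\{\mu(\overline{B}_r(x,\delta)):x\in B_r(\rho,R)\cap\operatorname{supp}(\mu)\}$, $\inf\emptyset=\infty$. *)

(* Defs.v *)
From HB Require Import structures.
From mathcomp Require Import all_boot all_order all_algebra.
From mathcomp Require Import all_classical all_reals all_analysis.

Import Order.TTheory GRing.Theory Num.Theory.
Import numFieldNormedType.Exports.

Local Open Scope classical_set_scope.
Local Open Scope ring_scope.

(* Complete types are pointed in the library: [point] is the root rho. *)
#[short(type="completeMetricType")]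
HB.structure Definition CompleteMetric (K : numDomainType) :=
  {M of CompletePseudoMetric K M & Metric K M}.

Definition separable_space (T : topologicalType) : Prop :=
  exists2 D : set T, countable D & dense D.

Notation borel T := (g_sigma_algebraType (@open T)).

Section metric_notions.
Context {R : realType}.

(* The library's [closed_ball] is the closure of the open ball, which may be
   strictly smaller than this set. *)
Definition cball {T : metricType R} (x : T) (r : R) : set T :=
  [set y | mdist x y <= r].

Definition metric_bounded {T : metricType R} (A : set T) : Prop :=
  exists M : R, forall x y, A x -> A y -> mdist x y <= M.

Definition heine_borel (T : metricType R) : Prop :=
  forall A : set T, closed A -> metric_bounded A -> compact A.

Definition isometric_on {T U : metricType R} (S : set T) (phi : T -> U) : Prop :=
  forall x y, S x -> S y -> mdist (phi x) (phi y) = mdist x y.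

Lemma closed_cball (T : metricType R) (x : T) (r : R) : closed (cball x r).
Proof.
rewrite -[cball x r]setCK; apply: open_closedC.
rewrite openE => y /= /negP; rewrite -ltNge => ry.
rewrite /interior /=.
apply/nbhs_ballP; exists (mdist x y - r) => /=; first by rewrite subr_gt0.
move=> z; rewrite ballEmdist /= ltrBrDl -ltrBrDr => yz; apply/negP.
rewrite -ltNge (lt_le_trans yz)// lerBlDr (metric_sym y z).
exact: metric_triangle.
Qed.

Lemma measurable_cball (T : completeMetricType R) (x : T) (r : R) :
  measurable (cball x r : set (borel T)).
Proof.
rewrite -[cball x r]setCK; apply: measurableC; apply: sub_sigma_algebra.
exact/closed_openC/closed_cball.
Qed.

End metric_notions.

Section measure_notions.
Context {R : realType}.
Local Open Scope ereal_scope.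

Definition msupport {T : ptopologicalType} (mu : set (borel T) -> \bar R) :
  set T := [set x | forall U : set T, open_nbhs x U -> 0 < mu U].

(* Image measure of mu under phi : S -> U, A |-> mu (phi^-1 A), where phi is
   represented by a function on T whose values outside of S do not matter. *)
Definition pushforward_on {T U : ptopologicalType} (S : set T) (phi : T -> U)
    (mu : set (borel T) -> \bar R) : set (borel U) -> \bar R :=
  fun A => mu (S `&` phi @^-1` A).

Definition weak_cvg {T : ptopologicalType}
    (mu_ : nat -> set (borel T) -> \bar R) (mu : set (borel T) -> \bar R) :
    Prop :=
  forall f : T -> R, continuous f -> bounded_fun f ->
    \int[mu_ n]_x (f x)%:E @[n --> \oo] --> \int[mu]_x (f x)%:E.

Definition vague_cvg {T : ptopologicalType}
    (mu_ : nat -> set (borel T) -> \bar R) (mu : set (borel T) -> \bar R) :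
    Prop :=
  forall f : T -> R, continuous f -> compact (closure [set x | f x != 0%R]) ->
    \int[mu_ n]_x (f x)%:E @[n --> \oo] --> \int[mu]_x (f x)%:E.

(* Product measure mu^(x)m, as a set function: it is only used for boundedly
   finite Borel measures on separable spaces, where it is a measure and where
   the product sigma-algebra of [m.-tuple (borel X)] is the Borel one. *)
Fixpoint power_measure {d} {T : measurableType d} (mu : set T -> \bar R)
    (m : nat) : set (m.-tuple T) -> \bar R :=
  if m is m'.+1 then
    pushforward (mu \x power_measure mu m')
      (fun p : T * m'.-tuple T => [tuple of p.1 :: p.2])
  else dirac [tuple].

End measure_notions.

Definition dist_index (m : nat) : Type :=
  {ij : 'I_m.+1 * 'I_m.+1 | (ij.1 < ij.2)%N}.

Definition dist_space (R : realType) (m : nat) : Type :=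
  prod_topology (fun _ : dist_index m => R).
HB.instance Definition _ (R : realType) (m : nat) := Topological.on (dist_space R m).
HB.instance Definition _ (R : realType) (m : nat) := Pointed.on (dist_space R m).

Record mms (R : realType) := Mms {
  mms_carrier :> completeMetricType R;
  mms_separable : separable_space mms_carrier;
  mms_measure : {measure set (borel mms_carrier) -> \bar R};
  mms_boundedly_finite : forall A : set (borel mms_carrier),
    measurable A -> metric_bounded A -> (mms_measure A < +oo)%E }.

Arguments Mms {R}.
Arguments mms_carrier {R}.
Arguments mms_separable {R}.
Arguments mms_measure {R}.
Arguments mms_boundedly_finite {R}.

Section mms_theory.
Context {R : realType}.
Implicit Types X Y : mms R.

Definition supp_root X : set X := msupport (mms_measure X) `|` [set point].

Definition mms_equiv X Y : Prop :=
  exists phi : X -> Y,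
    [/\ isometric_on (supp_root X) phi,
        phi @` supp_root X = supp_root Y,
        phi point = point &
        forall A : set (borel Y), measurable A ->
          pushforward_on (supp_root X) phi (mms_measure X) A = mms_measure Y A].

(* [mms] is a type of representatives: the class of X has to contain one which
   is Heine-Borel. *)
Definition in_mms_HB X : Prop :=
  exists2 Y : mms R, mms_equiv X Y & heine_borel Y.

Lemma mrestr_boundedly_finite X (r : R) (A : set (borel X)) :
  measurable A -> metric_bounded A ->
  (mrestr (mms_measure X) (measurable_cball _ point r) A < +oo)%E.
Proof.
move=> mA [M AM]; apply: (mms_boundedly_finite X).
  by apply: measurableI => //; exact: measurable_cball.
by exists M => x y [Ax _] [Ay _]; exact: AM.
Qed.

Definition mms_restr X (r : R) : mms R :=
  Mms X (mms_separable X)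
    (mrestr (mms_measure X) (measurable_cball _ point r))
    (mrestr_boundedly_finite X r).

Definition dist_matrix X (m : nat) (x : m.-tuple X) : dist_space R m :=
  fun ij => let y := [tuple of point :: x] in
    mdist (tnth y (val ij).1) (tnth y (val ij).2).

(* The measure nu_m: the root is x_0, followed by m sampled points. *)
Definition distance_distribution X (m : nat) :
    set (borel (dist_space R m)) -> \bar R :=
  pushforward (power_measure (mms_measure X) m)
    (dist_matrix X m : m.-tuple (borel X) -> borel (dist_space R m)).

Definition gromov_weak_cvg (X_ : nat -> mms R) X : Prop :=
  forall m : nat, weak_cvg (fun n => distance_distribution (X_ n) m)
                           (distance_distribution X m).

Definition gromov_vague_cvg (X_ : nat -> mms R) X : Prop :=
  countable [set r : R | 0 < r /\
    ~ gromov_weak_cvg (fun n => mms_restr (X_ n) r) (mms_restr X r)].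

Definition lower_mass X (delta r : R) : \bar R :=
  ereal_inf [set mms_measure X (cball x delta) |
    x in ball (point : X) r `&` msupport (mms_measure X)].

(* For the set of spaces {X_ i : i in I}. *)
Definition local_lower_mass_bound {I : Type} (X_ : I -> mms R) : Prop :=
  forall delta r : R, 0 < delta -> delta < r ->
    (0 < ereal_inf [set lower_mass (X_ i) delta r | i in [set: I]])%E.

Definition root_embedding {X} {E : completeMetricType R} (phi : X -> E) : Prop :=
  isometric_on (supp_root X) phi /\ phi point = point.

Definition embedded_measure {X} {E : completeMetricType R} (phi : X -> E) :
    set (borel E) -> \bar R :=
  pushforward_on (supp_root X) phi (mms_measure X).

Definition local_weak_cvg {E : completeMetricType R}
    (mu_ : nat -> set (borel E) -> \bar R) (mu : set (borel E) -> \bar R) :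
    Prop :=
  countable [set r : R | 0 <= r /\
    ~ weak_cvg (fun n => mrestr (mu_ n) (measurable_cball _ point r))
               (mrestr mu (measurable_cball _ point r))].

End mms_theory.

(* Main.v *)
(* If the embedded measures converge locally weakly in E, so do their powers, and the
   distance distributions are images of the powers under uniformly continuous maps:
   this is the direction from embeddings to Gromov-vague convergence.

   Conversely, Gromov-weak convergence of the restrictions to a ball gives, for every
   precision, finite approximate matchings between X_n and the limit. To find a
   sample of X_n that resembles a given sample b of the limit, both in its mutual
   distances and in the masses that a bump partition puts around its points, one
   integrates the L-th power of a function of the sample that peaks at b. The masses
   are themselves integrals over further sample points, so this L-th power is an
   integral against a longer distance distribution, hence converges; for L large
   some sample of X_n must come close to the peak. Along matchings of precision
   tending to 0, each X_n is joined to the limit by distances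
   F(x, y) = min_i (r_n(x, a_i) + r(b_i, y) + e_n), where e_n is replaced by 0 for the
   pair of roots so that all roots are identified; two spaces X_n and X_m are joined
   through the limit, and the completion of the union is E. Bounded Lipschitz tests
   then converge, which suffices for local weak convergence at every radius whose
   sphere is null for the limit.

   Under the lower mass bound, the limit inherits a lower bound on the mass of balls;
   a ball disjoint from the limit support would keep mass in X_n but lose it in the
   limit. Hence bounded sets of E are totally bounded, and E is Heine-Borel. *)

Require Import Defs.
From HB Require Import structures.
From mathcomp Require Import all_boot all_order all_algebra.
From mathcomp Require Import all_classical all_reals all_analysis.
From mathcomp Require Import measurable_realfun.
From mathcomp Require Import ring lra.

Import Order.TTheory GRing.Theory Num.Theory.
Import numFieldNormedType.Exports.

Set Implicit Arguments.
Unset Strict Implicit.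
Unset Printing Implicit Defensive.

Local Open Scope classical_set_scope.
Local Open Scope ring_scope.

(** * Bounded measurable functions and powers of a finite measure *)

(** Local weak convergence is never proved radius by radius. The Gromov-vague hypothesis is used
    only at chosen radii [r k > k], and one diagonal index lets radius and precision improve
    together; the exceptional radii in [E] then come from the limit measure alone. Tightness of the
    approximating spaces is not known beforehand. Instead, the mass that finitely many bumps around
    points of the limit leave uncovered is one more weight to be matched, so it is small in [X_ n]
    because it is small in the limit. The masses around a sample are not functions of its distance
    matrix; together with the distances they are reached only through polynomials in them, each
    factor costing fresh sample points. This is why a peaking power takes the place of an indicator,
    and since the square of a mean is a double integral, each factor consumes two points. Embeddings
    are isometric only on the support and the root, so integrals are compared on sets of full
    measure, and all other points are sent to the root. *)

Lemma bounded_funP T (R : realType) (f : T -> R) :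
  bounded_fun f <-> exists M : R, forall x, `|f x| <= M.
Proof.
split=> [[M [_ fM]]|[M fM]].
  by exists (`|M| + 1) => x; apply: fM => //; rewrite ltr_pwDr// ler_norm.
exists M; split; first exact: num_real.
by move=> N MN x _ /=; rewrite (le_trans (fM x))// ltW.
Qed.

Section bounded_measurable.
Context d (T : measurableType d) (R : realType).
Implicit Types f g : T -> R.

(** Against a finite measure such functions are integrable, so their integrals are real numbers and
    linearity carries no further side condition. *)
Definition bmeas f := measurable_fun setT f /\ exists M : R, forall x, `|f x| <= M.

Lemma bmeas_cst (c : R) : bmeas (fun=> c).
Proof. by split; [exact: measurable_cst|exists `|c|]. Qed.

Lemma bmeasD f g : bmeas f -> bmeas g -> bmeas (fun x => f x + g x).
Proof.
move=> [mf [M fM]] [mg [N gN]]; split; first exact: measurable_funD.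
by exists (M + N) => x; rewrite (le_trans (ler_normD _ _))// lerD.
Qed.

Lemma bmeasN f : bmeas f -> bmeas (fun x => - f x).
Proof.
move=> [mf [M fM]]; split; first exact: measurableT_comp.
by exists M => x; rewrite normrN.
Qed.

Lemma bmeasB f g : bmeas f -> bmeas g -> bmeas (fun x => f x - g x).
Proof. by move=> bf /bmeasN; exact: bmeasD. Qed.

Lemma bmeasM f g : bmeas f -> bmeas g -> bmeas (fun x => f x * g x).
Proof.
move=> [mf [M fM]] [mg [N gN]]; split; first exact: measurable_funM.
by exists (M * N) => x; rewrite normrM ler_pM.
Qed.

Lemma bmeas_sum I (r : seq I) (F : I -> T -> R) :
  (forall i, bmeas (F i)) -> bmeas (fun x => \sum_(i <- r) F i x).
Proof.
move=> bF; elim: r => [|i r ih].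
  by under eq_fun do rewrite big_nil; exact: bmeas_cst.
by under eq_fun do rewrite big_cons; exact: bmeasD.
Qed.

Lemma bmeasX f n : bmeas f -> bmeas (fun x => f x ^+ n).
Proof.
move=> bf; elim: n => [|n ih]; first exact: bmeas_cst.
by under eq_fun do rewrite exprS; exact: bmeasM.
Qed.

End bounded_measurable.

Lemma bmeas_comp d1 d2 (T1 : measurableType d1) (T2 : measurableType d2)
    (R : realType) (f : T2 -> R) (g : T1 -> T2) :
  bmeas f -> measurable_fun setT g -> bmeas (fun x => f (g x)).
Proof.
move=> [mf [M fM]] mg; split; first exact: measurableT_comp.
by exists M.
Qed.

Section finite_Rintegral.
Context d (T : measurableType d) (R : realType).
Variable mu : {finite_measure set T -> \bar R}.
Implicit Types f g : T -> R.

Definition mass : R := fine (mu setT).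

Lemma mass_ge0 : 0 <= mass.
Proof. by rewrite fine_ge0. Qed.

Lemma bmeas_integrable f : bmeas f -> mu.-integrable setT (EFin \o f).
Proof.
move=> [mf [M fM]]; apply: measurable_bounded_integrable => //.
  by rewrite -ge0_fin_numE// fin_num_measure.
by apply/bounded_funP; exists M.
Qed.

Lemma bmeas_fineK f : bmeas f -> (\int[mu]_x f x)%:E = (\int[mu]_x (f x)%:E)%E.
Proof.
by move=> bf; rewrite fineK//; exact: integrable_fin_num (bmeas_integrable bf).
Qed.

Lemma Rint_D f g : bmeas f -> bmeas g ->
  \int[mu]_x (f x + g x) = \int[mu]_x f x + \int[mu]_x g x.
Proof. by move=> bf bg; rewrite RintegralD//; exact: bmeas_integrable. Qed.

Lemma Rint_B f g : bmeas f -> bmeas g ->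
  \int[mu]_x (f x - g x) = \int[mu]_x f x - \int[mu]_x g x.
Proof. by move=> bf bg; rewrite RintegralB//; exact: bmeas_integrable. Qed.

Lemma Rint_Z c f : bmeas f -> \int[mu]_x (c * f x) = c * \int[mu]_x f x.
Proof. by move=> bf; rewrite RintegralZl//; exact: bmeas_integrable. Qed.

Lemma Rint_cst (c : R) : \int[mu]_x c = c * mass.
Proof. by rewrite Rintegral_cst. Qed.

Lemma Rint_le f g : bmeas f -> bmeas g -> (forall x, f x <= g x) ->
  \int[mu]_x f x <= \int[mu]_x g x.
Proof. by move=> bf bg fg; apply: le_Rintegral => //; exact: bmeas_integrable. Qed.

Lemma Rint_norm_le f M : bmeas f -> (forall x, `|f x| <= M) ->
  `|\int[mu]_x f x| <= M * mass.
Proof.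
move=> bf fM; rewrite -Rint_cst ler_norml -[- Rintegral _ _ _]mulN1r -Rint_Z.
  2: exact: bmeas_cst.
apply/andP; split; apply: Rint_le => //; try exact: bmeas_cst.
  by move=> x; rewrite mulN1r; have := fM x; rewrite ler_norml => /andP[].
by move=> x; have := fM x; rewrite ler_norml => /andP[].
Qed.

Lemma Rint_sum I (r : seq I) (F : I -> T -> R) : (forall i, bmeas (F i)) ->
  \int[mu]_x (\sum_(i <- r) F i x) = \sum_(i <- r) \int[mu]_x F i x.
Proof.
move=> bF; elim: r => [|i r ih].
  under eq_Rintegral do rewrite big_nil.
  by rewrite Rint_cst mul0r big_nil.
under eq_Rintegral do rewrite big_cons.
by rewrite Rint_D//; [rewrite ih big_cons|exact: bmeas_sum].
Qed.

Lemma Rint_eq_on S f g : measurable S -> mu (~` S) = 0%E -> bmeas f -> bmeas g ->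
  (forall x, S x -> f x = g x) -> \int[mu]_x f x = \int[mu]_x g x.
Proof.
move=> mS S0 bf bg fg; rewrite /Rintegral.
rewrite (negligible_integral (measurableC mS))//; last exact: bmeas_integrable.
rewrite [in RHS](negligible_integral (measurableC mS))//; last exact: bmeas_integrable.
rewrite setTD setCK; congr fine; apply: eq_integral => x.
by rewrite inE => /fg ->.
Qed.

End finite_Rintegral.

Section fubini.
Context d1 d2 (T1 : measurableType d1) (T2 : measurableType d2) (R : realType).
Variables (m1 : {finite_measure set T1 -> \bar R}).
Variables (m2 : {finite_measure set T2 -> \bar R}).

Lemma fin_num_product_measure : fin_num_fun (m1 \x m2)%E.
Proof.
move=> A mA; rewrite ge0_fin_numE//.
apply: (@le_lt_trans _ _ ((m1 \x m2)%E (setT `*` setT))).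
  by apply: le_measure; rewrite ?inE// setXTT.
rewrite product_measure1E// lte_mul_pinfty// ?fin_num_measure//.
by rewrite -ge0_fin_numE// fin_num_measure.
Qed.

Variable f : T1 * T2 -> R.
Hypothesis bf : bmeas f.

Let intf : (m1 \x m2)%E.-integrable setT (EFin \o f).
Proof.
have [mf [M fM]] := bf; apply: measurable_bounded_integrable => //.
  by rewrite -ge0_fin_numE// fin_num_product_measure.
by apply/bounded_funP; exists M.
Qed.

Lemma bmeas_section1 x : bmeas (fun y => f (x, y)).
Proof. by apply: bmeas_comp => //; exact: measurable_pair1. Qed.

Lemma bmeas_section2 y : bmeas (fun x => f (x, y)).
Proof. by apply: bmeas_comp => //; exact: measurable_pair2. Qed.

Lemma bmeas_Rint1 : bmeas (fun x => \int[m2]_y f (x, y)).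
Proof.
split.
  apply: (eq_measurable_fun (fine \o (fubini_F m2 (EFin \o f)))) => //.
  by apply: measurableT_comp => //; exact: (measurable_fubini_F intf).
have [_ [M fM]] := bf; exists (M * mass m2) => x.
by apply: Rint_norm_le => //; exact: bmeas_section1.
Qed.

Lemma bmeas_Rint2 : bmeas (fun y => \int[m1]_x f (x, y)).
Proof.
split.
  apply: (eq_measurable_fun (fine \o (fubini_G m1 (EFin \o f)))) => //.
  by apply: measurableT_comp => //; exact: (measurable_fubini_G intf).
have [_ [M fM]] := bf; exists (M * mass m1) => x.
by apply: Rint_norm_le => //; exact: bmeas_section2.
Qed.

Lemma Rint_prod1 : \int[(m1 \x m2)%E]_z f z = \int[m1]_x \int[m2]_y f (x, y).
Proof.
rewrite {1}/Rintegral -integral12_prod_meas1//; congr fine.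
apply: eq_integral => x _; rewrite bmeas_fineK//; exact: bmeas_section1.
Qed.

Lemma Rint_prod2 : \int[(m1 \x m2)%E]_z f z = \int[m2]_y \int[m1]_x f (x, y).
Proof.
rewrite {1}/Rintegral -integral21_prod_meas1//; congr fine.
apply: eq_integral => x _; rewrite bmeas_fineK//; exact: bmeas_section2.
Qed.

End fubini.

Section finite_measure_of.
Context d (T : measurableType d) (R : realType).
Variable mu : {measure set T -> \bar R}.

(** The finiteness proof is an argument so that the structure instances below can use it; the set
    function itself is [mu]. *)
Definition finite_measure_of of (mu setT < +oo)%E : set T -> \bar R := mu.

Hypothesis muT : (mu setT < +oo)%E.

HB.instance Definition _ := Measure.copy (finite_measure_of muT) mu.

Let fin : fin_num_fun (finite_measure_of muT).
Proof.
move=> A mA; rewrite ge0_fin_numE// (le_lt_trans _ muT)//.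
by apply: le_measure; rewrite ?inE.
Qed.

HB.instance Definition _ :=
  @Measure_isFinite.Build _ _ _ (finite_measure_of muT) fin.

Lemma finite_measure_pack :
  exists nu : {finite_measure set T -> \bar R}, nu = mu :> (set T -> \bar R).
Proof. by exists (finite_measure_of muT). Qed.

End finite_measure_of.

Lemma finite_measure_pushforward d1 d2 (T1 : measurableType d1)
    (T2 : measurableType d2) (R : realType) (mu : {measure set T1 -> \bar R})
    (f : T1 -> T2) : measurable_fun setT f -> (mu setT < +oo)%E ->
  exists nu : {finite_measure set T2 -> \bar R},
    nu = pushforward mu f :> (set T2 -> \bar R).
Proof.
move=> mf muT.
pose nu : {measure set T2 -> \bar R} :=
  measure_function_pushforward__canonical__measure_function_Measure mu mf.
have nuT : (nu setT < +oo)%E by rewrite /nu/= /pushforward preimage_setT.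
by have [nu' nuE] := finite_measure_pack nuT; exists nu'.
Qed.

Section power.
Context d (T : measurableType d) (R : realType).

Lemma power_measure_finite (mu : {finite_measure set T -> \bar R}) m :
  exists M : {finite_measure set (m.-tuple T) -> \bar R},
    M = power_measure mu m :> (set (m.-tuple T) -> \bar R).
Proof.
elim: m => [|m [M ME]] /=.
  pose D : {measure set (0.-tuple T) -> \bar R} := dirac [tuple].
  have DT : (D setT < +oo)%E by rewrite /D/= diracE in_setT ltry.
  by have [nu nuE] := finite_measure_pack DT; exists nu.
rewrite -ME; apply: finite_measure_pushforward.
  exact: measurable_cons.
by rewrite -ge0_fin_numE// fin_num_product_measure.
Qed.

(** [power_measure] is a bare set function; choosing a bundled finite measure equal to it gives
    access to integration and Fubini. *)
Definition mpow mu m := sval (cid (power_measure_finite mu m)).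

Lemma mpowE mu m : mpow mu m = power_measure mu m :> (set (m.-tuple T) -> \bar R).
Proof. by rewrite /mpow; case: cid. Qed.

Variable mu : {finite_measure set T -> \bar R}.

Lemma Rint_mpow0 (F : 0.-tuple T -> R) : bmeas F ->
  \int[mpow mu 0]_t F t = F [tuple].
Proof.
move=> [mF _]; rewrite /Rintegral.
rewrite (eq_measure_integral (dirac ([tuple] : 0.-tuple T))); last first.
  by move=> A mA _; exact: (congr1 (@^~ A) (mpowE mu 0)).
rewrite integral_dirac//; last exact/measurable_EFinP.
by rewrite diracE in_setT mul1e.
Qed.

Section succ.
Variables (m : nat) (F : m.+1.-tuple T -> R).
Hypothesis bF : bmeas F.

Let cons_ (p : T * m.-tuple T) := [tuple of p.1 :: p.2].

Let bF' : bmeas (F \o cons_).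
Proof. by apply: bmeas_comp => //; exact: measurable_cons. Qed.

Lemma Rint_mpowS_prod :
  \int[mpow mu m.+1]_t F t = \int[(mu \x mpow mu m)%E]_p F [tuple of p.1 :: p.2].
Proof.
rewrite /Rintegral; congr fine.
have intF : (mu \x mpow mu m)%E.-integrable setT (EFin \o F \o cons_).
  have [mF [M FM]] := bF'; apply: measurable_bounded_integrable => //.
    by rewrite -ge0_fin_numE// fin_num_product_measure.
  by apply/bounded_funP; exists M.
have mcons : measurable_fun setT cons_ by exact: measurable_cons.
pose nu : {measure set (m.+1.-tuple T) -> \bar R} :=
  measure_function_pushforward__canonical__measure_function_Measure (mu \x mpow mu m)%E mcons.
rewrite (eq_measure_integral nu); last first.
  move=> A mA _; rewrite [LHS](congr1 (@^~ A) (mpowE mu m.+1))/=.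
  by rewrite /nu/= /pushforward mpowE.
rewrite /nu/= integral_pushforward//.
by apply/measurable_EFinP; case: bF.
Qed.

Lemma bmeas_tcons x : bmeas (fun t : m.-tuple T => F [tuple of x :: t]).
Proof. exact: (bmeas_section1 bF' x). Qed.

Lemma Rint_mpowS :
  \int[mpow mu m.+1]_t F t = \int[mu]_x \int[mpow mu m]_t F [tuple of x :: t].
Proof. by rewrite Rint_mpowS_prod (Rint_prod1 _ _ bF'). Qed.

(** With the head innermost, the most recently sampled point is integrated out while the others stay
    fixed; the opposite order serves inductions on the length. *)
Lemma Rint_mpowS2 :
  \int[mpow mu m.+1]_t F t = \int[mpow mu m]_t \int[mu]_x F [tuple of x :: t].
Proof. by rewrite Rint_mpowS_prod (Rint_prod2 _ _ bF'). Qed.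

Lemma bmeas_Rint_tcons :
  bmeas (fun x => \int[mpow mu m]_t F [tuple of x :: t]).
Proof. exact: (bmeas_Rint1 mu (mpow mu m) bF'). Qed.

Lemma bmeas_Rint_tcons2 :
  bmeas (fun t : m.-tuple T => \int[mu]_x F [tuple of x :: t]).
Proof. exact: (bmeas_Rint2 mu (mpow mu m) bF'). Qed.

End succ.

Lemma mass_mpow m : mass (mpow mu m) = mass mu ^+ m.
Proof.
elim: m => [|m ih].
  have := Rint_mpow0 (bmeas_cst _ 1).
  by rewrite Rint_cst mul1r expr0.
have := Rint_mpowS (bmeas_cst (m.+1.-tuple T) 1).
by rewrite !Rint_cst !mul1r ih exprSr.
Qed.

End power.

(** * Metric spaces and their Borel measures *)

Section metric_space.
Context (R : realType) (T : metricType R).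
Implicit Types (x y z : T) (f g : T -> R).

Definition klip (k : R) f := forall x y, `|f x - f y| <= k * mdist x y.

Lemma klipB k f x y : klip k f -> f x <= f y + k * mdist x y.
Proof.
by move=> /(_ x y)/(le_trans (ler_norm _)); rewrite lerBlDl.
Qed.

Lemma klipP k f : (forall x y, f x <= f y + k * mdist x y) -> klip k f.
Proof.
move=> kf x y; rewrite ler_norml; have := kf x y; have := kf y x.
rewrite [mdist y x]metric_sym; lra.
Qed.

Lemma near_ball x e : 0 < e -> \forall y \near x, mdist x y < e.
Proof.
move=> e0; apply/nbhs_ballP; exists e => //= y; by rewrite ballEmdist.
Qed.

Lemma open_mdistP (A : set T) : open A <->
  (forall x, A x -> exists2 e, 0 < e & forall y, mdist x y < e -> A y).
Proof.
split=> [oA x Ax|Ae].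
  have /nbhs_ballP[e /= e0 eA] := open_nbhs_nbhs (conj oA Ax).
  by exists e => // y xy; apply: eA; rewrite ballEmdist.
rewrite openE => x /Ae[e e0 eA]; apply/nbhs_ballP; exists e => // y.
by rewrite ballEmdist; exact: eA.
Qed.

Lemma klip_continuous k f : klip k f -> continuous f.
Proof.
move=> kf x; apply/cvgrPdist_lt => e e0; near=> y.
rewrite (le_lt_trans (kf _ _))// (@le_lt_trans _ _ ((`|k| + 1) * mdist x y))//.
  by rewrite ler_wpM2r ?mdist_ge0// ler_wpDr// ler_norm.
rewrite mulrC -ltr_pdivlMr ?ltr_wpDl//; near: y.
by apply: near_ball; rewrite divr_gt0 ?ltr_wpDl.
Unshelve. all: by end_near. Qed.

Lemma mdist_klip x : klip 1 (mdist x).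
Proof. by apply: klipP => y z; rewrite mul1r [mdist y z]metric_sym metric_triangle. Qed.

Lemma mdist_continuous x : continuous (mdist x : T -> R).
Proof. exact: klip_continuous (mdist_klip x). Qed.

Lemma klip_min k f g : klip k f -> klip k g -> klip k (fun x => Num.min (f x) (g x)).
Proof.
move=> kf kg; apply: klipP => x y; rewrite addr_minl ge_min !le_min.
have := klipB x y kf; have := klipB x y kg.
case: (leP (f x) (g x)) => fg h1 h2; apply/orP; [left|right]; apply/andP; split => //.
  exact: le_trans fg h1.
exact: le_trans (ltW fg) h2.
Qed.

Lemma klip_max k f g : klip k f -> klip k g -> klip k (fun x => Num.max (f x) (g x)).
Proof.
move=> kf kg; apply: klipP => x y; rewrite addr_maxl ge_max !le_max.
by rewrite (klipB x y kf) (klipB x y kg) orbT.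
Qed.

Lemma klip_cst k c : 0 <= k -> klip k (fun=> c).
Proof. by move=> k0 x y; rewrite subrr normr0 mulr_ge0// mdist_ge0. Qed.

Lemma klipN k f : klip k f -> klip k (fun x => - f x).
Proof. by move=> kf x y; rewrite -opprD normrN. Qed.

Lemma klipD k l f g : klip k f -> klip l g -> klip (k + l) (fun x => f x + g x).
Proof.
by move=> kf lg x y; rewrite opprD addrACA mulrDl (le_trans (ler_normD _ _))// lerD.
Qed.

Lemma klipZ k c f : klip k f -> klip (`|c| * k) (fun x => c * f x).
Proof. by move=> kf x y; rewrite -mulrBr normrM -mulrA ler_wpM2l. Qed.

Lemma klip_le k l f : k <= l -> klip k f -> klip l f.
Proof.
by move=> kl kf x y; rewrite (le_trans (kf x y))// ler_wpM2r ?mdist_ge0.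
Qed.

End metric_space.

Section borel_topology.
Context (R : realType) (T : ptopologicalType).

Lemma open_borel (U : set T) : open U -> measurable (U : set (borel T)).
Proof. exact: sub_sigma_algebra. Qed.

Lemma closed_borel (A : set T) : closed A -> measurable (A : set (borel T)).
Proof.
move=> cA; rewrite -[A]setCK; apply: measurableC.
by apply: sub_sigma_algebra; exact: closed_openC.
Qed.

Lemma continuous_borelR (f : T -> R) : continuous f -> measurable_fun setT (f : borel T -> R).
Proof.
move=> cf; apply: (measurability _ (RGenOpens.measurableE R)).
move=> _ [_ [a [b ->]] <-]; rewrite setTI; apply: open_borel.
by move/continuousP : cf; apply; exact: interval_open.
Qed.

End borel_topology.

Section borel_metric.
Context (R : realType) (T : completeMetricType R).
Implicit Types (x y z : T) (f g : T -> R).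

Lemma open_mball x e : open [set y | mdist x y < e].
Proof.
move/continuousP: (@mdist_continuous _ _ x) => /(_ [set z | z < e]); apply.
exact: open_lt.
Qed.

Lemma bmeas_continuous f M : continuous f -> (forall x, `|f x| <= M) ->
  bmeas (f : borel T -> R).
Proof. by move=> cf fM; split; [exact: continuous_borelR|exists M]. Qed.

Lemma bmeas_klip k f M : klip k f -> (forall x, `|f x| <= M) ->
  bmeas (f : borel T -> R).
Proof. by move=> /klip_continuous; exact: bmeas_continuous. Qed.

Lemma separable_seq : separable_space T ->
  exists q : nat -> T, forall x (e : R), 0 < e -> exists n, mdist (q n) x < e.
Proof.
move=> [D /countable_injP[f finj] dD].
pose q n := if pselect (exists2 x, D x & f x = n) is left h
            then sval (cid2 h) else point.
exists q => x e e0.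
have /dD[]// : [set y | mdist x y < e] !=set0 by exists x; rewrite /= mdistxx.
  exact: open_mball.
move=> y [/= xy Dy]; exists (f y); rewrite /q; case: pselect => [h|[]]; last by exists y.
case: (cid2 h) => /= z Dz /finj ->; rewrite ?inE//; by rewrite metric_sym.
Qed.

Hypothesis sepT : separable_space T.

(** The domain carries the product of the Borel sigma-algebras, where continuity alone does not
    suffice. Separability writes [mdist x y < r] as a countable union of the conditions
    [mdist (q n) x + mdist (q n) y < r]. *)
Lemma measurable_mdist :
  measurable_fun setT (fun p : borel T * borel T => mdist (p.1 : T) (p.2 : T)).
Proof.
have [q dq] := separable_seq sepT.
apply: (measurability _ (RGenInftyO.measurableE R)) => _ [_ [r ->] <-]; rewrite setTI.
pose h n (p : borel T * borel T) := mdist (q n) (p.1 : T) + mdist (q n) (p.2 : T).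
have mh n : measurable_fun setT (h n).
  apply: measurable_funD; apply: measurableT_comp => //;
    exact: continuous_borelR (@mdist_continuous _ _ _).
rewrite (_ : _ @^-1` _ = \bigcup_n (h n @^-1` `]-oo, r[)).
  apply: bigcupT_measurable => n; rewrite -[X in measurable X]setTI.
  by apply: mh.
apply/seteqP; split => [p|p [n _]]; rewrite /= !in_itv/= /h.
  move=> pr; have [|n qn] := dq p.1 ((r - mdist (p.1 : T) (p.2 : T)) / 2).
    by rewrite divr_gt0// subr_gt0.
  exists n => //=; rewrite in_itv/=.
  have := metric_triangle (q n) p.1 p.2; lra.
apply: le_lt_trans; rewrite (le_trans (metric_triangle _ (q n) _))//.
by rewrite [mdist p.1 _]metric_sym.
Qed.

Lemma measurable_mdist_comp d (S : measurableType d) (f g : S -> borel T) :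
  measurable_fun setT f -> measurable_fun setT g ->
  measurable_fun setT (fun s => mdist (f s : T) (g s : T)).
Proof.
move=> mf mg.
exact: (measurableT_comp measurable_mdist (measurable_fun_pair mf mg)).
Qed.

End borel_metric.

(** * Support of a Borel measure *)

Section support.
Context (R : realType) (T : completeMetricType R).
Variable mu : {measure set (borel T) -> \bar R}.

Lemma closed_msupport : closed (msupport mu : set T).
Proof.
rewrite -[msupport _]setCK; apply: open_closedC; apply/open_mdistP => x.
move=> /existsNP[U /not_implyP[[oU Ux]]] U0.
have [e e0 eU] := (open_mdistP U).1 oU x Ux.
by exists e => // y /eU Uy /(_ U (conj oU Uy)); exact: U0.
Qed.

Lemma measurable_msupport : measurable (msupport mu : set (borel T)).
Proof. by apply: closed_borel; exact: closed_msupport. Qed.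

Lemma msupport_ball (x : T) e : msupport mu x -> 0 < e ->
  (0 < mu [set y | (mdist x y < e)%R])%E.
Proof.
move=> /(_ [set y | mdist x y < e]) + e0; apply; split; first exact: open_mball.
by rewrite /= mdistxx.
Qed.

Hypothesis sepT : separable_space T.

(** A point outside the support has a null neighbourhood, hence lies in a null ball whose centre
    belongs to a dense sequence and whose radius is some [1 / (k + 1)]. There are countably many
    such balls. *)
Lemma msupport_full : mu (~` msupport mu) = 0%E.
Proof.
have [q dq] := separable_seq sepT.
pose B (p : nat * nat) : set (borel T) := [set y | mdist (q p.1) y < p.2.+1%:R^-1].
have mB p : measurable (B p) by apply: open_borel; exact: open_mball.
pose N p := if mu (B p) == 0%E then B p else set0.
have sub : ~` msupport mu `<=` \bigcup_n \bigcup_k N (n, k).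
  move=> x /existsNP[U /not_implyP[[oU Ux]]] U0.
  have {U0} U0 : mu U = 0%E.
    apply/eqP; rewrite eq_le measure_ge0 andbT leNgt; exact/negP.
  have [e e0 eU] := (open_mdistP U).1 oU x Ux.
  pose k := Num.truncn (2 / e).
  have ke : k.+1%:R^-1 < e / 2.
    rewrite -[e / 2]invf_div ltf_pV2 ?posrE ?divr_gt0//.
    exact: truncnS_gt.
  have [n qn] := dq x k.+1%:R^-1 ltac:(by []).
  exists n => //; exists k => //; rewrite /N/= ifT//.
  rewrite eq_le measure_ge0 andbT -U0.
  apply: le_measure; rewrite ?inE//; first exact: open_borel.
  move=> y /= yB; apply: eU; rewrite (le_lt_trans (metric_triangle _ (q n) _))//.
  by rewrite [mdist x _]metric_sym (lt_le_trans (ltrD qn yB))// [leRHS]splitr lerD ?ltW.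
apply/eqP; rewrite eq_le measure_ge0 andbT.
have : mu.-negligible (\bigcup_n \bigcup_k N (n, k)).
  apply: negligible_bigcup => n; apply: negligible_bigcup => k.
  rewrite /N; case: eqP => [B0|_]; last exact: negligible_set0.
  by exists (B (n, k)); split.
case=> A [mA A0 NA]; rewrite -A0; apply: le_measure; rewrite ?inE//.
  by apply: measurableC; exact: measurable_msupport.
exact: subset_trans sub NA.
Qed.

End support.

Lemma Rint_dct d (T : measurableType d) (R : realType)
    (mu : {finite_measure set T -> \bar R}) (f_ : nat -> T -> R) (f : T -> R) M :
  (forall n, bmeas (f_ n)) -> bmeas f -> (forall n x, `|f_ n x| <= M) ->
  (forall x, f_ n x @[n --> \oo] --> f x) ->
  \int[mu]_x f_ n x @[n --> \oo] --> \int[mu]_x f x.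
Proof.
move=> bf_ bf fM ff; have [|||||_ _] := @dominated_convergence _ _ _ mu setT measurableT
    (fun n x => (f_ n x)%:E) (EFin \o f) (cst M%:E).
- by move=> n; apply/measurable_EFinP; case: (bf_ n).
- by apply/measurable_EFinP; case: bf.
- apply: aeW => x _; apply/fine_cvgP; split; first exact: nearW.
  exact: ff.
- exact: (bmeas_integrable mu (bmeas_cst _ M)).
- by apply: aeW => x n _; rewrite /= lee_fin.
rewrite -[X in _ --> X]bmeas_fineK//; exact: fine_cvg.
Qed.

Lemma integral_mrestr d (T : measurableType d) (R : realType)
    (mu : {measure set T -> \bar R}) (D : set T) (mD : measurable D) (f : T -> R) :
  (mu D < +oo)%E -> bmeas f -> (forall x, ~ D x -> f x = 0) ->
  (\int[mrestr mu mD]_x (f x)%:E = \int[mu]_x (f x)%:E)%E.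
Proof.
move=> muD [mf [M fM]] f0.
have intf : (mrestr mu mD).-integrable setT (EFin \o f).
  apply: measurable_bounded_integrable => //; first by rewrite /= /mrestr setTI.
  by apply/bounded_funP; exists M.
have D0 : mrestr mu mD (~` D) = 0%E by rewrite /mrestr setICl measure0.
rewrite (negligible_integral (mu := mrestr mu mD) (measurableC mD))//.
rewrite setTD setCK; transitivity (\int[mu]_(x in D) (f x)%:E)%E.
  by apply: eq_measure_integral => A mA AD; rewrite /= /mrestr setIidl.
rewrite integral_mkcond; apply: eq_integral => x _; rewrite patchE.
by case: ifPn => //; rewrite notin_setE => /f0 ->.
Qed.

(** * Restriction to balls around the root *)

Section restriction.
Context (R : realType) (E : completeMetricType R).

Definition bounded_finite (nu : {measure set (borel E) -> \bar R}) :=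
  forall r, (nu (cball point r) < +oo)%E.

Variables (nu : {measure set (borel E) -> \bar R}) (bnu : bounded_finite nu).

Lemma restr_lty r : (mrestr nu (measurable_cball E point r) setT < +oo)%E.
Proof. by rewrite /mrestr setTI. Qed.

Definition restr r : {finite_measure set (borel E) -> \bar R} :=
  finite_measure_of (restr_lty r).

Lemma restrE r : restr r = mrestr nu (measurable_cball E point r) :> (set _ -> \bar R).
Proof. by []. Qed.

Lemma Rint_restr r s (f : E -> R) : bmeas (f : borel E -> R) -> s <= r ->
  (forall x, s < mdist point x -> f x = 0) ->
  \int[restr r]_x f x = \int[nu]_x f x.
Proof.
move=> bf sr f0; congr fine; apply: integral_mrestr => // x /negP.
by rewrite -ltNge => rx; apply: f0; exact: le_lt_trans rx.
Qed.

Lemma Rint_restr_EFin s (f : E -> R) : bmeas (f : borel E -> R) ->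
  (forall x, s < mdist point x -> f x = 0) ->
  (\int[nu]_x f x)%:E = (\int[nu]_x (f x)%:E)%E.
Proof.
move=> bf f0; rewrite -(Rint_restr bf (lexx s))// bmeas_fineK//.
by apply: integral_mrestr => // x /negP; rewrite -ltNge => /f0.
Qed.

Lemma restr_cballC r : restr r (~` cball point r) = 0%E.
Proof. by rewrite restrE /mrestr setICl measure0. Qed.

Definition msphere r : set (borel E) := [set x | mdist point x = r].

Lemma measurable_sphere r : measurable (msphere r).
Proof.
rewrite (_ : msphere r = cball point r `\` [set x | mdist point x < r]).
  apply: measurableD; first exact: measurable_cball.
  by apply: open_borel; exact: open_mball.
apply/seteqP; split => x; rewrite /msphere/cball/=.
  by move=> ->; split=> //; rewrite ltxx.
by move=> [xr /negP]; rewrite -leNgt => rx; apply/eqP; rewrite eq_le xr.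
Qed.

(** A charged sphere is a jump of the mass as a function of the radius: a rational fits strictly
    between the masses of the open and the closed ball, and the jump intervals of different radii
    are disjoint. *)
Lemma countable_spheres : countable [set r | nu (msphere r) <> 0%E].
Proof.
pose F r := fine (nu (cball point r)).
pose f r := fine (nu [set x : E | mdist point x < r]).
have mo r : measurable ([set x | mdist point x < r] : set (borel E)).
  by apply: open_borel; exact: open_mball.
have fo r : (nu [set x : E | (mdist point x < r)%R] < +oo)%E.
  apply: le_lt_trans (bnu r); apply: le_measure; rewrite ?inE//.
    exact: measurable_cball.
  by move=> x /= /ltW.
have fF r : nu (msphere r) <> 0%E -> f r < F r.
  move=> r0; have : (nu (cball point r) =
      nu [set x : E | (mdist point x < r)%R] + nu (msphere r))%E.
    rewrite -measureU//; first last.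
    - apply/seteqP; split => // x [/=] + xr; rewrite xr ltxx//.
    - exact: measurable_sphere.
    congr (nu _); apply/seteqP; split => x; rewrite /cball/msphere/= le_eqVlt.
      by move=> /orP[/eqP ->|->]; [right|left].
    by move=> [->|->]; rewrite ?eqxx ?orbT.
  have rfin : nu (msphere r) \is a fin_num.
    rewrite ge0_fin_numE//; apply: le_lt_trans (bnu r); apply: le_measure.
    - by rewrite inE; exact: measurable_sphere.
    - by rewrite inE; exact: measurable_cball.
    - by move=> x /= <-; rewrite /cball/=.
  move=> /(congr1 fine); rewrite fineD//; last by rewrite ge0_fin_numE.
  rewrite -/(F r) -/(f r) => ->; rewrite ltrDl fine_gt0// -ge0_fin_numE// rfin andbT.
  by rewrite lt0e measure_ge0 andbT; apply/eqP.
have Ff r s : r < s -> F r <= f s.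
  move=> rs; apply: fine_le; rewrite ?ge0_fin_numE//.
  apply: le_measure; rewrite ?inE//; first exact: measurable_cball.
  by move=> x /= /le_lt_trans; exact.
pose q r := if pselect (nu (msphere r) <> 0%E) is left h
            then sval (cid (rat_in_itvoo (fF r h))) else 0.
apply/countable_injP; exists (pickle \o q) => r s; rewrite !inE => /= r0 s0.
move=> /(pcan_inj pickleK); rewrite /q; case: pselect => // h; case: pselect => // h'.
case: cid => /= a /[1!in_itv]/= /andP[a1 a2]; case: cid => /= b /[1!in_itv]/= /andP[b1 b2] ab.
subst b.
case: (ltgtP r s) => // /Ff rs; lra.
Qed.

End restriction.

(** * Local weak convergence is tested by Lipschitz functions *)

Section inf_convolution.
Context (R : realType) (E : metricType R) (G : E -> R).
Hypothesis G01 : forall x, 0 <= G x <= 1.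
Hypothesis lscG : forall x e, 0 < e ->
  exists2 d, 0 < d & forall y, mdist x y < d -> G x - e <= G y.

(** The Pasch-Hausdorff envelope, the largest [k]-Lipschitz minorant of [G]. *)
Definition infconv (k : nat) x := inf [set G y + k%:R * mdist x y | y in setT].

Let lb_ge0 k x : lbound [set G y + k%:R * mdist x y | y in setT] 0.
Proof.
move=> _ [y _ <-]; rewrite addr_ge0 ?mulr_ge0 ?mdist_ge0//.
by have /andP[] := G01 y.
Qed.

Let has_lb k x : has_inf [set G y + k%:R * mdist x y | y in setT].
Proof. by split; [exists (G x + k%:R * mdist x x); exists x|exists 0; exact: lb_ge0]. Qed.

Lemma infconv_le k x y : infconv k x <= G y + k%:R * mdist x y.
Proof. by apply: ge_inf; [exact: (has_lb k x).2|exists y]. Qed.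

Lemma infconv_leG k x : infconv k x <= G x.
Proof. by rewrite (le_trans (infconv_le k x x))// mdistxx mulr0 addr0. Qed.

Lemma infconv_ge0 k x : 0 <= infconv k x.
Proof. by apply: lb_le_inf; [exact: (has_lb k x).1|exact: lb_ge0]. Qed.

Lemma infconv_klip k : klip k%:R (infconv k).
Proof.
apply: klipP => x y; rewrite -lerBlDr; apply: lb_le_inf.
  exact: (has_lb k y).1.
move=> _ [z _ <-]; rewrite lerBlDr (le_trans (infconv_le k x z))// -addrA.
by rewrite lerD2l -mulrDr ler_wpM2l// addrC metric_triangle.
Qed.

(** Points closer than [d] gain at most [e] by semicontinuity; farther ones pay at least [k * d],
    which for large [k] is at least 1 and so at least [G x]. *)
Lemma infconv_cvg x : infconv k x @[k --> \oo] --> G x.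
Proof.
apply/cvgrPdist_le => e e0; have [d d0 Gd] := lscG x e0.
near=> k; rewrite ger0_norm ?subr_ge0 ?infconv_leG// lerBlDr -lerBlDl.
apply: lb_le_inf; first exact: (has_lb k x).1.
move=> _ [y _ <-]; have [xy|xy] := ltP (mdist x y) d.
  by rewrite (le_trans (Gd _ xy))// lerDl mulr_ge0// mdist_ge0.
have /andP[_ Gx1] := G01 x; have /andP[Gy0 _] := G01 y.
have : 1 <= k%:R * mdist x y.
  rewrite (@le_trans _ _ (k%:R * d))// ?ler_wpM2l// -ler_pdivrMr//.
  by near: k; exact: nbhs_infty_ger.
lra.
Unshelve. all: by end_near. Qed.

End inf_convolution.

Section portmanteau.
Context (R : realType) (E : completeMetricType R).

Definition lip_test (h : E -> R) := [/\ exists k, klip k h,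
  forall x, 0 <= h x <= 1 & exists s, forall x, s < mdist point x -> h x = 0].

Definition lip_cvg (nu_ : nat -> {measure set (borel E) -> \bar R})
    (nu : {measure set (borel E) -> \bar R}) := forall h, lip_test h ->
  \int[nu_ n]_x h x @[n --> \oo] --> \int[nu]_x h x.

Lemma lip_test_bmeas h : lip_test h -> bmeas (h : borel E -> R).
Proof.
move=> [[k kh] h01 _]; apply: (@bmeas_klip _ _ k _ 1) => // x.
by have /andP[h0 h1] := h01 x; rewrite ger0_norm.
Qed.

Lemma mass_restr (nu : {measure set (borel E) -> \bar R}) (bnu : bounded_finite nu) r s :
  r <= s -> mass (restr bnu r) = \int[restr bnu s]_x \1_(cball point r) x.
Proof.
move=> rs; rewrite (@Rint_restr _ _ _ _ s r)//.
- by rewrite /mass restrE /mrestr setTI /Rintegral integral_indic ?setIT//; exact: measurable_cball.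
- split; first by apply: measurable_indic; exact: measurable_cball.
  by exists 1 => x; rewrite indicE; case: (_ \in _); rewrite ?normr1 ?normr0.
- by move=> x rx; rewrite indicE memNset// /cball/=; apply/negP; rewrite -ltNge.
Qed.

Variables (nu_ : nat -> {measure set (borel E) -> \bar R}).
Variables (nu : {measure set (borel E) -> \bar R}).
Hypotheses (bnu_ : forall n, bounded_finite (nu_ n)) (bnu : bounded_finite nu).
Hypothesis cnu : lip_cvg nu_ nu.

(** Cut off to the open ball, [g] is lower semicontinuous, so its Lipschitz envelopes are tests
    below [g] that recover its integral in the limit. The null sphere makes the cut-off harmless for
    [nu]; for [nu_ n] the inequality between envelope and [g] is enough. *)
Lemma lip_cvg_liminf r (g : E -> R) e : nu (msphere r) = 0%E ->
  continuous g -> (forall x, 0 <= g x <= 1) -> 0 < e ->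
  \forall n \near \oo, \int[restr bnu r]_x g x - e <= \int[restr (bnu_ n) r]_x g x.
Proof.
move=> r0 cg g01 e0.
pose G x := if mdist point x < r then g x else 0.
have G01 x : 0 <= G x <= 1 by rewrite /G; case: ifPn; rewrite ?lexx ?ler01.
have Gg x : G x <= g x by rewrite /G; case: ifPn => // _; have /andP[] := g01 x.
have lscG x d : 0 < d -> exists2 c, 0 < c & forall y, mdist x y < c -> G x - d <= G y.
  move=> d0; have [xr|xr] := ltP (mdist point x) r; last first.
    exists 1 => // y _; rewrite {1}/G ltNge xr/=.
    by have /andP[] := G01 y; lra.
  have /nbhs_ballP[c /= c0 cd] : nbhs x [set y | mdist point y < r /\ g x - d <= g y].
    apply: filterI.
      by apply: open_nbhs_nbhs; split => //; exact: open_mball.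
    near=> y; suff : `|g x - g y| <= d by rewrite ler_norml; lra.
    by near: y; move: (cg x) => /cvgrPdist_le/(_ _ d0).
  exists c => // y xy; have [|yr gy] := cd y; first by rewrite ballEmdist.
  by rewrite /G xr yr.
have mG : bmeas (G : borel E -> R).
  split; last by exists 1 => x; have /andP[? ?] := G01 x; rewrite ger0_norm.
  rewrite (_ : G = (fun x => \1_[set y : E | mdist point y < r] x * g x)).
    apply: measurable_funM; last exact: continuous_borelR.
    by apply: measurable_indic; apply: open_borel; exact: open_mball.
  apply/funext => x; rewrite /G indicE; case: ifPn => xr.
    by rewrite mem_set// mul1r.
  by rewrite memNset ?mul0r//; exact/negP.
have bg : bmeas (g : borel E -> R).
  apply: (@bmeas_continuous _ _ _ 1) => // x.
  by have /andP[? ?] := g01 x; rewrite ger0_norm.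
have intG : \int[restr bnu r]_x G x = \int[restr bnu r]_x g x.
  have mo : measurable ([set x | mdist point x < r] : set (borel E)).
    by apply: open_borel; exact: open_mball.
  apply: (Rint_eq_on mo) => //; last by move=> x /= xr; rewrite /G xr.
  rewrite restrE /mrestr -r0; congr (nu _); apply/seteqP; split => x.
    by rewrite /cball/msphere/= => -[/negP]; rewrite -leNgt => *;
      apply/eqP; rewrite eq_le; apply/andP.
  by rewrite /cball/msphere/= => ->; split => //; rewrite ltxx.
have h01 k x : 0 <= infconv G k x <= 1.
  rewrite infconv_ge0// (le_trans (infconv_leG G01 k x))//.
  by have /andP[] := G01 x.
have hsupp k x : r < mdist point x -> infconv G k x = 0.
  move=> rx; apply/eqP; rewrite eq_le infconv_ge0// andbT.
  by rewrite (le_trans (infconv_leG G01 k x))// /G ltNge (ltW rx).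
have ht k : lip_test (infconv G k).
  split; [by exists k%:R; exact: infconv_klip|exact: h01|by exists r; exact: hsupp].
have e2 : 0 < e / 2 by rewrite divr_gt0.
have [k hk] : exists k, \int[restr bnu r]_x g x - e / 2 <= \int[nu]_x infconv G k x.
  have : \int[restr bnu r]_x infconv G n x @[n --> \oo] --> \int[restr bnu r]_x G x.
    apply: (@Rint_dct _ _ _ _ _ _ 1) => //.
    - by move=> n; exact: lip_test_bmeas.
    - by move=> n x; have /andP[? ?] := h01 n x; rewrite ger0_norm.
    - by move=> x; exact: infconv_cvg.
  move=> /cvgrPdist_le/(_ _ e2)[k _ /(_ k (leqnn k))] /=.
  rewrite intG ler_norml => /andP[_ hk]; exists k.
  rewrite -(Rint_restr bnu (lip_test_bmeas (ht k)) (lexx r)); last exact: hsupp.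
  by lra.
have := cnu (ht k) => /cvgrPdist_le/(_ _ e2); apply: filterS => n.
rewrite ler_norml => /andP[_ hn].
have : \int[nu_ n]_x infconv G k x <= \int[restr (bnu_ n) r]_x g x.
  rewrite -(Rint_restr (bnu_ n) (lip_test_bmeas (ht k)) (lexx r)); last exact: hsupp.
  apply: Rint_le => //; first exact: lip_test_bmeas.
  by move=> x; rewrite (le_trans (infconv_leG G01 k x)).
lra.
Unshelve. all: by end_near. Qed.

(** The tests [h k] are 1 on the closed ball and fall to 0 within a further distance [1 / (k + 1)];
    they dominate the indicator of the ball and converge to it. *)
Lemma lip_cvg_limsup_mass r e : 0 < e ->
  \forall n \near \oo, mass (restr (bnu_ n) r) <= mass (restr bnu r) + e.
Proof.
move=> e0.
pose h k (x : E) := Num.max 0 (1 - k.+1%:R * Num.max 0 (mdist point x - r)).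
have hk k : klip k.+1%:R (h k).
  apply: klip_max; first exact: klip_cst.
  rewrite -[X in klip X]add0r; apply: klipD; first exact: klip_cst.
  apply: klipN; rewrite -[X in klip X]mulr1 -{1}[k.+1%:R]ger0_norm//.
  apply: klipZ; apply: klip_max; first exact: klip_cst.
  rewrite -[X in klip X]addr0; apply: klipD; last exact: klip_cst.
  exact: mdist_klip.
have h01 k x : 0 <= h k x <= 1.
  rewrite /h le_max lexx/= ge_max ler01/= gerBl mulr_ge0//.
  by rewrite le_max lexx.
have hin k x : mdist point x <= r -> h k x = 1.
  by move=> xr; rewrite /h [Num.max 0 (mdist _ _ - _)]max_l ?subr_le0// mulr0 subr0 max_r.
have hout k x : k.+1%:R * (mdist point x - r) >= 1 -> h k x = 0.
  move=> kx; rewrite /h max_l// subr_le0 (le_trans kx)// ler_wpM2l//.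
  by rewrite le_max lexx orbT.
have hsupp k x : r + 1 < mdist point x -> h k x = 0.
  move=> rx; apply: hout; have h1 : 1 <= mdist point x - r by rewrite lerBrDl ltW.
  by rewrite (le_trans h1)// ler_peMl ?ler1n// (le_trans ler01).
have ht k : lip_test (h k).
  by split; [exists k.+1%:R|exact: h01|exists (r + 1); exact: hsupp].
have e2 : 0 < e / 2 by rewrite divr_gt0.
have bI : bmeas (\1_(cball point r : set (borel E)) : _ -> R).
  split; first by apply: measurable_indic; exact: measurable_cball.
  by exists 1 => x; rewrite indicE; case: (_ \in _); rewrite ?normr1 ?normr0.
have rr1 : r <= r + 1 by rewrite lerDl.
have [k hk2] : exists k, \int[nu]_x h k x <= mass (restr bnu r) + e / 2.
  have : \int[restr bnu (r + 1)]_x h n x @[n --> \oo] -->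
      \int[restr bnu (r + 1)]_x \1_(cball point r) x.
    apply: (@Rint_dct _ _ _ _ _ _ 1) => //.
    - by move=> n; exact: lip_test_bmeas.
    - by move=> n x; have /andP[? ?] := h01 n x; rewrite ger0_norm.
    - move=> x; rewrite indicE; have [xr|xr] := leP (mdist point x) r.
        rewrite mem_set//; under eq_fun do rewrite hin//; exact: cvg_cst.
      rewrite memNset; last by rewrite /cball/= leNgt xr.
      apply/cvgrPdist_le => d d0; near=> n; rewrite hout ?subrr ?normr0; [exact: ltW|].
      rewrite -ler_pdivrMr ?subr_gt0// (@le_trans _ _ n%:R) ?ler_nat//.
      by near: n; exact: nbhs_infty_ger.
  move=> /cvgrPdist_le/(_ _ e2)[k _ /(_ k (leqnn k))] /=.
  rewrite -mass_restr// ler_norml => /andP[hk2 _]; exists k.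
  rewrite -(Rint_restr bnu (lip_test_bmeas (ht k)) (lexx (r + 1))); last exact: hsupp.
  by lra.
have := cnu (ht k) => /cvgrPdist_le/(_ _ e2); apply: filterS => n.
rewrite ler_norml => /andP[hn _].
have : mass (restr (bnu_ n) r) <= \int[nu_ n]_x h k x.
  rewrite (mass_restr _ rr1).
  rewrite -(Rint_restr (bnu_ n) (lip_test_bmeas (ht k)) (lexx (r + 1))); last exact: hsupp.
  apply: Rint_le => //; first exact: lip_test_bmeas.
  move=> x; rewrite indicE; have [xr|xr] := leP (mdist point x) r.
    by rewrite mem_set// hin.
  rewrite memNset; first by have /andP[] := h01 k x.
  by rewrite /cball/= leNgt xr.
lra.
Unshelve. all: by end_near. Qed.

Lemma lip_cvg_weak r : nu (msphere r) = 0%E ->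
  forall f : E -> R, continuous f -> bounded_fun f ->
  \int[restr (bnu_ n) r]_x f x @[n --> \oo] --> \int[restr bnu r]_x f x.
Proof.
move=> r0.
(* The lower bound for [1 - g], combined with the upper bound on the masses, is the upper bound for
   [g]. *)
have unit (g : E -> R) : continuous g -> (forall x, 0 <= g x <= 1) ->
    \int[restr (bnu_ n) r]_x g x @[n --> \oo] --> \int[restr bnu r]_x g x.
  move=> cg g01; apply/cvgrPdist_le => e e0.
  have e2 : 0 < e / 2 by rewrite divr_gt0.
  have bg : bmeas (g : borel E -> R).
    apply: (@bmeas_continuous _ _ _ 1) => // x.
    by have /andP[? ?] := g01 x; rewrite ger0_norm.
  have c1g : continuous (fun x => 1 - g x) by move=> x; apply: cvgB; [exact: cvg_cst|exact: cg].
  have g01' x : 0 <= 1 - g x <= 1 by have := g01 x; lra.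
  near=> n.
  have h1 : \int[restr bnu r]_x g x - e / 2 <= \int[restr (bnu_ n) r]_x g x.
    by near: n; exact: lip_cvg_liminf.
  have : \int[restr bnu r]_x (1 - g x) - e / 2 <= \int[restr (bnu_ n) r]_x (1 - g x).
    by near: n; exact: lip_cvg_liminf.
  have : mass (restr (bnu_ n) r) <= mass (restr bnu r) + e / 2.
    by near: n; exact: lip_cvg_limsup_mass.
  rewrite !Rint_B//; try exact: bmeas_cst.
  rewrite !Rint_cst ler_norml; lra.
move=> f cf /bounded_funP[M fM].
(* An affine change brings a bounded function into [[0, 1]]; the constant that it adds is integrated
   as the unit function. *)
pose N := `|M| + 1.
have N0 : 0 < N by rewrite ltr_wpDl.
pose g x := (f x + N) / (2 * N).
have cg : continuous g.
  by move=> x; apply: cvgMl; apply: cvgD; [exact: cf|exact: cvg_cst].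
have g01 x : 0 <= g x <= 1.
  have : `|f x| <= N by rewrite (le_trans (fM x))// ler_wpDr// ler_norm.
  by rewrite ler_norml /g => /andP[? ?]; rewrite divr_ge0 ?ler_pdivrMr; lra.
have bg : bmeas (g : borel E -> R).
  apply: (@bmeas_continuous _ _ _ 1) => // x.
  by have /andP[? ?] := g01 x; rewrite ger0_norm.
have fE (m : {finite_measure set (borel E) -> \bar R}) :
    \int[m]_x f x = 2 * N * \int[m]_x g x - N * \int[m]_x 1.
  have b1 : bmeas (fun _ : borel E => 1 : R) by exact: bmeas_cst.
  rewrite -(Rint_Z m (2 * N) bg) -(Rint_Z m N b1) -Rint_B.
  - by apply: eq_Rintegral => x _; rewrite /g; field; rewrite gt_eqF.
  - by apply: bmeasM => //; exact: bmeas_cst.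
  - by apply: bmeasM => //; exact: bmeas_cst.
under eq_fun do rewrite fE.
rewrite fE; apply: cvgB; apply: cvgMr; apply: unit => //.
  by move=> x; exact: cvg_cst.
by move=> x; rewrite ler01 lexx.
Unshelve. all: by end_near. Qed.

Lemma lip_cvg_local_weak : local_weak_cvg (fun n => nu_ n : set (borel E) -> \bar R) nu.
Proof.
apply: sub_countable (countable_spheres bnu); apply: subset_card_le.
move=> r /= [r0 rP]; apply: contra_not rP => nur f cf bf.
have [M fM] := (bounded_funP f).1 bf.
have bmf : bmeas (f : borel E -> R) by exact: bmeas_continuous fM.
change ((\int[restr (bnu_ n) r]_x (f x)%:E)%E @[n --> \oo] -->
  (\int[restr bnu r]_x (f x)%:E)%E).
under eq_fun do rewrite -(bmeas_fineK _ bmf).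
rewrite -(bmeas_fineK _ bmf); apply/fine_cvgP; split; first exact: nearW.
exact: lip_cvg_weak.
Qed.

End portmanteau.

(** * Embedded measures and vague convergence *)

(** Countable sets are Lebesgue-null, while the interval has length 1. *)
Lemma countable_avoid (R : realType) (A : set R) (x : R) : countable A ->
  exists2 r, x < r < x + 1 & ~ A r.
Proof.
move=> cA; apply: contrapT => noR.
have sub : `]x, x + 1[%classic `<=` A.
  move=> r /=; rewrite in_itv/= => xr; apply: contrapT => Ar; apply: noR.
  by exists r.
have := countable_lebesgue_measure0 (sub_countable (subset_card_le sub) cA).
rewrite lebesgue_measure_itv/= lte_fin ltrDl ltr01 -EFinD addrAC subrr add0r.
by move=> /eqP; rewrite eqe oner_eq0.
Qed.

Lemma metric_bounded_cball (R : realType) (T : metricType R) (x : T) r :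
  metric_bounded (cball x r).
Proof.
exists (r + r) => y z xy xz; rewrite (le_trans (metric_triangle _ x _))// lerD//.
by rewrite metric_sym.
Qed.

Lemma measure_setI_full d (T : measurableType d) (R : realType)
    (mu : {measure set T -> \bar R}) (S A : set T) : measurable S -> measurable A ->
  mu (~` S) = 0%E -> mu (A `&` S) = mu A.
Proof.
move=> mS mA S0; rewrite [RHS](measureDI mu mA mS) [X in _ = (X + _)%E](_ : _ = 0%E) ?add0e//.
apply/eqP; rewrite eq_le measure_ge0 andbT -S0; apply: le_measure; rewrite ?inE.
- exact: measurableD.
- exact: measurableC.
- exact: subIsetr.
Qed.

Lemma measureCI0 d (T : measurableType d) (R : realType)
    (mu : {measure set T -> \bar R}) (S A : set T) : measurable S -> measurable A ->
  mu (~` S) = 0%E -> mu (~` A) = 0%E -> mu (~` (S `&` A)) = 0%E.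
Proof.
move=> mS mA S0 A0; rewrite setCI.
have mCS := measurableC mS; have mCA := measurableC mA.
apply/eqP; rewrite eq_le measure_ge0 andbT.
have := measureU2 mu mCS mCA.
by rewrite -[X in (_ <= X)%E]/(mu (~` S) + mu (~` A))%E S0 A0 adde0.
Qed.

Section mms_lemmas.
Context (R : realType) (X : mms R).

Lemma mms_bounded_finite : bounded_finite (mms_measure X).
Proof.
move=> r; apply: mms_boundedly_finite; first exact: measurable_cball.
exact: metric_bounded_cball.
Qed.

Lemma closed_supp_root : closed (supp_root X).
Proof.
apply: closedU; first exact: closed_msupport.
rewrite (_ : [set point] = cball (point : X) 0); first exact: closed_cball.
apply/seteqP; split => x; rewrite /cball/=; first by move=> ->; rewrite mdistxx.
move=> x0; apply/esym/mdist_positivity/eqP.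
by rewrite eq_le x0 mdist_ge0.
Qed.

Lemma measurable_supp_root : measurable (supp_root X : set (borel X)).
Proof. by apply: closed_borel; exact: closed_supp_root. Qed.

Lemma supp_root_full : mms_measure X (~` supp_root X) = 0%E.
Proof.
apply/eqP; rewrite eq_le measure_ge0 andbT -(msupport_full (mms_measure X) (mms_separable X)).
apply: le_measure; rewrite ?inE.
- by apply: measurableC; exact: measurable_supp_root.
- by apply: measurableC; exact: measurable_msupport.
- by apply: subsetC; exact: subsetUl.
Qed.

Lemma supp_root_point : supp_root X point.
Proof. by right. Qed.

End mms_lemmas.

Section embedded.
Context (R : realType) (X : mms R) (E : completeMetricType R) (phi : X -> E).
Hypothesis rphi : root_embedding phi.

(** An embedding may be arbitrary, even non-measurable, off [supp_root X]; sending that part to the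
    root gives a Borel map with the same values where they matter. *)
Definition supp_ext (x : X) : E := if x \in supp_root X then phi x else point.

Lemma supp_extE x : supp_root X x -> supp_ext x = phi x.
Proof. by move=> Sx; rewrite /supp_ext mem_set. Qed.

(** On the closed set [supp_root X] the map is isometric, so there the preimage of a closed set is
    closed in [X]; elsewhere the map is constant. *)
Lemma measurable_supp_ext : measurable_fun setT (supp_ext : borel X -> borel E).
Proof.
have [iphi _] := rphi.
apply: (@measurability _ _ (borel X) (borel E) setT supp_ext open) => //.
move=> _ [U oU <-]; rewrite setTI.
pose C := supp_root X `&` phi @^-1` (~` U).
have cC : closed C.
  rewrite -[C]setCK; apply: open_closedC; apply/open_mdistP => x Cx.
  have [Sx|Sx] := pselect (supp_root X x); last first.
    have := closed_openC (@closed_supp_root _ X) => /open_mdistP/(_ x Sx)[e e0 eS].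
    by exists e => // y /eS Sy [].
  have /((open_mdistP U).1 oU)[e e0 eU] : U (phi x) by apply: contrapT => Ux; apply: Cx.
  exists e => // y xy [Sy]; apply; apply: eU; by rewrite iphi.
rewrite (_ : _ @^-1` _ = (supp_root X `\` C) `|` ((~` supp_root X) `&` [set _ | U point])).
  apply: measurableU.
    apply: measurableD; first exact: measurable_supp_root.
    exact: closed_borel.
  apply: measurableI; first by apply: measurableC; exact: measurable_supp_root.
  have [Up|Up] := pselect (U point).
    rewrite (_ : [set _ | _] = setT); first exact: measurableT.
    by apply/seteqP; split.
  rewrite (_ : [set _ | _] = set0); first exact: measurable0.
  by apply/seteqP; split.
apply/seteqP; split => x /=; rewrite /supp_ext.
  case: ifPn; rewrite ?inE ?notin_setE => Sx Ux; [left|by right].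
  by split => // -[].
move=> [[Sx Cx]|[Sx Up]]; last by rewrite memNset.
by rewrite mem_set//; apply: contrapT => Ux; apply: Cx.
Qed.

(** Restricting to [supp_root X] before pushing forward makes this equal to [embedded_measure phi]
    on every set, measurable or not. *)
Definition embedded : {measure set (borel E) -> \bar R} :=
  measure_function_pushforward__canonical__measure_function_Measure
    (mrestr (mms_measure X) (@measurable_supp_root _ X)) measurable_supp_ext.

Lemma embeddedE : embedded = embedded_measure phi :> (set _ -> \bar R).
Proof.
apply/funext => A; rewrite /embedded/= /pushforward /mrestr /embedded_measure/=.
rewrite /pushforward_on setIC; congr (mms_measure X _); apply/seteqP.
by split => x /= [Sx]; rewrite supp_extE.
Qed.

Lemma mdist_supp_ext x : supp_root X x -> mdist point (supp_ext x) = mdist point x.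
Proof.
move=> Sx; rewrite supp_extE//; case: rphi => iphi phi0.
by rewrite -phi0 iphi//; exact: supp_root_point.
Qed.

Lemma embedded_bounded_finite : bounded_finite embedded.
Proof.
move=> r; rewrite embeddedE /embedded_measure /pushforward_on.
apply: le_lt_trans (mms_bounded_finite X r); apply: le_measure.
- rewrite inE; rewrite (_ : _ `&` _ = supp_root X `&` supp_ext @^-1` cball point r).
    apply: measurableI; first exact: measurable_supp_root.
    rewrite -[Y in measurable Y]setTI; apply: measurable_supp_ext => //.
    exact: measurable_cball.
  by apply/seteqP; split => x /= [Sx]; rewrite supp_extE.
- by rewrite inE; exact: measurable_cball.
- by move=> x [Sx]; rewrite /cball/= -supp_extE// mdist_supp_ext.
Qed.

(** Embeddings preserve the distance to the root, so pushing forward commutes with cutting to a ball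
    around the root. *)
Lemma Rint_restr_embedded (h : E -> R) s : bmeas (h : borel E -> R) ->
  \int[restr embedded_bounded_finite s]_x h x =
  \int[restr (@mms_bounded_finite R X) s]_x h (supp_ext x).
Proof.
move=> bh; set m := restr (@mms_bounded_finite R X) s.
have mh : measurable_fun setT (EFin \o h : borel E -> \bar R).
  by apply/measurable_EFinP; case: bh.
have ih : m.-integrable setT (EFin \o h \o supp_ext).
  exact: (bmeas_integrable _ (bmeas_comp bh measurable_supp_ext)).
rewrite -(preimage_setT supp_ext) in ih.
have := integral_pushforward measurable_supp_ext mh ih measurableT.
rewrite preimage_setT /Rintegral => <-.
congr fine; pose nu : {measure set (borel E) -> \bar R} :=
  measure_function_pushforward__canonical__measure_function_Measure
    m measurable_supp_ext.
rewrite -[RHS]/(\int[nu]_x (h x)%:E)%E; apply: eq_measure_integral => A mA _.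
rewrite -[LHS]/(embedded (A `&` cball point s)) embeddedE.
rewrite -[RHS]/(mms_measure X (supp_ext @^-1` A `&` cball point s)).
have mextA : measurable (supp_ext @^-1` A : set (borel X)).
  by rewrite -[Y in measurable Y]setTI; exact: measurable_supp_ext.
rewrite -[RHS](measure_setI_full (@measurable_supp_root _ X))//; last 2 first.
- by apply: measurableI => //; exact: measurable_cball.
- exact: supp_root_full.
rewrite /embedded_measure /pushforward_on; congr (mms_measure X _).
apply/seteqP; split => x /= [].
  move=> Sx []; rewrite -supp_extE// /cball/= => Ax xs.
  by split => //; split => //; rewrite -mdist_supp_ext.
by move=> [Ax xs] Sx; rewrite -supp_extE//; split => //; split; rewrite // /cball/= mdist_supp_ext.
Qed.

Lemma Rint_embedded (h : E -> R) s : bmeas (h : borel E -> R) ->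
  (forall x, s < mdist point x -> h x = 0) ->
  \int[embedded]_x h x = \int[restr (@mms_bounded_finite R X) s]_x h (supp_ext x).
Proof.
by move=> bh hs; rewrite -Rint_restr_embedded// (Rint_restr _ bh (lexx s)).
Qed.

End embedded.

Lemma compact_Rbounded (R : realType) (T : topologicalType) (f : T -> R) (K : set T) :
  continuous f -> compact K -> exists M : R, forall x, K x -> `|f x| <= M.
Proof.
move=> cf cK.
have /compact_bounded[M [_ fM]] : compact (f @` K : set R^o).
  by apply: continuous_compact => //; exact: continuous_subspaceT.
exists (`|M| + 1) => x Kx; apply: (fM (`|M| + 1)); last by exists x.
by rewrite ltr_pwDr// ler_norm.
Qed.

Section vague.
Context (R : realType) (E : completeMetricType R).
Variables (nu_ : nat -> {measure set (borel E) -> \bar R}).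
Variables (nu : {measure set (borel E) -> \bar R}).
Hypotheses (bnu_ : forall n, bounded_finite (nu_ n)) (bnu : bounded_finite nu).

Let nuf_ n : set (borel E) -> \bar R := nu_ n.

(** A compact support lies in a ball around the root, and some larger radius is not exceptional; at
    that radius the restriction does not affect the integral of [f]. *)
Lemma local_weak_vague : local_weak_cvg nuf_ nu -> vague_cvg nuf_ nu.
Proof.
move=> cw f cf; set K := closure _ => cK.
have f0 x : ~ K x -> f x = 0.
  by move=> Kx; apply/eqP/negPn/negP => fx; apply: Kx; exact: subset_closure.
have [M fM] := compact_Rbounded cf cK.
have [s sM] := compact_Rbounded (@mdist_continuous _ _ (point : E)) cK.
have f00 x : `|s| < mdist point x -> f x = 0.
  move=> sx; apply: f0 => Kx; have := sM x Kx; rewrite ger0_norm ?mdist_ge0//.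
  by rewrite leNgt (le_lt_trans _ sx)// ler_norm.
have bf : forall x, `|f x| <= `|M|.
  move=> x; have [Kx|Kx] := pselect (K x); first by rewrite (le_trans (fM x Kx))// ler_norm.
  by rewrite f0// normr0.
have [r /andP[sr _] /not_andP[]] := countable_avoid `|s| cw.
  by rewrite (le_trans _ (ltW sr))// normr_ge0.
move=> /contrapT /(_ f cf); have bff : bounded_fun f by apply/bounded_funP; exists `|M|.
have mf : bmeas (f : borel E -> R) by exact: bmeas_continuous bf.
have f000 x : ~ cball point r x -> f x = 0.
  move=> /negP; rewrite -ltNge => rx; apply: f00; exact: lt_trans rx.
move=> /(_ bff); under eq_fun do rewrite (integral_mrestr _ (bnu_ _ r) mf f000).
by rewrite (integral_mrestr _ (bnu r) mf f000).
Qed.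

(** Lipschitz tests vanish outside a ball, so the Heine-Borel property makes them compactly
    supported, and they suffice for local weak convergence. *)
Lemma vague_local_weak : heine_borel E -> vague_cvg nuf_ nu -> local_weak_cvg nuf_ nu.
Proof.
move=> hbE cv; apply: lip_cvg_local_weak => // h th; have [[k kh] h01 [s hs]] := th.
have bh := lip_test_bmeas th.
have /cv : continuous h by exact: klip_continuous kh.
have hc : compact (closure [set x | h x != 0]).
  have sub : closure [set x | h x != 0] `<=` cball point s.
    rewrite closureE => x; apply; split; first exact: closed_cball.
    by move=> y /=; apply: contraNP => /negP; rewrite -ltNge => /hs ->.
  apply: hbE; first exact: closed_closure.
  have [M bM] := @metric_bounded_cball R E point s.
  by exists M => x y /sub sx /sub; exact: bM.
move=> /(_ hc); under eq_fun do rewrite -(Rint_restr_EFin (bnu_ _) bh hs).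
by rewrite -(Rint_restr_EFin bnu bh hs) => /fine_cvg.
Qed.

End vague.

(** * Distance distributions *)

HB.instance Definition _ m := Finite.copy (dist_index m)
  {ij : 'I_m.+1 * 'I_m.+1 | (ij.1 < ij.2)%N}.

Section dist_space.
Context (R : realType) (m : nat).
Local Notation I := (dist_index m).
Local Notation P := (dist_space R m).
Implicit Types p q : P.

Lemma proj_cvg p i : (q : P) i @[q --> p] --> p i.
Proof. exact: (@proj_continuous I (fun=> R) i p). Qed.

(** The index type is finite, so the boxes of the supremum distance form a base of the product
    topology. *)
Lemma nbhs_prodP p (U : set P) : nbhs p U <->
  exists2 e : R, 0 < e & forall q, (forall i, `|p i - q i| < e) -> U q.
Proof.
split=> [pU|[e e0 eU]]; last first.
  apply: (filterS eU).
  apply: (@filter_forall _ I (fun i (q : P) => `|p i - q i| < e) (nbhs p)) => i.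
  by move: e e0 {eU}; apply/cvgrPdist_lt; exact: proj_cvg.
pose B := filter_from (fun e : R => 0 < e) (fun e => [set q : P | forall i, `|p i - q i| < e]).
have fB : Filter B.
  apply: filter_from_filter; first by exists 1.
  move=> e d e0 d0; exists (Num.min e d); first by rewrite lt_min e0.
  by move=> q /= pq; split => i; have := pq i; rewrite lt_min => /andP[].
suff : B --> p by move=> /(_ _ pU)[e e0 eU]; exists e.
apply/cvg_sup => i; apply/cvg_image.
  by apply/seteqP; split => // r _; exists (fun=> r).
move=> A /nbhs_ballP[e /= e0 eA].
exists [set q : P | A (q i)].
  by exists e => // q /(_ i) pq; apply: eA.
apply/seteqP; split => [r [q Aq <-]//|r Ar]; by exists (fun=> r).
Qed.

Lemma box_nbhs p (e : R) : 0 < e -> \forall q \near p, forall i, `|p i - q i| < e.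
Proof. by move=> e0; apply/nbhs_prodP; exists e. Qed.

(** Boxes with rational centre and radius [1 / (k + 1)] form a countable base; the preimage of a box
    is a finite intersection of measurable sets. *)
Lemma measurable_prod d (S : measurableType d) (g : S -> P) :
  (forall i, measurable_fun setT (fun s => g s i)) ->
  measurable_fun setT (g : S -> borel P).
Proof.
move=> mg; apply: (@measurability _ _ S (borel P) setT g open) => //.
move=> _ [U oU <-]; rewrite setTI.
pose box (c : {ffun I -> rat} * nat) : set P :=
  [set q | forall i, `|ratr (c.1 i) - q i| < c.2.+1%:R^-1].
pose B n := if unpickle n is Some c then
  if pselect (box c `<=` U) then g @^-1` box c else set0 else set0.
rewrite (_ : g @^-1` U = \bigcup_n B n).
  apply: bigcupT_measurable => n; rewrite /B; case: (unpickle n) => [c|]; last exact: measurable0.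
  case: (pselect (box c `<=` U)) => [cU|cU]; last exact: measurable0.
  rewrite (_ : _ @^-1` _ = \bigcap_(i in [set: I])
      [set s | `|ratr (c.1 i) - g s i| < c.2.+1%:R^-1]).
    apply: fin_bigcap_measurable => // i _.
    rewrite (_ : [set s | _] =
        (fun s => `|ratr (c.1 i) - g s i|) @^-1` `]-oo, c.2.+1%:R^-1[); last first.
      by apply/seteqP; split => s /=; rewrite in_itv.
    rewrite -[Y in measurable Y]setTI; apply: (_ : measurable_fun setT _) => //.
    by apply: measurableT_comp => //; exact: measurable_funB.
  by apply/seteqP; split => [s sc i _|s sc i]; exact: sc.
apply/seteqP; split => [s Us|s [n _]]; last first.
  by rewrite /B; case: (unpickle n) => // c; case: pselect => // cU; exact: cU.
have /nbhs_prodP[e e0 eU] := open_nbhs_nbhs (conj oU Us).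
pose k := Num.truncn (2 / e).
have ke : k.+1%:R^-1 < e / 2.
  by rewrite -[e / 2]invf_div ltf_pV2 ?posrE ?divr_gt0// truncnS_gt.
have /choice[c hc] (i : I) : exists r : rat, `|ratr r - g s i| < k.+1%:R^-1.
  have [|r] := @rat_in_itvoo R (g s i) (g s i + k.+1%:R^-1); first by rewrite ltrDl.
  by rewrite in_itv/= => /andP[r1 r2]; exists r; rewrite gtr0_norm ?subr_gt0// ltrBlDl.
exists (pickle ([ffun i => c i], k)) => //; rewrite /B pickleK.
have hbox : box ([ffun i => c i], k) `<=` U.
  move=> q /= qk; apply: eU => i; have := qk i; have := hc i; rewrite ffunE => h1 h2.
  rewrite (le_lt_trans (ler_distD (ratr (c i)) _ _))// [ltRHS]splitr.
  by rewrite ltrD ?(lt_trans _ ke)// distrC.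
by case: pselect => // h i /=; rewrite ffunE.
Qed.

(** Heine's theorem on the cube, which is compact by Tychonoff. *)
Lemma unif_continuous_box (F : P -> R) (M e : R) : continuous F -> 0 < e ->
  exists2 d, 0 < d & forall p q, (forall i, `|p i| <= M) -> (forall i, `|q i| <= M) ->
    (forall i, `|p i - q i| < d) -> `|F p - F q| <= e.
Proof.
move=> cF e0.
have cK : compact [set p : P | forall i, p i \in `[- M, M]].
  by apply: (@tychonoff I (fun=> R) (fun=> [set x | x \in `[- M, M]])) => i; exact: segment_compact.
have /compact_near_coveringP cov := cK.
have [] := cov R (0^'+) (fun d p => forall q : P,
  (forall i, `|p i - q i| < d) -> `|F p - F q| <= e) _.
  move=> p _; have e2 : 0 < e / 2 by rewrite divr_gt0.
  have /nbhs_prodP[d d0 dF] : nbhs p [set q | `|F p - F q| < e / 2].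
    by move: (cF p) => /cvgrPdist_lt/(_ _ e2).
  have d2 : 0 < d / 2 by rewrite divr_gt0.
  near=> q c => /= q' qq'.
  have pq i : `|p i - (q : P) i| < d / 2 by move: i; near: q; exact: box_nbhs.
  have cd : c < d / 2 by near: c; exact: nbhs_right_lt.
  have h1 := dF q ltac:(by move=> i; rewrite (lt_trans (pq i))// ltr_pdivrMr// ltr_pMr// ltr1n).
  have h2 : `|F p - F q'| < e / 2.
    apply: dF => i; rewrite (le_lt_trans (ler_distD (q i) _ _))// [ltRHS]splitr ltrD//.
    by rewrite (lt_trans (qq' i)).
  rewrite (le_trans (ler_distD (F p) _ _))// [leRHS]splitr lerD ?ltW//.
  by rewrite distrC.
move=> d /= d0 dF; exists (d / 2); first by rewrite divr_gt0.
move=> p q pM qM pq; apply: (dF (d / 2)) => //=.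
- by rewrite /ball/= sub0r normrN gtr0_norm ?divr_gt0// ltr_pdivrMr// ltr_pMr// ltr1n.
- by rewrite divr_gt0.
- by move=> i; rewrite in_itv/= -ler_norml.
Unshelve. all: by end_near. Qed.

End dist_space.

Section distance_distributions.
Context (R : realType) (X : mms R) (m : nat).

Lemma measurable_dist_coord (ij : dist_index m) :
  measurable_fun setT (fun t : m.-tuple (borel X) => dist_matrix X m t ij).
Proof.
have mcons : measurable_fun setT
    (fun x : m.-tuple (borel X) => [tuple of (point : borel X) :: x]).
  by apply: measurable_cons => //; exact: measurable_cst.
have mt i : measurable_fun setT
    (fun x : m.-tuple (borel X) => tnth [tuple of (point : borel X) :: x] i).
  by move/measurable_fun_tnthP : mcons => /(_ i).
exact: (measurable_mdist_comp (mms_separable X) (mt (val ij).1) (mt (val ij).2)).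
Qed.

Lemma measurable_dist_matrix :
  measurable_fun setT (dist_matrix X m : m.-tuple (borel X) -> borel (dist_space R m)).
Proof. by apply: measurable_prod => ij; exact: measurable_dist_coord. Qed.

Lemma bmeas_dist_matrix (F : dist_space R m -> R) : continuous F -> bounded_fun F ->
  bmeas (fun t : m.-tuple (borel X) => F (dist_matrix X m t)).
Proof.
move=> cF /bounded_funP[M FM].
apply: (@bmeas_comp _ _ _ _ _ (F : borel (dist_space R m) -> R)).
  by split; [exact: continuous_borelR|exists M].
exact: measurable_dist_matrix.
Qed.

Lemma integral_dist_matrix (mu : {finite_measure set (borel X) -> \bar R})
    (F : dist_space R m -> R) : continuous F -> bounded_fun F ->
  (\int[pushforward (mpow mu m)
     (dist_matrix X m : m.-tuple (borel X) -> borel (dist_space R m))]_D (F D)%:E =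
   (\int[mpow mu m]_t F (dist_matrix X m t))%:E)%E.
Proof.
move=> cF /bounded_funP[M FM].
have bF : bmeas (F : borel (dist_space R m) -> R).
  by split; [exact: continuous_borelR|exists M].
have bFd := bmeas_comp bF measurable_dist_matrix.
rewrite bmeas_fineK// integral_pushforward//.
- exact: measurable_dist_matrix.
- by apply/measurable_EFinP; case: bF.
- exact: (bmeas_integrable _ bFd).
Qed.

End distance_distributions.

Notation mrestrict X r := (restr (@mms_bounded_finite _ X) r).

Lemma restr_supp_root_full (R : realType) (X : mms R) r :
  mrestrict X r (~` supp_root X) = 0%E.
Proof.
apply/eqP; rewrite eq_le measure_ge0 andbT -(supp_root_full X).
have mS := measurableC (@measurable_supp_root _ X).
by apply: le_measure; rewrite ?inE//; apply: measurableI => //; exact: measurable_cball.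
Qed.

Lemma gromov_weak_cvg_restrP (R : realType) (X_ : nat -> mms R) (X : mms R) r :
  gromov_weak_cvg (fun n => mms_restr (X_ n) r) (mms_restr X r) <->
  forall m (F : dist_space R m -> R), continuous F -> bounded_fun F ->
    \int[mpow (mrestrict (X_ n) r) m]_t F (dist_matrix (X_ n) m t) @[n --> \oo] -->
    \int[mpow (mrestrict X r) m]_t F (dist_matrix X m t).
Proof.
have dE m (Y : mms R) : distance_distribution (mms_restr Y r) m =
    pushforward (mpow (mrestrict Y r) m)
      (dist_matrix Y m : m.-tuple (borel Y) -> borel (dist_space R m)).
  by rewrite mpowE.
split=> cX m F cF bF.
  have := cX m F cF bF; under eq_fun do rewrite dE integral_dist_matrix//.
  by rewrite dE integral_dist_matrix// => /fine_cvg.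
under eq_fun do rewrite dE integral_dist_matrix//.
rewrite dE integral_dist_matrix//; apply/fine_cvgP; split; first exact: nearW.
exact: cX.
Qed.

(** * Convergence of embedded measures implies Gromov-vague convergence *)

Section bump.
Context (R : realType).

Definition bump (d s : R) := Num.min 1 (Num.max 0 (2 - s / d)).

(* A continuous partition subordinate to the balls of radius [2 d], seen through
   the vector [s] of the distances to the centres. *)
Definition rest (d : R) (s : nat -> R) (N : nat) := \prod_(j < N) (1 - bump d (s j)).

Definition part (d : R) (s : nat -> R) (i : nat) := bump d (s i) * rest d s i.

Lemma bump01 d s : 0 <= bump d s <= 1.
Proof. by rewrite /bump le_min ge_min lexx ler01 le_max lexx. Qed.

Lemma bump_near d s : 0 < d -> s <= d -> bump d s = 1.
Proof.
move=> d0 sd; apply/min_idPl; rewrite le_max; apply/orP; right.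
by rewrite lerBrDr -lerBrDl ler_pdivrMr//; lra.
Qed.

Lemma bump_far d s : 0 < d -> 2 * d <= s -> bump d s = 0.
Proof.
move=> d0 sd; rewrite /bump max_l; first by rewrite min_r.
by rewrite subr_le0 ler_pdivlMr.
Qed.

Lemma bump_lip d s t : 0 < d -> `|bump d s - bump d t| <= d^-1 * `|s - t|.
Proof.
move=> d0; have -> : d^-1 * `|s - t| = `|s / d - t / d|.
  by rewrite -mulrBl normrM mulrC [`|d^-1|]gtr0_norm ?invr_gt0.
rewrite /bump; set u := s / d; set v := t / d.
rewrite ler_norml; have := ler_norm (u - v); have := ler_norm (v - u).
rewrite distrC; case: (leP 0 (2 - u)) => hu; case: (leP 0 (2 - v)) => hv.
- case: (leP 1 (2 - u)) => ku; case: (leP 1 (2 - v)) => kv; lra.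
- case: (leP 1 (2 - u)) => ku; case: (leP 1 0) => kv; lra.
- case: (leP 1 0) => ku; case: (leP 1 (2 - v)) => kv; lra.
- by have := normr_ge0 (u - v); case: (leP 1 0) => ku; lra.
Qed.

Lemma rest01 d s N : 0 <= rest d s N <= 1.
Proof.
rewrite /rest; elim: N => [|N ih]; first by rewrite big_ord0 ler01 lexx.
rewrite big_ord_recr/=; have := bump01 d (s N).
move: ih; set a := \prod_(_ < _) _ => /andP[a0 a1] /andP[b0 b1].
by rewrite mulr_ge0 ?subr_ge0//= mulr_ile1 ?subr_ge0// gerBl.
Qed.

Lemma part01 d s i : 0 <= part d s i <= 1.
Proof.
have /andP[? ?] := rest01 d s i; have /andP[? ?] := bump01 d (s i).
by rewrite /part mulr_ge0//= mulr_ile1.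
Qed.

(** [part d s i] equals [rest d s i - rest d s i.+1], so the sum telescopes. *)
Lemma sum_part d s N : \sum_(i < N) part d s i + rest d s N = 1.
Proof.
elim: N => [|N ih]; first by rewrite /rest !big_ord0 add0r.
rewrite big_ord_recr/= /part -[RHS]ih /rest big_ord_recr/=; ring.
Qed.

Lemma part_far d s i : 0 < d -> 2 * d <= s i -> part d s i = 0.
Proof. by move=> d0 sd; rewrite /part bump_far// mul0r. Qed.

Lemma rest_near d s N i : 0 < d -> (i < N)%N -> s i <= d -> rest d s N = 0.
Proof.
move=> d0 iN si; rewrite /rest (bigD1 (Ordinal iN))//= bump_near// subrr.
by rewrite mul0r.
Qed.

Lemma rest_lip d s t N e : 0 < d -> (forall i, (i < N)%N -> `|s i - t i| <= e) ->
  `|rest d s N - rest d t N| <= d^-1 * e *+ N.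
Proof.
move=> d0 ste; elim: N ste => [|N ih] ste.
  by rewrite /rest !big_ord0 subrr normr0 mulr0n.
rewrite /rest !big_ord_recr/= -!/(rest d _ N).
have {}ih := ih (fun i iN => ste i (leqW iN)).
have hb : `|bump d (s N) - bump d (t N)| <= d^-1 * e.
  by rewrite (le_trans (bump_lip _ _ _))// ler_wpM2l ?invr_ge0 ?(ltW d0)// ste.
have /andP[r0 r1] := rest01 d t N; have /andP[b0 b1] := bump01 d (s N).
rewrite (_ : _ - _ = (rest d s N - rest d t N) * (1 - bump d (s N)) +
  rest d t N * (bump d (t N) - bump d (s N))); last by ring.
rewrite mulrSr (le_trans (ler_normD _ _))// lerD// normrM.
  rewrite (le_trans _ ih)// ler_piMr// ger0_norm ?subr_ge0// gerBl//.
by rewrite (le_trans _ hb)// distrC ler_piMl// ger0_norm.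
Qed.

Lemma part_lip d s t N i e : 0 < d -> (forall i, (i < N)%N -> `|s i - t i| <= e) ->
  (i < N)%N -> `|part d s i - part d t i| <= d^-1 * e *+ i.+1.
Proof.
move=> d0 ste iN; have E u : part d u i = rest d u i - rest d u i.+1.
  by rewrite /part /rest big_ord_recr/=; ring.
have hb : `|bump d (s i) - bump d (t i)| <= d^-1 * e.
  by rewrite (le_trans (bump_lip _ _ _))// ler_wpM2l ?invr_ge0 ?(ltW d0)// ste.
have hr := rest_lip d0 (fun j ji => ste j (ltn_trans ji iN)).
have /andP[r0 r1] := rest01 d t i; have /andP[b0 b1] := bump01 d (s i).
rewrite (_ : _ - _ = (rest d s i - rest d t i) * bump d (s i) +
  rest d t i * (bump d (s i) - bump d (t i))); last by rewrite /part; ring.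
rewrite mulrSr (le_trans (ler_normD _ _))// lerD// normrM.
  by rewrite (le_trans _ hr)// ler_piMr// ger0_norm.
by rewrite (le_trans _ hb)// ler_piMl// ger0_norm.
Qed.

End bump.

Lemma bmeas_indic d (T : measurableType d) (R : realType) (A : set T) :
  measurable A -> bmeas (\1_A : T -> R).
Proof.
move=> mA; split; first exact: measurable_indic.
by exists 1 => x; rewrite indicE; case: (_ \in _); rewrite ?normr1 ?normr0.
Qed.

Lemma Rint_norm_le_on d (T : measurableType d) (R : realType)
    (mu : {finite_measure set T -> \bar R}) (S : set T) (f g : T -> R) :
  measurable S -> mu (~` S) = 0%E -> bmeas f -> bmeas g ->
  (forall x, S x -> `|f x| <= g x) -> `|\int[mu]_x f x| <= \int[mu]_x g x.
Proof.
move=> mS S0 bf bg fg.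
have bI : bmeas (\1_S : T -> R) by exact: bmeas_indic.
have E h : bmeas h -> \int[mu]_x h x = \int[mu]_x (\1_S x * h x).
  move=> bh; apply: (Rint_eq_on mS) => //; first exact: bmeasM.
  by move=> x Sx; rewrite indicE mem_set// mul1r.
rewrite (E f)// (E g)//; have := bmeasM bI bf; have := bmeasM bI bg => bG bF.
have h x : `|\1_S x * f x| <= \1_S x * g x.
  rewrite indicE; have [Sx|Sx] := pselect (S x).
    by rewrite mem_set// !mul1r fg.
  by rewrite memNset// !mul0r normr0.
rewrite ler_norml -[- Rintegral _ _ _]mulN1r -Rint_Z//; apply/andP; split.
  apply: Rint_le => //; first exact: bmeasM (bmeas_cst _ _) bG.
  by move=> x; rewrite mulN1r; have := h x; rewrite ler_norml => /andP[].
by apply: Rint_le => // x; rewrite (le_trans (ler_norm _)).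
Qed.

Section partition.
Context (R : realType) (T : completeMetricType R).
Implicit Types (q : nat -> T) (mu : {finite_measure set (borel T) -> \bar R}).

Definition dists q (y : T) i := mdist (q i) y.

Lemma continuous_bump d (c : T) : 0 < d -> continuous (fun y => bump d (mdist c y)).
Proof.
move=> d0; apply: (@klip_continuous _ _ d^-1) => x y.
rewrite (le_trans (bump_lip _ _ _))// ler_wpM2l ?invr_ge0 ?(ltW d0)//.
by rewrite (le_trans (mdist_klip _ _ _))// mul1r.
Qed.

Lemma continuous_rest d q N : 0 < d -> continuous (fun y => rest d (dists q y) N).
Proof.
move=> d0; elim: N => [|N ih].
  by rewrite /rest; under eq_fun do rewrite big_ord0; move=> x; exact: cvg_cst.
rewrite /rest; under eq_fun do rewrite big_ord_recr/=.
move=> x; apply: cvgM; first exact: ih.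
by apply: cvgB; [exact: cvg_cst|exact: continuous_bump].
Qed.

Lemma continuous_part d q i : 0 < d -> continuous (fun y => part d (dists q y) i).
Proof.
move=> d0 x; apply: cvgM; first exact: continuous_bump.
exact: continuous_rest.
Qed.

Lemma bmeas_rest d q N : 0 < d -> bmeas (fun y : borel T => rest d (dists q y) N).
Proof.
move=> d0; apply: (@bmeas_continuous _ _ _ 1); first exact: continuous_rest.
by move=> x; have /andP[? ?] := rest01 d (dists q x) N; rewrite ger0_norm.
Qed.

Lemma bmeas_part d q i : 0 < d -> bmeas (fun y : borel T => part d (dists q y) i).
Proof.
move=> d0; apply: (@bmeas_continuous _ _ _ 1); first exact: continuous_part.
by move=> x; have /andP[? ?] := part01 d (dists q x) i; rewrite ger0_norm.
Qed.

(** A Riemann sum. Where [part d (dists q x) i] is nonzero, [x] is within [2 * d] of [q i], and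
    replacing [H x] by [c i] costs [e]; on the uncovered remainder only the bound [K] is used. *)
Lemma Rint_part mu (S : set (borel T)) d q N (H : T -> R) (c : nat -> R) e K :
  measurable S -> mu (~` S) = 0%E -> bmeas (H : borel T -> R) -> 0 < d -> 0 <= e ->
  (forall x, S x -> `|H x| <= K) ->
  (forall i x, (i < N)%N -> S x -> mdist (q i) x <= 2 * d -> `|H x - c i| <= e) ->
  `|\int[mu]_x H x - \sum_(i < N) c i * \int[mu]_x part d (dists q x) i| <=
    e * mass mu + K * \int[mu]_x rest d (dists q x) N.
Proof.
move=> mS S0 bH d0 e0 HK Hc.
have bp i : bmeas (fun y : borel T => part d (dists q y) i) by exact: bmeas_part.
have br : bmeas (fun y : borel T => rest d (dists q y) N) by exact: bmeas_rest.
have bcp i : bmeas (fun y : borel T => c i * part d (dists q y) i).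
  by apply: bmeasM => //; exact: bmeas_cst.
under eq_bigr do rewrite -Rint_Z//.
rewrite -Rint_sum; last by move=> i; exact: bcp.
rewrite -Rint_B//; last by apply: bmeas_sum => i; exact: bcp.
rewrite -Rint_cst -Rint_Z// -Rint_D//; last 2 first.
- exact: bmeas_cst.
- by apply: bmeasM => //; exact: bmeas_cst.
apply: (Rint_norm_le_on mS) => //.
- by apply: bmeasB => //; apply: bmeas_sum => i; exact: bcp.
- by apply: bmeasD; [exact: bmeas_cst|apply: bmeasM => //; exact: bmeas_cst].
move=> x Sx; have := sum_part d (dists q x) N => sp.
have -> : H x - \sum_(i < N) c i * part d (dists q x) i =
    \sum_(i < N) (H x - c i) * part d (dists q x) i + H x * rest d (dists q x) N.
  under [in RHS]eq_bigr do rewrite mulrBl.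
  rewrite sumrB -mulr_sumr; move: sp; set a := \sum_(_ < _) part _ _ _ => sp.
  by rewrite -[in LHS](mulr1 (H x)) -[in LHS]sp; ring.
have /andP[r0 _] := rest01 d (dists q x) N.
rewrite (le_trans (ler_normD _ _))// lerD//; last first.
  by rewrite normrM ler_pM// ?HK// ger0_norm.
apply: (@le_trans _ _ (\sum_(i < N) e * part d (dists q x) i)).
  rewrite (le_trans (ler_norm_sum _ _ _))//; apply: ler_sum => i _.
  have /andP[p0 _] := part01 d (dists q x) i.
  rewrite normrM [X in _ * X]ger0_norm//.
  have [xd|xd] := leP (2 * d) (mdist (q i) x).
    by rewrite part_far// !mulr0.
  by rewrite ler_wpM2r// Hc// ltW.
by rewrite -mulr_sumr ler_piMr// -sp lerDl.
Qed.

(** By density [rest] is eventually 0 at each point of [S], so dominated convergence applies. This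
    expresses the tightness of a single measure. *)
Lemma Rint_rest_cvg0 mu (S : set (borel T)) d q :
  measurable S -> mu (~` S) = 0%E -> 0 < d ->
  (forall x (e : R), S x -> 0 < e -> exists n, mdist (q n) x < e) ->
  \int[mu]_x rest d (dists q x) N @[N --> \oo] --> (0 : R).
Proof.
move=> mS S0 d0 dq; rewrite -[X in _ --> X](mul0r (mass mu)) -Rint_cst.
have bI : bmeas (\1_S : borel T -> R).
  split; first exact: measurable_indic.
  by exists 1 => x; rewrite indicE; case: (_ \in _); rewrite ?normr1 ?normr0.
have br N : bmeas (fun y : borel T => rest d (dists q y) N) by exact: bmeas_rest.
have brI N : bmeas (fun x : borel T => \1_S x * rest d (dists q x) N) by exact: bmeasM.
rewrite (_ : (fun N => _) = fun N => \int[mu]_x (\1_S x * rest d (dists q x) N)); last first.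
  apply/funext => N; apply: (Rint_eq_on mS) => // x Sx.
  by rewrite indicE mem_set// mul1r.
apply: (@Rint_dct _ _ _ _ _ _ 1) => //.
- exact: bmeas_cst.
- move=> N x; have /andP[? ?] := rest01 d (dists q x) N.
  rewrite normrM [X in _ * X]ger0_norm// indicE.
  by case: (_ \in _); rewrite ?normr1 ?normr0 ?mul1r ?mul0r.
move=> x; apply/cvgrPdist_le => e e0.
have [Sx|Sx] := pselect (S x); last first.
  by near=> N; rewrite indicE memNset// mul0r subrr normr0 ltW.
have [n qn] := dq x d Sx d0; near=> N.
rewrite (@rest_near _ _ _ _ n)//; first by rewrite mulr0 subrr normr0 ltW.
- by near: N; exact: nbhs_infty_gt.
- exact: ltW.
Unshelve. all: by end_near. Qed.

End partition.

(** * Weak convergence of powers *)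

Section weak_products.
Context (R : realType) (T : completeMetricType R).
Hypothesis sepT : separable_space T.
Variables (nu_ : nat -> {finite_measure set (borel T) -> \bar R}).
Variables (nu : {finite_measure set (borel T) -> \bar R}).
Hypothesis wnu : forall f : T -> R, continuous f -> bounded_fun f ->
  \int[nu_ n]_x f x @[n --> \oo] --> \int[nu]_x f x.

Lemma weak_mass : mass (nu_ n) @[n --> \oo] --> mass nu.
Proof.
have c1 : continuous (fun _ : T => 1 : R) by move=> x; exact: cvg_cst.
have b1 : bounded_fun (fun _ : T => 1 : R).
  by apply/bounded_funP; exists 1 => x; rewrite normr1.
have := wnu c1 b1; rewrite Rint_cst mul1r.
by under eq_fun do rewrite Rint_cst mul1r.
Qed.

(** Weak convergence with a varying integrand: equicontinuity lets one finite Riemann sum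
    approximate all the integrals, and in that sum both the weights and the finitely many values
    [H_ n (q i)] converge. *)
Lemma Rint_cvg_equicontinuous (H_ : nat -> T -> R) (H : T -> R) (K : R) :
  (forall n, bmeas (H_ n : borel T -> R)) -> bmeas (H : borel T -> R) ->
  (\forall n \near \oo, forall x, `|H_ n x| <= K) -> (forall x, `|H x| <= K) ->
  (forall e : R, 0 < e -> exists2 d : R, 0 < d & (\forall n \near \oo,
     forall x y, mdist x y < d -> `|H_ n x - H_ n y| <= e) /\
     forall x y, mdist x y < d -> `|H x - H y| <= e) ->
  (forall x, H_ n x @[n --> \oo] --> H x) ->
  \int[nu_ n]_x H_ n x @[n --> \oo] --> \int[nu]_x H x.
Proof.
move=> bH_ bH K_ KH equi HH; have [q dq] := separable_seq sepT.
have K0 : 0 <= K by rewrite (le_trans _ (KH point)).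
apply/cvgrPdist_le => e0 e00; pose C := mass nu + 1.
have C0 : 0 < C by rewrite ltr_wpDl// mass_ge0.
(* The two Riemann errors cost at most [2 * C * e], the two remainders [K * e] and [K * 2 * e], and
   the difference of the sums [e]. *)
pose e := e0 / (2 * C + 3 * K + 1); have D0 : 0 < 2 * C + 3 * K + 1 by lra.
have e_gt0 : 0 < e by rewrite divr_gt0.
have [d d0 [equi_ equiH]] := equi e e_gt0.
(* A bump of scale [c] reaches to [2 * c], which has to stay below [d]. *)
pose c := d / 3; have c0 : 0 < c by rewrite divr_gt0.
have [N rN] : exists N, \int[nu]_x rest c (dists q x) N <= e.
  have := @Rint_rest_cvg0 _ _ nu setT c q measurableT ltac:(by rewrite setCT measure0) c0
    (fun x e _ => dq x e) => /cvgrPdist_le/(_ e e_gt0)[N _ /(_ N (leqnn _))] /=.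
  by rewrite sub0r normrN => /(le_trans (ler_norm _)); exists N.
have bp1 i : bounded_fun (fun y => part c (dists q y) i).
  by apply/bounded_funP; exists 1 => y;
    have /andP[? ?] := part01 c (dists q y) i; rewrite ger0_norm.
have br1 : bounded_fun (fun y => rest c (dists q y) N).
  by apply/bounded_funP; exists 1 => y;
    have /andP[? ?] := rest01 c (dists q y) N; rewrite ger0_norm.
have cr := wnu (@continuous_rest _ _ c q N c0) br1.
have cS : \sum_(i < N) H_ n (q i) * \int[nu_ n]_x part c (dists q x) i @[n --> \oo] -->
    \sum_(i < N) H (q i) * \int[nu]_x part c (dists q x) i.
  apply: cvg_big => [|i _]; [exact: add_continuous|apply: cvgM]; first exact: HH.
  exact: wnu (@continuous_part _ _ c q i c0) (bp1 i).
have near2 x i : mdist (q i) x <= 2 * c -> mdist x (q i) < d.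
  by rewrite metric_sym /c; lra.
have h : `|\int[nu]_x H x - \sum_(i < N) H (q i) * \int[nu]_x part c (dists q x) i| <=
    e * mass nu + K * \int[nu]_x rest c (dists q x) N.
  apply: (@Rint_part _ _ _ setT _ _ _ _ (H \o q)) => //; first by rewrite setCT measure0.
  - exact: ltW.
  - by move=> i x _ _ xi; apply: equiH; exact: near2.
near=> n.
have En : forall x y, mdist x y < d -> `|H_ n x - H_ n y| <= e by near: n.
have Kn : forall x, `|H_ n x| <= K by near: n.
have hn : `|\int[nu_ n]_x H_ n x - \sum_(i < N) H_ n (q i) * \int[nu_ n]_x part c (dists q x) i| <=
    e * mass (nu_ n) + K * \int[nu_ n]_x rest c (dists q x) N.
  apply: (@Rint_part _ _ _ setT _ _ _ _ (H_ n \o q)) => //; first by rewrite setCT measure0.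
  - exact: ltW.
  - by move=> i x _ _ xi; apply: En; exact: near2.
have mn : mass (nu_ n) <= C.
  have : `|mass nu - mass (nu_ n)| <= 1.
    by near: n; move/cvgrPdist_le : weak_mass; exact.
  by rewrite ler_norml /C; lra.
have rn : \int[nu_ n]_x rest c (dists q x) N <= 2 * e.
  have : `|\int[nu]_x rest c (dists q x) N - \int[nu_ n]_x rest c (dists q x) N| <= e.
    by near: n; move/cvgrPdist_le : cr; exact.
  by rewrite ler_norml; lra.
have sn : `|\sum_(i < N) H (q i) * \int[nu]_x part c (dists q x) i -
    \sum_(i < N) H_ n (q i) * \int[nu_ n]_x part c (dists q x) i| <= e.
  by near: n; move/cvgrPdist_le : cS; exact.
have -> : e0 = e * (2 * C + 3 * K + 1) by rewrite /e divfK// gt_eqF.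
have k1 : K * \int[nu]_x rest c (dists q x) N <= K * e by rewrite ler_wpM2l.
have k2 : K * \int[nu_ n]_x rest c (dists q x) N <= K * (2 * e) by rewrite ler_wpM2l.
have k3 : e * mass nu <= e * C by rewrite ler_wpM2l ?(ltW e_gt0)// /C; lra.
have k4 : e * mass (nu_ n) <= e * C by rewrite ler_wpM2l ?(ltW e_gt0).
move: h hn sn; rewrite !ler_norml => /andP[h1 h2] /andP[h3 h4] /andP[h5 h6].
apply/andP; split; lra.
Unshelve. all: by end_near. Qed.

Definition tunif m (G : m.-tuple T -> R) := forall e : R, 0 < e -> exists2 d : R, 0 < d &
  forall s t, (forall i, mdist (tnth s i) (tnth t i) < d) -> `|G s - G t| <= e.

(** By induction the integral over the tail converges for each value of the head. As the masses are
    eventually bounded, these integrals are uniformly bounded and equicontinuous in the head, so the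
    statement on varying integrands applies. *)
Lemma weak_mpow m (G : m.-tuple T -> R) : bmeas (G : m.-tuple (borel T) -> R) ->
  tunif G -> \int[mpow (nu_ n) m]_t G t @[n --> \oo] --> \int[mpow nu m]_t G t.
Proof.
elim: m G => [|m ih] G bG uG.
  under eq_fun do rewrite Rint_mpow0//.
  by rewrite Rint_mpow0//; exact: cvg_cst.
under eq_fun do rewrite Rint_mpowS//.
rewrite Rint_mpowS//.
have [_ [M GM]] := bG.
have M0 : 0 <= M by rewrite (le_trans _ (GM [tuple of nseq m.+1 (point : T)])).
have [K CK] : exists2 C, mass nu <= C & \forall n \near \oo, mass (nu_ n) <= C.
  exists (mass nu + 1); first by rewrite lerDl.
  have := weak_mass => /cvgrPdist_le/(_ 1 ltr01); apply: filterS => n.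
  by rewrite ler_norml; lra.
have K0 : 0 <= K by rewrite (le_trans (mass_ge0 nu)).
move=> CK_.
have Gle (mu : {finite_measure set (borel T) -> \bar R}) x : mass mu <= K ->
    `|\int[mpow mu m]_t G [tuple of x :: t]| <= M * K ^+ m.
  move=> muK; rewrite (@le_trans _ _ (M * mass (mpow mu m)))//.
    by apply: Rint_norm_le => //; exact: bmeas_tcons.
  by rewrite mass_mpow ler_wpM2l// lerXn2r// nnegrE ?mass_ge0.
have Gequi (mu : {finite_measure set (borel T) -> \bar R}) x y e : mass mu <= K ->
    (forall t : m.-tuple T, `|G [tuple of x :: t] - G [tuple of y :: t]| <= e) -> 0 <= e ->
    `|\int[mpow mu m]_t G [tuple of x :: t] - \int[mpow mu m]_t G [tuple of y :: t]|
      <= e * K ^+ m.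
  move=> muK xye e0; rewrite -Rint_B; try exact: bmeas_tcons.
  rewrite (@le_trans _ _ (e * mass (mpow mu m)))//.
    apply: Rint_norm_le => //; apply: bmeasB; exact: bmeas_tcons.
  by rewrite mass_mpow ler_wpM2l// lerXn2r// nnegrE ?mass_ge0.
apply: (@Rint_cvg_equicontinuous _ _ (M * K ^+ m)).
- by move=> n; exact: bmeas_Rint_tcons.
- exact: bmeas_Rint_tcons.
- by apply: filterS CK_ => n nK x; exact: Gle.
- by move=> x; exact: Gle.
- move=> e e0; have K1 : 0 < K ^+ m + 1 by rewrite ltr_wpDl// exprn_ge0.
  have eK : 0 < e / (K ^+ m + 1) by rewrite divr_gt0.
  have [d d0 dG] := uG _ eK.
  have eKm : e / (K ^+ m + 1) * K ^+ m <= e.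
    by rewrite mulrAC ler_pdivrMr// ler_wpM2l ?(ltW e0)// lerDl.
  have cons_close x y (t : m.-tuple T) : mdist x y < d ->
      `|G [tuple of x :: t] - G [tuple of y :: t]| <= e / (K ^+ m + 1).
    move=> xy; apply: dG => i; case: (unliftP ord0 i) => [j|] ->; rewrite ?tnthS ?tnth0//.
    by rewrite mdistxx.
  exists d => //; split; last first.
    move=> x y xy; apply: le_trans eKm; apply: Gequi => //; last exact: ltW.
    by move=> t; exact: cons_close.
  apply: filterS CK_ => n nK x y xy; apply: le_trans eKm; apply: Gequi => //; last exact: ltW.
  by move=> t; exact: cons_close.
- move=> x; apply: ih; first exact: bmeas_tcons.
  move=> e e0; have [d d0 dG] := uG _ e0; exists d => // s t st; apply: dG => i.
  by case: (unliftP ord0 i) => [j|] ->; rewrite ?tnthS ?tnth0// mdistxx.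
Qed.

End weak_products.

Lemma Rint_mpow_eq_on d (T : measurableType d) (R : realType)
    (mu : {finite_measure set T -> \bar R}) (S : set T) m (f g : m.-tuple T -> R) :
  measurable S -> mu (~` S) = 0%E -> bmeas f -> bmeas g ->
  (forall t, (forall i, S (tnth t i)) -> f t = g t) ->
  \int[mpow mu m]_t f t = \int[mpow mu m]_t g t.
Proof.
move=> mS S0; elim: m f g => [|m ih] f g bf bg fg.
  by rewrite !Rint_mpow0// fg// => -[].
rewrite !Rint_mpowS//; apply: (Rint_eq_on mS) => //; try exact: bmeas_Rint_tcons.
move=> x Sx; apply: ih; try exact: bmeas_tcons.
move=> t St; apply: fg => i; case: (unliftP ord0 i) => [j|] ->.
  by rewrite tnthS.
by rewrite tnth0.
Qed.

Lemma measurable_map_tuple d1 d2 (T1 : measurableType d1) (T2 : measurableType d2)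
    (f : T1 -> T2) m : measurable_fun setT f ->
  measurable_fun setT (fun t : m.-tuple T1 => [tuple of map f t]).
Proof.
move=> mf; apply/measurable_fun_tnthP => i.
rewrite (_ : _ \o _ = f \o (@tnth _ T1 ^~ i)); last first.
  by apply/funext => t; rewrite /= tnth_map.
by apply: measurableT_comp => //; exact: measurable_tnth.
Qed.

Section embedded_power.
Context (R : realType) (X : mms R) (E : completeMetricType R) (phi : X -> E).
Hypothesis rphi : root_embedding phi.

Lemma Rint_mpow_embedded r m (G : m.-tuple E -> R) : bmeas (G : m.-tuple (borel E) -> R) ->
  \int[mpow (restr (embedded_bounded_finite rphi) r) m]_s G s =
  \int[mpow (mrestrict X r) m]_t G [tuple of map (supp_ext phi) t].
Proof.
have me := measurable_supp_ext rphi.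
elim: m G => [|m ih] G bG.
  rewrite !Rint_mpow0//; first by congr G; apply: val_inj.
  by apply: bmeas_comp bG _; exact: measurable_map_tuple.
have bG' : bmeas (fun t : m.+1.-tuple (borel X) => G [tuple of map (supp_ext phi) t]).
  by apply: bmeas_comp bG _; exact: measurable_map_tuple.
rewrite !Rint_mpowS// Rint_restr_embedded//; last exact: bmeas_Rint_tcons.
apply: eq_Rintegral => x _; rewrite ih; last exact: bmeas_tcons.
by apply: eq_Rintegral => t _; congr G; apply: val_inj.
Qed.

End embedded_power.

Section local_weak_gromov.
Context (R : realType) (X_ : nat -> mms R) (X : mms R) (E : completeMetricType R).
Variables (phi_ : forall n, X_ n -> E) (phi : X -> E).
Hypotheses (sepE : separable_space E) (rphi_ : forall n, root_embedding (@phi_ n)).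
Hypothesis rphi : root_embedding phi.

Let mE_fin (A : set (borel E)) : measurable A -> metric_bounded A ->
  (@mzero _ (borel E) R A < +oo)%E.
Proof. by rewrite /mzero. Qed.

(* [E] as an [mms]: the measure is a dummy, only [dist_matrix EE] matters. *)
Let EE := Mms E sepE mzero mE_fin.

(** Points in the ball of radius [r] are at distance at most [2 * r], so clipping changes nothing
    there. It confines the matrix to a compact cube, where a continuous [F] is uniformly
    continuous. *)
Definition clip (r : R) m (D : dist_space R m) : dist_space R m :=
  fun ij => Num.min (2 * r) (D ij).

Lemma clip_close r m (s t : m.-tuple E) e (ij : dist_index m) :
  (forall i, mdist (tnth s i) (tnth t i) < e) -> 0 < e ->
  `|clip r (dist_matrix EE m s) ij - clip r (dist_matrix EE m t) ij| < 2 * e.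
Proof.
move=> st e0; apply: (@le_lt_trans _ _ `|dist_matrix EE m s ij - dist_matrix EE m t ij|).
  rewrite /clip; set a := dist_matrix _ _ _ _; set b := dist_matrix _ _ _ _.
  rewrite ler_norml; have := ler_norm (a - b); have := ler_norm (b - a); rewrite distrC.
  by case: (leP (2 * r) a) => ?; case: (leP (2 * r) b) => ?; lra.
have st' i : mdist (tnth [tuple of (point : E) :: s] i) (tnth [tuple of (point : E) :: t] i) < e.
  by case: (unliftP ord0 i) => [j|] ->; rewrite ?tnthS ?tnth0 ?mdistxx.
rewrite /dist_matrix; case: ij => -[/= i j] ij.
have := st' i; have := st' j.
set a := tnth _ i; set b := tnth _ j; set c := tnth _ i; set d := tnth _ j.
move=> bd ac; rewrite ltr_norml.
have := metric_triangle a c b; have := metric_triangle c a d.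
have := metric_triangle c d b; have := metric_triangle a b d.
rewrite [mdist c a]metric_sym [mdist d b]metric_sym; lra.
Qed.

Lemma weak_gromov_weak r : 0 < r ->
  weak_cvg (fun n => mrestr (embedded_measure (@phi_ n)) (measurable_cball _ point r))
           (mrestr (embedded_measure phi) (measurable_cball _ point r)) ->
  gromov_weak_cvg (fun n => mms_restr (X_ n) r) (mms_restr X r).
Proof.
move=> r0 w; apply/gromov_weak_cvg_restrP => m F cF /[dup] bF /bounded_funP[M FM].
pose nu_ n := restr (embedded_bounded_finite (rphi_ n)) r.
pose nu := restr (embedded_bounded_finite rphi) r.
have wnu (f : E -> R) : continuous f -> bounded_fun f ->
    \int[nu_ n]_x f x @[n --> \oo] --> \int[nu]_x f x.
  move=> cf bf; have [M' fM] := (bounded_funP f).1 bf.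
  have bmf : bmeas (f : borel E -> R) by exact: bmeas_continuous fM.
  have resE (Y : mms R) (psi : Y -> E) (rpsi : root_embedding psi) :
      (\int[restr (embedded_bounded_finite rpsi) r]_x (f x)%:E =
       \int[mrestr (embedded_measure psi) (measurable_cball _ point r)]_x (f x)%:E)%E.
    by rewrite -(embeddedE rpsi).
  have := w f cf bf; rewrite -(resE _ _ rphi); under eq_fun do rewrite -(resE _ _ (rphi_ _)).
  by rewrite -bmeas_fineK// => /fine_cvg.
pose G (s : m.-tuple E) := F (clip r (dist_matrix EE m s)).
have bG : bmeas (G : m.-tuple (borel E) -> R).
  split; last by exists M => s; exact: FM.
  apply: (@measurableT_comp _ _ _ _ _ _ (F : borel (dist_space R m) -> R)).
    exact: continuous_borelR.
  apply: measurable_prod => ij; apply: measurable_minr; first exact: measurable_cst.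
  exact: (@measurable_dist_coord _ EE m ij).
have uG : tunif G.
  move=> e e0; have [d d0 dF] := unif_continuous_box (2 * r) cF e0.
  exists (d / 2); first by rewrite divr_gt0.
  have clipM (s : m.-tuple E) ij : `|clip r (dist_matrix EE m s) ij| <= 2 * r.
    have D0 : 0 <= dist_matrix EE m s ij by exact: mdist_ge0.
    rewrite /clip ger0_norm ?ge_min ?lexx// le_min D0 andbT; lra.
  move=> s t st; apply: dF => // i.
  have := @clip_close r m s t (d / 2) i st ltac:(by rewrite divr_gt0).
  by rewrite mulrC divfK.
(* Almost every sample lies in the support and in the ball, where [psi] is isometric and the
   clipping is void. *)
have key (Y : mms R) (psi : Y -> E) (rpsi : root_embedding psi) :
    \int[mpow (mrestrict Y r) m]_t F (dist_matrix Y m t) =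
    \int[mpow (restr (embedded_bounded_finite rpsi) r) m]_s G s.
  rewrite Rint_mpow_embedded//.
  apply: (@Rint_mpow_eq_on _ (borel Y) R (mrestrict Y r) (supp_root Y `&` cball point r) m
    (fun t => F (dist_matrix Y m t)) (fun t => G [tuple of map (supp_ext psi) t])).
  - by apply: measurableI; [exact: measurable_supp_root|exact: measurable_cball].
  - apply: measureCI0; [exact: measurable_supp_root|exact: measurable_cball| |].
      exact: restr_supp_root_full.
    exact: restr_cballC.
  - exact: bmeas_dist_matrix.
  - by apply: bmeas_comp bG _; apply: measurable_map_tuple; exact: measurable_supp_ext.
  - move=> t St; congr F; apply/funext => ij; rewrite /clip.
    have [iso p0] := rpsi.
    have E1 i : tnth [tuple of (point : E) :: map_tuple (supp_ext psi) t] i =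
        psi (tnth [tuple of (point : Y) :: t] i).
      case: (unliftP ord0 i) => [j|] ->; rewrite ?tnth0// !tnthS tnth_map supp_extE//.
      by have [] := St j.
    have S1 i : supp_root Y (tnth [tuple of (point : Y) :: t] i).
      case: (unliftP ord0 i) => [j|] ->; rewrite ?tnth0 ?tnthS; first by have [] := St j.
      exact: supp_root_point.
    have b1 i : mdist point (tnth [tuple of (point : Y) :: t] i) <= r.
      case: (unliftP ord0 i) => [j|] ->; rewrite ?tnth0 ?tnthS; first by have [] := St j.
      by rewrite mdistxx ltW.
    rewrite [in RHS]/dist_matrix !E1 iso// min_r//.
    rewrite (le_trans (metric_triangle _ point _))// mulr_natl mulr2n lerD//.
    by rewrite metric_sym.
under eq_fun do rewrite (key _ _ (rphi_ _)).
rewrite (key _ _ rphi).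
exact: weak_mpow.
Qed.

Lemma local_weak_gromov_vague :
  local_weak_cvg (fun n => embedded_measure (@phi_ n)) (embedded_measure phi) ->
  gromov_vague_cvg X_ X.
Proof.
apply: sub_countable; apply: subset_card_le => r /= [r0 rP]; split; first exact: ltW.
by apply: contra_not rP; exact: weak_gromov_weak.
Qed.

End local_weak_gromov.

(** * Approximate matchings from Gromov-weak convergence *)

(* Resolution through the filter instance of [prod_topology] diverges here. *)
#[local] Instance dist_space_nbhs_filter (R : realType) (m : nat) (p : dist_space R m) :
  ProperFilter (nbhs p).
Proof. exact: nbhs_pfilter. Qed.

#[local] Instance dist_space_nbhs_filter' (R : realType) (m : nat) (p : dist_space R m) :
  Filter (nbhs p).
Proof. exact: nbhs_filter. Qed.

Section sample_points.
Context (R : realType).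

(** Index 0 is the root, and the sample is listed from its end, so prepending a point does not
    renumber the others. Indices beyond the sample give the root again. *)
Definition pts (T : pointedType) (t : seq T) i := nth point (point :: rev t) i.

Lemma pts_cons (T : pointedType) (y : T) t i :
  (i <= size t)%N -> pts (y :: t) i = pts t i.
Proof.
rewrite /pts; case: i => [//|i] it; rewrite /= rev_cons nth_rcons size_rev.
by rewrite it.
Qed.

Lemma pts_cons_last (T : pointedType) (y : T) t m : size t = m -> pts (y :: t) m.+1 = y.
Proof.
by move=> <-; rewrite /pts/= rev_cons nth_rcons size_rev ltnn eqxx.
Qed.

Definition pdist (T : metricType R) (p : nat -> T) i j := mdist (p i) (p j).

Variable m : nat.

(** [dist_space] stores the entries above the diagonal only; this is the symmetric matrix with zero
    diagonal. *)
Definition dist_entry (D : dist_space R m) (a b : 'I_m.+1) : R :=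
  if insub (a, b) is Some ij then D ij else
  if insub (b, a) is Some ij then D ij else 0.

(** Undoes the reversal in [pts]; out-of-range indices fall back to the root. *)
Definition rev_index (i : nat) : 'I_m.+1 := inord (if (0 < i <= m)%N then (m.+1 - i)%N else 0%N).

(** Matrices of every size become functions on pairs of naturals, so a single functional can be
    evaluated on samples of any length. *)
Definition dist_ext (D : dist_space R m) (i j : nat) : R :=
  dist_entry D (rev_index i) (rev_index j).

Lemma dist_extE (X : mms R) (t : m.-tuple X) :
  dist_ext (dist_matrix X m t) = pdist (@pts X t).
Proof.
have E a b : dist_entry (dist_matrix X m t) a b =
    mdist (tnth [tuple of point :: t] a) (tnth [tuple of point :: t] b).
  rewrite /dist_entry; case: insubP => [ij _ ijE|].
    by rewrite /dist_matrix ijE.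
  rewrite -leqNgt => /= ba; case: insubP => [ij _ ijE|].
    by rewrite /dist_matrix ijE metric_sym.
  by rewrite -leqNgt => /= ab; rewrite (_ : a = b) ?mdistxx//; apply/val_inj/anti_leq/andP.
have P i : tnth [tuple of point :: t] (rev_index i) = pts t i.
  rewrite (tnth_nth point) /rev_index inordK; last first.
    by case: ifP => // /andP[i0 im]; rewrite ltn_subrL i0.
  case: i => [//|i]; rewrite /pts/=; case: ifPn => im.
    by rewrite subSS nth_rev size_tuple// -(prednK (n := (m - i)%N)) ?subn_gt0//= subnS.
  by rewrite [RHS]nth_default // size_rev size_tuple leqNgt.
by apply/funext => i; apply/funext => j; rewrite /dist_ext E !P.
Qed.

End sample_points.

(** * Continuous functionals of the distance matrix *)

Section dist_functionals.
Context (R : realType).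
Implicit Types f g : (nat -> nat -> R) -> R.

(** The functionals that Gromov-weak convergence can test, with continuity required at every sample
    size at once. *)
Definition dcont f := (forall m, continuous (fun D : dist_space R m => f (dist_ext D))) /\
  exists M : R, forall D, `|f D| <= M.

Lemma continuous_dist_ext m i j : continuous (fun D : dist_space R m => dist_ext D i j).
Proof.
rewrite /dist_ext /dist_entry; case: insub => [ij|].
  by move=> x; exact: (@proj_cvg R m x ij).
case: insub => [ij|]; first by move=> x; exact: (@proj_cvg R m x ij).
exact: cst_continuous.
Qed.

Lemma dcont_cst (c : R) : dcont (fun=> c).
Proof. by split; [move=> m; exact: cst_continuous|exists `|c|]. Qed.

Lemma dcontD f g : dcont f -> dcont g -> dcont (fun D => f D + g D).
Proof.
move=> [cf [M fM]] [cg [N gN]]; split; first by move=> m x; apply: cvgD; [exact: cf|exact: cg].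
by exists (M + N) => x; rewrite (le_trans (ler_normD _ _))// lerD.
Qed.

Lemma dcontN f : dcont f -> dcont (fun D => - f D).
Proof.
move=> [cf [M fM]]; split; first by move=> m x; apply: cvgN; exact: cf.
by exists M => x; rewrite normrN.
Qed.

Lemma dcontM f g : dcont f -> dcont g -> dcont (fun D => f D * g D).
Proof.
move=> [cf [M fM]] [cg [N gN]]; split; first by move=> m x; apply: cvgM; [exact: cf|exact: cg].
by exists (M * N) => x; rewrite normrM ler_pM.
Qed.

Lemma dcont_sum I (r : seq I) (F : I -> (nat -> nat -> R) -> R) :
  (forall i, dcont (F i)) -> dcont (fun D => \sum_(i <- r) F i D).
Proof.
move=> bF; elim: r => [|i r ih].
  by under eq_fun do rewrite big_nil; exact: dcont_cst.
by under eq_fun do rewrite big_cons; exact: dcontD.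
Qed.

Lemma dcont_prod I (r : seq I) (F : I -> (nat -> nat -> R) -> R) :
  (forall i, dcont (F i)) -> dcont (fun D => \prod_(i <- r) F i D).
Proof.
move=> bF; elim: r => [|i r ih].
  by under eq_fun do rewrite big_nil; exact: dcont_cst.
by under eq_fun do rewrite big_cons; exact: dcontM.
Qed.

Lemma dcont_entry (h : R -> R) (M : R) i j : continuous h -> (forall x, `|h x| <= M) ->
  dcont (fun D => h (D i j)).
Proof.
move=> ch hM; split; last by exists M.
by move=> m x; apply: continuous_comp; [exact: continuous_dist_ext|exact: ch].
Qed.

Lemma bump_continuous d : 0 < d -> continuous (bump d : R -> R).
Proof.
move=> d0; apply: (@klip_continuous R R^o d^-1) => x y.
by rewrite (le_trans (bump_lip _ _ d0))// distrC.
Qed.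

Lemma dcont_bump d i j : 0 < d -> dcont (fun D => bump d (D i j)).
Proof.
move=> d0; apply: (@dcont_entry (bump d) 1); first exact: bump_continuous.
by move=> x; have /andP[? ?] := bump01 d x; rewrite ger0_norm.
Qed.

Lemma bmeas_dcont f (X : mms R) m : dcont f ->
  bmeas (fun t : m.-tuple (borel X) => f (pdist (@pts X t))).
Proof.
move=> [cf [M fM]]; under eq_fun do rewrite -dist_extE.
apply: (@bmeas_dist_matrix _ X m (fun D => f (dist_ext D))); first exact: cf.
by apply/bounded_funP; exists M.
Qed.

Lemma gromov_weak_dcont (X_ : nat -> mms R) (X : mms R) r m f :
  gromov_weak_cvg (fun n => mms_restr (X_ n) r) (mms_restr X r) -> dcont f ->
  \int[mpow (mrestrict (X_ n) r) m]_t f (pdist (@pts (X_ n) t)) @[n --> \oo] -->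
  \int[mpow (mrestrict X r) m]_t f (pdist (@pts X t)).
Proof.
move=> /gromov_weak_cvg_restrP gw [cf [M fM]].
have := gw m (fun D => f (dist_ext D)) (cf m) ltac:(by apply/bounded_funP; exists M).
under eq_Rintegral do rewrite dist_extE.
under eq_fun => n do under eq_Rintegral do rewrite dist_extE.
exact.
Qed.

End dist_functionals.

Section weights.
Context (R : realType).
Implicit Types s : nat -> R.

Definition wt (d : R) N k s := if (k < N)%N then part d s k else rest d s N.

Lemma wt01 d N k s : 0 <= wt d N k s <= 1.
Proof. by rewrite /wt; case: ifP => _; [exact: part01|exact: rest01]. Qed.

Lemma rest_local d N s s' : (forall j, (j < N)%N -> s j = s' j) ->
  rest d s N = rest d s' N.
Proof. by move=> ss; apply: eq_bigr => i _; rewrite ss. Qed.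

Lemma wt_local d N k s s' : (forall j, (j < N)%N -> s j = s' j) ->
  wt d N k s = wt d N k s'.
Proof.
move=> ss; rewrite /wt; case: ifP => kN; last exact: rest_local.
by rewrite /part ss// (@rest_local _ _ s s')// => j /ltn_trans-/(_ _ kN); exact: ss.
Qed.

Lemma wt_lip d N k s s' e : 0 < d -> 0 <= e ->
  (forall j, (j < N)%N -> `|s j - s' j| <= e) ->
  `|wt d N k s - wt d N k s'| <= d^-1 * e *+ N.
Proof.
move=> d0 e0 ss; rewrite /wt; case: ifP => kN; last exact: rest_lip.
rewrite (le_trans (part_lip d0 ss kN))// ler_wpMn2l//.
by rewrite mulr_ge0// invr_ge0 ltW.
Qed.

Lemma dcont_wt d N k i : 0 < d -> dcont (fun D => wt d N k (fun j => D j.+1 i)).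
Proof.
move=> d0.
have dr n : dcont (fun D => rest d (fun j => D j.+1 i) n).
  apply: dcont_prod => j; apply: dcontD; first exact: dcont_cst.
  by apply: dcontN; exact: dcont_bump.
rewrite /wt; case: (k < N)%N; last exact: dr.
by apply: dcontM; [exact: dcont_bump|exact: dr].
Qed.

End weights.

(** * The peaking functional and its powers *)

Section power_functional.
Context (R : realType) (N : nat) (d e : R) (c : nat -> R) (B : nat -> nat -> R).
Hypotheses (d0 : 0 < d) (e0 : 0 < e).
Implicit Types D : nat -> nat -> R.

Definition window D := \prod_(i < N.+1) \prod_(j < N.+1) bump e `|D i j - B i j|.

(** The points of indices [i] and [j] play the role of two independent samples: integrated over
    both, the product of the two deviations becomes the square of a mean deviation. *)
Definition pairing i j D := N.+1%:R - \sum_(k < N.+1)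
  (wt d N k (fun l => D l.+1 i) - c k) * (wt d N k (fun l => D l.+1 j) - c k).

(** Each factor reads two sample points of its own, beyond the [N] points in the window, so that
    integrating them out produces independent factors. *)
Fixpoint window_pow L D := if L is L'.+1
  then window_pow L' D * pairing (L'.*2 + N).+1 (L'.*2 + N).+2 D else window D.

Lemma dcont_window : dcont window.
Proof.
apply: dcont_prod => i; apply: dcont_prod => j.
apply: (@dcont_entry _ (fun x => bump e `|x - B i j|) 1) => [x|x].
  apply: (@continuous_comp _ _ _ (fun x => `|x - B i j|) (bump e)).
    by apply: cvg_norm; apply: cvgB; [exact: cvg_id|exact: cvg_cst].
  exact: bump_continuous.
by have /andP[? ?] := bump01 e `|x - B i j|; rewrite ger0_norm.
Qed.

Lemma window01 D : 0 <= window D <= 1.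
Proof.
have prod01 (F : 'I_N.+1 -> R) : (forall i, 0 <= F i <= 1) -> 0 <= \prod_i F i <= 1.
  move=> F01; elim/big_rec : _ => [|i x _ /andP[x0 x1]]; first by rewrite ler01 lexx.
  by have /andP[? ?] := F01 i; rewrite mulr_ge0//= mulr_ile1.
by apply: (prod01) => i; apply: (prod01) => j; exact: bump01.
Qed.

Lemma window_eq1 D : (forall i j, (i <= N)%N -> (j <= N)%N -> `|D i j - B i j| <= e) ->
  window D = 1.
Proof.
move=> DB; rewrite /window big1// => i _; rewrite big1// => j _.
by rewrite bump_near// DB// -ltnS.
Qed.

Lemma window_neq0 D i j : window D != 0 -> (i <= N)%N -> (j <= N)%N ->
  `|D i j - B i j| <= 2 * e.
Proof.
move=> w0 iN jN; rewrite leNgt; apply/negP => De; move/negP : w0; apply; apply/eqP.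
rewrite /window (bigD1 (Ordinal (iN : (i < N.+1)%N)))//=.
by rewrite (bigD1 (Ordinal (jN : (j < N.+1)%N)))//= bump_far ?mul0r// ltW.
Qed.

Lemma dcont_pairing i j : dcont (pairing i j).
Proof.
apply: dcontD; first exact: dcont_cst.
apply: dcontN; apply: dcont_sum => k.
by apply: dcontM; apply: dcontD; (try exact: dcont_wt);
  apply: dcontN; exact: dcont_cst.
Qed.

Lemma dcont_window_pow L : dcont (window_pow L).
Proof.
elim: L => [|L ih]; first exact: dcont_window.
by apply: dcontM => //; exact: dcont_pairing.
Qed.

Lemma window_pow_local L D D' : (forall i j, (i <= L.*2 + N)%N -> (j <= L.*2 + N)%N ->
  D i j = D' i j) -> window_pow L D = window_pow L D'.
Proof.
elim: L => [|L ih] DD /=.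
  by apply: eq_bigr => i _; apply: eq_bigr => j _; rewrite DD// -ltnS.
have leL i : (i <= L.*2 + N)%N -> (i <= (L.*2 + N).+2)%N by move=> h; exact/leqW/leqW.
rewrite (ih) => [|i j iL jL]; last by rewrite DD//; exact: leL.
congr (_ * _); congr (_ - _); apply: eq_bigr => k _.
by congr ((_ - _) * (_ - _)); apply: wt_local => j jN; apply: DD => //;
  apply: leL; rewrite (leq_trans jN)// leq_addl.
Qed.

Section space.
Variables (X : mms R) (mu : {finite_measure set (borel X) -> \bar R}).

Definition wmean k (t : seq X) : R :=
  \int[mu]_y wt d N k (fun j => mdist (pts t j.+1) y).

(** The maximum [N.+1%:R * mass mu ^+ 2] is reached exactly when each mean is [c k * mass mu]. For
    [c k] in [[0, 1]] the coefficient [N.+1] keeps the value nonnegative, so that its powers are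
    monotone. *)
Definition moment (t : seq X) : R :=
  N.+1%:R * mass mu ^+ 2 - \sum_(k < N.+1) (wmean k t - c k * mass mu) ^+ 2.

Lemma bmeas_wt k (t : seq X) :
  bmeas (fun y : borel X => wt d N k (fun j => mdist (pts t j.+1) y)).
Proof.
rewrite /wt; case: (k < N)%N; first exact: (bmeas_part (fun j => pts t j.+1) k d0).
exact: (bmeas_rest (fun j => pts t j.+1) N d0).
Qed.

Lemma wmean_bounds k t : 0 <= wmean k t <= mass mu.
Proof.
apply/andP; split.
  by apply: Rintegral_ge0 => y _; have /andP[] := wt01 d N k (fun j => mdist (pts t j.+1) y).
rewrite -[leRHS]mul1r -Rint_cst; apply: Rint_le; [exact: bmeas_wt|exact: bmeas_cst|].
by move=> y; have /andP[] := wt01 d N k (fun j => mdist (pts t j.+1) y).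
Qed.

Lemma wmean_cons k y t : (N <= size t)%N -> wmean k (y :: t) = wmean k t.
Proof.
move=> Nt; apply: eq_Rintegral => z _; apply: wt_local => j jN.
by rewrite pts_cons// (leq_trans jN).
Qed.

Lemma moment_cons y t : (N <= size t)%N -> moment (y :: t) = moment t.
Proof. by move=> Nt; congr (_ - _); apply: eq_bigr => k _; rewrite wmean_cons. Qed.

(** The mean arises from a continuous functional of the distances of [m.+1] points by integrating
    out the newest one. *)
Lemma bmeas_wmean k m : (N <= m)%N -> bmeas (fun t : m.-tuple (borel X) => wmean k t).
Proof.
move=> Nm; have bF := bmeas_dcont X m.+1 (dcont_wt N k m.+1 d0).
have := bmeas_Rint_tcons2 mu bF; congr bmeas; apply/funext => t.
apply: eq_Rintegral => y _; apply: wt_local => j jN; rewrite /pdist pts_cons; last first.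
  by rewrite size_tuple (leq_trans jN).
by rewrite (@pts_cons_last _ _ _ m) ?size_tuple.
Qed.

Lemma bmeas_moment m : (N <= m)%N -> bmeas (fun t : m.-tuple (borel X) => moment t).
Proof.
move=> Nm; apply: bmeasB; first exact: bmeas_cst.
apply: bmeas_sum => k; apply: bmeasX; apply: bmeasB; last exact: bmeas_cst.
exact: bmeas_wmean.
Qed.

Let centred k (t : seq X) y := wt d N k (fun j => mdist (pts t j.+1) y) - c k.

Let bmeas_centred k t : bmeas (centred k t : borel X -> R).
Proof. by apply: bmeasB; [exact: bmeas_wt|exact: bmeas_cst]. Qed.

Let Rint_centred k t : \int[mu]_y centred k t y = wmean k t - c k * mass mu.
Proof. by rewrite Rint_B ?Rint_cst//; [exact: bmeas_wt|exact: bmeas_cst]. Qed.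

Let bmeas_pairing t y :
  bmeas (fun z : borel X => N.+1%:R - \sum_(k < N.+1) centred k t y * centred k t z).
Proof.
apply: bmeasB; first exact: bmeas_cst.
by apply: bmeas_sum => k; apply: bmeasM => //; exact: bmeas_cst.
Qed.

Let Rint_pairing1 t y :
  \int[mu]_z (N.+1%:R - \sum_(k < N.+1) centred k t y * centred k t z) =
  N.+1%:R * mass mu - \sum_(k < N.+1) (wmean k t - c k * mass mu) * centred k t y.
Proof.
have bs (k : 'I_N.+1) : bmeas (fun z : borel X => centred k t y * centred k t z).
  by apply: bmeasM => //; exact: bmeas_cst.
rewrite Rint_B; [|exact: bmeas_cst|by apply: bmeas_sum => k; exact: bs].
rewrite Rint_cst Rint_sum//; congr (_ - _); apply: eq_bigr => k _.
by rewrite Rint_Z// Rint_centred mulrC.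
Qed.

Let bmeas_pairing1 t : bmeas (fun y : borel X =>
  N.+1%:R * mass mu - \sum_(k < N.+1) (wmean k t - c k * mass mu) * centred k t y).
Proof.
apply: bmeasB; first exact: bmeas_cst.
by apply: bmeas_sum => k; apply: bmeasM => //; exact: bmeas_cst.
Qed.

Lemma Rint_pairing (t : seq X) : \int[mu]_y \int[mu]_z
  (N.+1%:R - \sum_(k < N.+1) centred k t y * centred k t z) = moment t.
Proof.
under eq_Rintegral do rewrite Rint_pairing1.
have bs (k : 'I_N.+1) : bmeas (fun z : borel X => (wmean k t - c k * mass mu) * centred k t z).
  by apply: bmeasM => //; exact: bmeas_cst.
rewrite Rint_B; [|exact: bmeas_cst|by apply: bmeas_sum => k; exact: bs].
rewrite Rint_cst -mulrA -expr2 Rint_sum//; congr (_ - _); apply: eq_bigr => k _.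
by rewrite Rint_Z// Rint_centred expr2.
Qed.

(** Induction on [L]: the two newest points occur in the last factor only, whose double integral is
    [moment]. The exponent [j] collects the factors already integrated out. *)
Lemma Rint_window_pow L j :
  \int[mpow mu (L.*2 + N)]_t (window_pow L (pdist (@pts X t)) * moment t ^+ j) =
  \int[mpow mu N]_t (window (pdist (@pts X t)) * moment t ^+ (L + j)).
Proof.
elim: L j => [//|L ih] j.
have bm m : (N <= m)%N -> bmeas (fun t : m.-tuple (borel X) => moment t ^+ j).
  by move=> Nm; apply: bmeasX; exact: bmeas_moment.
have LN : (N <= L.*2 + N)%N by rewrite leq_addl.
rewrite -[(L.+1.*2 + N)%N]/((L.*2 + N).+2).
have bF : bmeas (fun t : (L.*2 + N).+2.-tuple (borel X) =>
    window_pow L.+1 (pdist (@pts X t)) * moment t ^+ j).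
  apply: bmeasM; first exact: (bmeas_dcont X _ (dcont_window_pow L.+1)).
  by apply: bm; exact/leqW/leqW.
rewrite (Rint_mpowS2 _ bF) (Rint_mpowS2 _ (bmeas_Rint_tcons2 _ bF)).
rewrite addSnnS -ih; apply: eq_Rintegral => t _.
have st : size t = (L.*2 + N)%N by rewrite size_tuple.
have Nt : (N <= size t)%N by rewrite st.
have E y z : window_pow L.+1 (pdist (@pts X (z :: y :: t))) * moment (z :: y :: t) ^+ j =
  (window_pow L (pdist (@pts X t)) * moment t ^+ j) *
  (N.+1%:R - \sum_(k < N.+1) centred k t y * centred k t z).
  have p2 i : (i <= L.*2 + N)%N -> pts (z :: y :: t) i = pts t i.
    by move=> iL; rewrite !pts_cons//= st//; exact: leqW.
  have py : pts (z :: y :: t) (L.*2 + N).+1 = y.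
    by rewrite pts_cons/= ?st// (pts_cons_last _ st).
  have pz : pts (z :: y :: t) (L.*2 + N).+2 = z.
    by rewrite pts_cons_last//= st.
  rewrite !moment_cons//=; last exact: leqW.
  rewrite mulrAC; congr (_ * _ * _).
    by apply: window_pow_local => i k iL kL; rewrite /pdist !p2.
  rewrite /pairing /pdist py pz; congr (_ - _); apply: eq_bigr => k _.
  by congr ((_ - _) * (_ - _)); apply: wt_local => l lN; rewrite p2// (leq_trans lN).
under eq_Rintegral => y _ do under eq_Rintegral => z _ do rewrite /= E.
rewrite exprSr mulrA -Rint_pairing -Rint_Z; last first.
  by under eq_fun do rewrite Rint_pairing1; exact: bmeas_pairing1.
by apply: eq_Rintegral => y _; rewrite -Rint_Z.
Qed.

End space.
End power_functional.

Lemma bmeas_min d (T : measurableType d) (R : realType) (f g : T -> R) :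
  bmeas f -> bmeas g -> bmeas (fun x => Num.min (f x) (g x)).
Proof.
move=> [mf [M fM]] [mg [N gN]]; split; first exact: measurable_minr.
exists (Num.max M N) => x; rewrite le_max.
by case: (leP (f x) (g x)) => _; rewrite ?fM ?gN ?orbT.
Qed.

Lemma Rint_mpow_le_on d (T : measurableType d) (R : realType)
    (mu : {finite_measure set T -> \bar R}) (S : set T) m (f g : m.-tuple T -> R) :
  measurable S -> mu (~` S) = 0%E -> bmeas f -> bmeas g ->
  (forall t, (forall i, S (tnth t i)) -> f t <= g t) ->
  \int[mpow mu m]_t f t <= \int[mpow mu m]_t g t.
Proof.
move=> mS S0 bf bg fg.
rewrite (Rint_mpow_eq_on mS S0 bf (bmeas_min bf bg)).
  by apply: Rint_le => //; [exact: bmeas_min|move=> t; rewrite ge_min lexx orbT].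
by move=> t St; rewrite min_l// fg.
Qed.

Lemma bmeas_box d (T : measurableType d) (R : realType) m (B : 'I_m -> set T) :
  (forall i, measurable (B i)) ->
  bmeas (fun t : m.-tuple T => \prod_i \1_(B i) (tnth t i) : R).
Proof.
move=> mB; pose b i (t : m.-tuple T) : R := \1_(B i) (tnth t i).
have bb i : bmeas (b i).
  apply: (@bmeas_comp _ _ _ _ _ (\1_(B i) : T -> R) (@tnth _ T ^~ i)).
    exact: bmeas_indic.
  exact: measurable_tnth.
rewrite -/b; elim: (index_enum _) => [|i s ih].
  by under eq_fun do rewrite big_nil; exact: bmeas_cst.
by under eq_fun do rewrite big_cons; apply: bmeasM => //; exact: bb.
Qed.

Lemma Rint_mpow_box d (T : measurableType d) (R : realType)
    (mu : {finite_measure set T -> \bar R}) m (B : 'I_m -> set T) :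
  (forall i, measurable (B i)) ->
  \int[mpow mu m]_t (\prod_i \1_(B i) (tnth t i)) = \prod_i fine (mu (B i)).
Proof.
elim: m B => [|m ih] B mB.
  by rewrite Rint_mpow0 ?big_ord0//; exact: bmeas_box.
have mB' i : measurable (B (lift ord0 i)) by exact: mB.
have bB' := @bmeas_box _ T R _ _ mB'.
have b0 : bmeas (\1_(B ord0) : T -> R) by exact: bmeas_indic.
rewrite (Rint_mpowS _ (@bmeas_box _ _ R _ _ mB)) big_ord_recl -(ih _ mB').
under eq_Rintegral => x _.
  under eq_Rintegral => t _.
    rewrite big_ord_recl tnth0; under eq_bigr do rewrite tnthS.
    over.
  rewrite Rint_Z// mulrC; over.
rewrite Rint_Z// mulrC; congr (_ * _).
by rewrite /Rintegral integral_indic ?setIT.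
Qed.

Lemma exists_expr_lt (R : realType) (a b p z : R) : 0 <= a < b -> 0 < p -> 0 < z ->
  exists L, a ^+ L * z < b ^+ L * p.
Proof.
move=> /andP[a0 ab] p0 z0; have b0 := le_lt_trans a0 ab.
have /cvgrPdist_lt/(_ (p / z)) : (a / b) ^+ n @[n --> \oo] --> (0 : R).
  apply: cvg_expr; rewrite ger0_norm ?divr_ge0 ?(ltW b0)//.
  by rewrite ltr_pdivrMr// mul1r.
rewrite divr_gt0// => /(_ isT)[L _ /(_ L (leqnn L))] /=.
rewrite sub0r normrN ger0_norm ?exprn_ge0 ?divr_ge0 ?(ltW b0)// => h; exists L.
by move: h; rewrite expr_div_n ltr_pdivlMr// mulrAC ltr_pdivrMr ?exprn_gt0// [p * _]mulrC.
Qed.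

Section sample_approx.
Context (R : realType).

Lemma pts_mdist (T : completeMetricType R) m (s t : m.-tuple T) (e : R) i : 0 < e ->
  (forall i, mdist (tnth s i) (tnth t i) < e) -> mdist (pts s i) (pts t i) < e.
Proof.
move=> e0 st; case: i => [|i]; first by rewrite /pts/= mdistxx.
rewrite /pts/=; have [im|mi] := ltnP i m; last first.
  by rewrite !nth_default ?size_rev ?size_tuple// mdistxx.
rewrite !nth_rev ?size_tuple//.
have jm : (m - i.+1 < m)%N by rewrite ltn_subrL/= (leq_ltn_trans _ im).
by have := st (Ordinal jm); rewrite !(tnth_nth point).
Qed.

Section moments.
Variables (N : nat) (d : R) (c : nat -> R) (X : mms R).
Variable mu : {finite_measure set (borel X) -> \bar R}.
Hypotheses (d0 : 0 < d) (c01 : forall k, 0 <= c k <= 1).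

Lemma moment_ge0 t : 0 <= moment N d c mu t.
Proof.
rewrite /moment subr_ge0 mulr_natl -[leRHS]/(_ *+ N.+1).
rewrite -[X in _ *+ X](card_ord N.+1) -sumr_const; apply: ler_sum => k _.
have /andP[w0 w1] : 0 <= wmean N d mu k t <= mass mu by exact: wmean_bounds.
have /andP[c0 c1] := c01 k.
have h0 : 0 <= c k * mass mu by rewrite mulr_ge0// mass_ge0.
have h1 : c k * mass mu <= mass mu by rewrite ler_piMl// mass_ge0.
by rewrite -[leLHS]real_normK ?num_real// lerXn2r ?nnegrE ?mass_ge0// ler_norml; lra.
Qed.

Lemma wmean_lip k (s t : N.-tuple X) e : 0 < e ->
  (forall i, mdist (tnth s i) (tnth t i) < e) ->
  `|wmean N d mu k s - wmean N d mu k t| <= d^-1 * e *+ N * mass mu.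
Proof.
move=> e0 st; rewrite /wmean -Rint_B; try exact: bmeas_wt.
apply: Rint_norm_le; first by apply: bmeasB; exact: bmeas_wt.
move=> y; apply: wt_lip => //; first exact: ltW.
move=> j jN; have := pts_mdist j.+1 e0 st.
have := metric_triangle (pts s j.+1) (pts t j.+1) y.
have := metric_triangle (pts t j.+1) (pts s j.+1) y.
by rewrite [mdist (pts t _) (pts s _)]metric_sym ler_norml; lra.
Qed.

End moments.
End sample_approx.

(** * Transfer of samples from the limit *)

Section sample_transfer.
Context (R : realType) (X_ : nat -> mms R) (X : mms R) (r : R).
Hypothesis gw : gromov_weak_cvg (fun n => mms_restr (X_ n) r) (mms_restr X r).

Local Notation mu_ n := (mrestrict (X_ n) r).
Local Notation mu := (mrestrict X r).

Lemma gromov_weak_mass : mass (mu_ n) @[n --> \oo] --> mass mu.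
Proof.
have := gromov_weak_dcont (m := 1) gw (dcont_cst 1).
rewrite Rint_cst mul1r mass_mpow expr1.
by under eq_fun do rewrite Rint_cst mul1r mass_mpow expr1.
Qed.

(* The law of the distances and of the weighted means [wmean] of a sample is only
   accessible through polynomials in the means. The polynomial [moment ^ L] peaks,
   as [L] grows, where the means are those of [b]; comparing its integrals over
   [X_ n] and [X] yields a sample of [X_ n] that looks like [b]. *)
Lemma sample_approx N d (b : N.-tuple X) k0 : 0 < d -> 0 < k0 -> 0 < mass mu ->
  (forall i, msupport mu (tnth b i)) ->
  \forall n \near \oo, exists a : N.-tuple (X_ n),
    [/\ forall i, supp_root (X_ n) (tnth a i),
        forall i j, (i <= N)%N -> (j <= N)%N ->
          `|pdist (pts a) i j - pdist (pts b) i j| <= k0 &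
        forall k, (k <= N)%N -> `|wmean N d (mu_ n) k a - wmean N d mu k b| <= k0].
Proof.
move=> d0 k00 M0 bS; set M := mass mu in M0.
pose c k := wmean N d mu k b / M.
have c01 k : 0 <= c k <= 1.
  have /andP[w0 w1] : 0 <= wmean N d mu k b <= M by exact: wmean_bounds.
  by rewrite /c divr_ge0 ?(ltW M0)//= ler_pdivrMr// mul1r.
have cM k : c k * M = wmean N d mu k b by rewrite /c divfK// gt_eqF.
pose B := pdist (pts b); pose e := k0 / 2; have e0 : 0 < e by rewrite divr_gt0.
pose T := N.+1%:R * M ^+ 2; have T0 : 0 < T by rewrite mulr_gt0// exprn_gt0.
(* [T] is the peak value, attained at [b]. A sample of [X_ n] with moment above [T - 2 * eta] has
   each squared deviation at most [k0 ^+ 2 / 8 + k0 ^+ 2 / 8], the square of [k0 / 2]; one of the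
   two terms pays for the mass of [X_ n] differing from [M]. The bound [T / 2] keeps [beta]
   positive. *)
pose eta := Num.min (k0 ^+ 2 / 16) (T / 2).
have eta0 : 0 < eta by rewrite lt_min !divr_gt0// exprn_gt0.
have etaT : eta <= T / 2 by rewrite ge_min lexx orbT.
have etak : eta <= k0 ^+ 2 / 16 by rewrite ge_min lexx.
pose alpha := Num.max 0 (T - 2 * eta); pose beta := T - eta.
have ab : 0 <= alpha < beta.
  rewrite le_max lexx/= gt_max /beta; apply/andP; split; lra.
(* Moving the points of [b] by [tau] lowers the moment by at most [tau ^+ 2 * C], which is at most
   [eta] for the [tau] below. A distance then changes by at most [2 * tau <= e], which keeps the
   window equal to 1. *)
pose C := N.+1%:R * (d^-1 *+ N * M) ^+ 2.
have C0 : 0 <= C by rewrite mulr_ge0// sqr_ge0.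
pose tau := Num.min (Num.min 1 (e / 2)) (eta / (C + 1)).
have tau0 : 0 < tau by rewrite !lt_min ltr01 !divr_gt0// ltr_wpDl.
have tau1 : tau <= 1 by rewrite !ge_min lexx.
have taue : tau <= e / 2 by rewrite !ge_min lexx orbT.
have tauC : tau * C <= eta.
  have : tau <= eta / (C + 1) by rewrite ge_min lexx orbT.
  rewrite ler_pdivlMr ?ltr_wpDl// mulrDr mulr1; lra.
(* The tuples [tau]-close to [b] form a box of positive mass [p], because the centres are in the
   support; on it the moment is at least [beta]. *)
pose V i : set (borel X) := [set y | mdist (tnth b i) y < tau].
have mV i : measurable (V i) by apply: open_borel; exact: open_mball.
have V0 i : 0 < fine (mu (V i)).
  apply: fine_gt0; rewrite (msupport_ball (bS i) tau0)/=.
  rewrite -ge0_fin_numE//; exact: (fin_num_measure mu _ (mV i)).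
pose p := \prod_i fine (mu (V i)).
have p0 : 0 < p by apply: prodr_gt0 => i _; exact: V0.
pose W (Y : mms R) (t : N.-tuple Y) := window N e B (pdist (pts t)).
pose Z := \int[mpow mu N]_t W X t.
have Z0 : 0 <= Z.
  by apply: Rintegral_ge0 => t _; have /andP[] := window01 N e B (pdist (pts t)).
(* From here on the power is fixed: the contribution [beta ^+ L * p] near [b] beats everything that
   moments up to [alpha] can contribute. *)
have [L hL] := exists_expr_lt ab p0 (ltr_wpDl Z0 ltr01).
have bmW (Y : mms R) : bmeas (fun t : N.-tuple (borel Y) => W Y t).
  exact: (bmeas_dcont Y N (dcont_window N B e0)).
have bmA (Y : mms R) (m : {finite_measure set (borel Y) -> \bar R}) :
    bmeas (fun t : N.-tuple (borel Y) => moment N d c m t ^+ L).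
  by apply: bmeasX; exact: bmeas_moment.
have lower : beta ^+ L * p <= \int[mpow mu N]_t (W X t * moment N d c mu t ^+ L).
  rewrite /p -Rint_mpow_box// -Rint_Z; last exact: bmeas_box.
  apply: Rint_le; [|exact: bmeasM|].
    by apply: bmeasM; [exact: bmeas_cst|exact: bmeas_box].
  move=> t; have [tV|tV] := pselect (forall i, V i (tnth t i)); last first.
    have [i iV] : exists i, ~ V i (tnth t i) by apply/existsNP.
    rewrite (bigD1 i)//= indicE memNset// mul0r mulr0 mulr_ge0//.
      by have /andP[] := window01 N e B (pdist (pts t)).
    by rewrite exprn_ge0// moment_ge0.
  rewrite big1 ?mulr1; last by move=> i _; rewrite indicE mem_set.
  rewrite /W window_eq1// ?mul1r.
    rewrite lerXn2r ?nnegrE ?moment_ge0//; first by case/andP: ab => + /ltW; exact: le_trans.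
    rewrite /beta /moment lerB//.
    apply: (@le_trans _ _ (\sum_(k < N.+1) (d^-1 * tau *+ N * M) ^+ 2)).
      apply: ler_sum => k _; rewrite cM -[leLHS]real_normK ?num_real// lerXn2r ?nnegrE//.
        by rewrite mulr_ge0 ?(ltW M0)// mulrn_wge0// mulr_ge0// ?(ltW tau0)// invr_ge0 ltW.
      by rewrite distrC; exact: wmean_lip.
    rewrite sumr_const card_ord (_ : _ *+ N.+1 = tau * (tau * C)); last first.
      rewrite /C -[LHS]mulr_natl -(mulr_natl (d^-1 * tau)) -(mulr_natl d^-1); ring.
    by rewrite (le_trans _ tauC)// ler_piMl// mulr_ge0// ltW.
  move=> i j _ _; have := pts_mdist i tau0 tV; have := pts_mdist j tau0 tV.
  rewrite /B /pdist; set x := pts t i; set y := pts t j; set u := pts b i; set v := pts b j.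
  have := metric_triangle u v y; have := metric_triangle u x y.
  have := metric_triangle x u y; have := metric_triangle u y v.
  rewrite [mdist x u]metric_sym [mdist y v]metric_sym ler_norml; lra.
have cI : \int[mpow (mu_ n) N]_t (W (X_ n) t * moment N d c (mu_ n) t ^+ L) @[n --> \oo] -->
    \int[mpow mu N]_t (W X t * moment N d c mu t ^+ L).
  have E (Y : mms R) (m : {finite_measure set (borel Y) -> \bar R}) :
      \int[mpow m N]_t (W Y t * moment N d c m t ^+ L) =
      \int[mpow m (L.*2 + N)]_t window_pow N d e c B L (pdist (@pts Y t)).
    rewrite -{1}[L]addn0 -(Rint_window_pow N c B d0 e0).
    by apply: eq_Rintegral => t _; rewrite expr0 mulr1.
  rewrite E; under eq_fun do rewrite E.
  exact: (gromov_weak_dcont gw (dcont_window_pow N c B d0 e0 L)).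
have cZ : \int[mpow (mu_ n) N]_t W (X_ n) t @[n --> \oo] --> Z.
  exact: (gromov_weak_dcont gw (dcont_window N B e0)).
have gap : 0 < beta ^+ L * p - alpha ^+ L * (Z + 1) by rewrite subr_gt0.
have c2 : N.+1%:R * mass (mu_ n) ^+ 2 @[n --> \oo] --> T.
  by apply: cvgMr; apply: cvgM; exact: gromov_weak_mass.
(* Without a suitable sample, the moment is at most [alpha] wherever the window is nonzero on the
   support, so the integral stays below [alpha ^+ L * (Z + 1)] and cannot converge to its limit. *)
near=> n; apply: contrapT => noa.
have In : \int[mpow (mu_ n) N]_t (W (X_ n) t * moment N d c (mu_ n) t ^+ L) >
    alpha ^+ L * (Z + 1).
  have : `|\int[mpow mu N]_t (W X t * moment N d c mu t ^+ L) -
    \int[mpow (mu_ n) N]_t (W (X_ n) t * moment N d c (mu_ n) t ^+ L)| <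
    beta ^+ L * p - alpha ^+ L * (Z + 1) by near: n; move/cvgrPdist_lt : cI; exact.
  by rewrite ltr_norml; lra.
have Zn : \int[mpow (mu_ n) N]_t W (X_ n) t <= Z + 1.
  have : `|Z - \int[mpow (mu_ n) N]_t W (X_ n) t| <= 1.
    by near: n; move/cvgrPdist_le : cZ; exact.
  by rewrite ler_norml; lra.
have Mn1 : `|M - mass (mu_ n)| <= k0 / 2.
  by near: n; move/cvgrPdist_le : gromov_weak_mass; apply; rewrite divr_gt0.
have Mn2 : N.+1%:R * mass (mu_ n) ^+ 2 - T <= k0 ^+ 2 / 8.
  have : `|T - N.+1%:R * mass (mu_ n) ^+ 2| <= k0 ^+ 2 / 8.
    by near: n; move/cvgrPdist_le : c2; apply; rewrite divr_gt0// exprn_gt0.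
  by rewrite ler_norml; lra.
move: In; apply/negP; rewrite -leNgt.
have aL0 : 0 <= alpha ^+ L by rewrite exprn_ge0//; case/andP: ab.
apply: (@le_trans _ _ (alpha ^+ L * \int[mpow (mu_ n) N]_t W (X_ n) t)); last first.
  by rewrite ler_wpM2l.
rewrite -Rint_Z//; apply: (@Rint_mpow_le_on _ (borel (X_ n)) R (mu_ n) (supp_root (X_ n)) N
  (fun t => W (X_ n) t * moment N d c (mu_ n) t ^+ L) (fun t => alpha ^+ L * W (X_ n) t)).
- exact: measurable_supp_root.
- exact: restr_supp_root_full.
- exact: bmeasM.
- by apply: bmeasM => //; exact: bmeas_cst.
move=> t St; rewrite mulrC.
have /andP[w0 _] := window01 N e B (pdist (pts t)).
have [->|wn0] := eqVneq (W (X_ n) t) 0; first by rewrite !mulr0.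
rewrite ler_wpM2r// lerXn2r ?nnegrE ?moment_ge0//; first by case/andP: ab.
rewrite le_max; apply/orP; right; rewrite leNgt; apply/negP => mt; apply: noa.
exists t; split => // [i j iN jN|k kN].
  rewrite (le_trans (window_neq0 e0 wn0 iN jN))// /e mulrC divfK//.
have sq : (wmean N d (mu_ n) k t - c k * mass (mu_ n)) ^+ 2 <= (k0 / 2) ^+ 2.
  move: mt; rewrite /moment (bigD1 (Ordinal (kN : (k < N.+1)%N)))//=.
  have : 0 <= \sum_(i < N.+1 | i != Ordinal (kN : (k < N.+1)%N))
      (wmean N d (mu_ n) i t - c i * mass (mu_ n)) ^+ 2.
    by apply: sumr_ge0 => i _; exact: sqr_ge0.
  rewrite expr_div_n; lra.
have h1 : `|wmean N d (mu_ n) k t - c k * mass (mu_ n)| <= k0 / 2.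
  by rewrite -(ler_pXn2r (n := 2))// ?nnegrE ?divr_ge0 ?(ltW k00)// real_normK ?num_real.
have h2 : `|c k * mass (mu_ n) - c k * M| <= k0 / 2.
  have /andP[ck0 ck1] := c01 k.
  by rewrite -mulrBr normrM ger0_norm// (le_trans _ Mn1)// distrC ler_piMl.
rewrite -cM (le_trans (ler_distD (c k * mass (mu_ n)) _ _))//.
by rewrite [leRHS]splitr lerD.
Unshelve. all: by end_near. Qed.

End sample_transfer.

(** A point of [S] is chosen in each ball of a countable base that meets [S]. *)
Lemma separable_subset_seq (R : realType) (T : completeMetricType R) (S : set T) :
  separable_space T -> S !=set0 -> exists q : nat -> T, (forall n, S (q n)) /\
    forall x (e : R), S x -> 0 < e -> exists n, mdist (q n) x < e.
Proof.
move=> /separable_seq[q dq] [x0 Sx0].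
pose P (c : nat * nat) x := S x /\ mdist (q c.1) x < c.2.+1%:R^-1.
pose s n := if unpickle n is Some c then
  (if pselect (exists x, P c x) is left h then sval (cid h) else x0) else x0.
exists s; split=> [n|x e Sx e0].
  rewrite /s; case: (unpickle n) => // c; case: pselect => // h.
  by case: (cid h) => /= y [].
pose k := Num.truncn (2 / e).
have ke : k.+1%:R^-1 < e / 2.
  by rewrite -[e / 2]invf_div ltf_pV2 ?posrE ?divr_gt0// truncnS_gt.
have [n qn] := dq x k.+1%:R^-1 ltac:(by []).
exists (pickle (n, k)); rewrite /s pickleK; case: pselect => [h|[]]; last by exists x.
case: (cid h) => /= y [_ /= yn].
rewrite (le_lt_trans (metric_triangle _ (q n) _))// [ltRHS]splitr metric_sym.
by rewrite ltrD ?(lt_trans _ ke).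
Qed.

(** * Existence of matchings *)

Section matching.
Context (R : realType).

Definition lip_on (T : metricType R) (S : set T) (f : T -> R) :=
  forall x y, S x -> S y -> `|f x - f y| <= mdist x y.

(* The last clause, on pairs of 1-Lipschitz functions that almost agree along the
   matching, says that the matching almost carries the restriction of [Y] to the
   ball of radius [r] to that of [X]. *)
Definition matching (Y X : mms R) (r e : R) (e1 : R) (N : nat) (a : nat -> Y) (b : nat -> X) :=
  [/\ a 0%N = point /\ b 0%N = point,
      forall i, supp_root Y (a i) /\ supp_root X (b i),
      forall i j, (i <= N)%N -> (j <= N)%N ->
        `|mdist (a i) (a j) - mdist (b i) (b j)| <= e1 &
      forall (f : Y -> R) (g : X -> R), bmeas (f : borel Y -> R) -> bmeas (g : borel X -> R) ->
        lip_on (supp_root Y) f -> lip_on (supp_root X) g ->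
        (forall x, `|f x| <= 1) -> (forall x, `|g x| <= 1) ->
        (forall i, (i <= N)%N -> `|f (a i) - g (b i)| <= e1) ->
        `|\int[mrestrict Y r]_x f x - \int[mrestrict X r]_x g x| <= e].

Lemma pts_supp_root (X : mms R) m (t : m.-tuple X) i :
  (forall i, supp_root X (tnth t i)) -> supp_root X (pts t i).
Proof.
move=> St; rewrite /pts; case: i => [|i] /=; first exact: supp_root_point.
have [im|mi] := ltnP i m; last first.
  by rewrite nth_default ?size_rev ?size_tuple//; exact: supp_root_point.
rewrite nth_rev ?size_tuple//; have jm : (m - i.+1 < m)%N by rewrite ltn_subrL/= (leq_ltn_trans _ im).
by have := St (Ordinal jm); rewrite (tnth_nth point).
Qed.

Variables (X_ : nat -> mms R) (X : mms R) (r : R).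
Hypothesis gw : gromov_weak_cvg (fun n => mms_restr (X_ n) r) (mms_restr X r).

Local Notation mu_ n := (mrestrict (X_ n) r).
Local Notation mu := (mrestrict X r).

Lemma msupport_restr : msupport mu `<=` supp_root X.
Proof.
move=> x Sx; left => U oU; apply: lt_le_trans (Sx U oU) _.
apply: le_measure; rewrite ?inE.
- by apply: measurableI; [apply: open_borel; case: oU|exact: measurable_cball].
- by apply: open_borel; case: oU.
- exact: subIsetl.
Qed.

(** When the limit has no mass in the ball, both integrals are small and matching the roots
    suffices. *)
Lemma matching_null e : 0 < e -> mass mu = 0 -> \forall n \near \oo,
  @matching (X_ n) X r e e 0 (fun=> point) (fun=> point).
Proof.
move=> e0 M0; near=> n; split=> //.
- by move=> i; split; exact: supp_root_point.
- by move=> i j _ _; rewrite !mdistxx subrr normr0 ltW.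
move=> f g bf bg _ _ f1 g1 _.
have Mn : mass (mu_ n) <= e.
  have : `|mass mu - mass (mu_ n)| <= e.
    by near: n; move/cvgrPdist_le : (gromov_weak_mass gw); exact.
  by rewrite M0 ler_norml; lra.
rewrite (le_trans (ler_normB _ _))//.
have h1 := Rint_norm_le (mu_ n) bf f1; have h2 := Rint_norm_le mu bg g1.
by move: h1 h2; rewrite M0 !mul1r; lra.
Unshelve. all: by end_near. Qed.

(** Both integrals are replaced by Riemann sums over the bump partitions around the two matched
    samples. The corresponding weights differ by at most [k0], and so do the remainders, which makes
    the remainder in [X_ n] small. *)
Lemma matching_pos e : 0 < e -> 0 < mass mu -> exists e1 N (b : nat -> X), 0 < e1 <= e /\
  \forall n \near \oo, exists a, @matching (X_ n) X r e e1 N a b.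
Proof.
move=> e0; set M := mass mu => M0.
have S0 : mu (~` msupport mu) = 0%E by exact: msupport_full (mms_separable X).
have mS : measurable (msupport mu : set (borel X)) by exact: measurable_msupport.
have [q [Sq dq]] : exists q : nat -> X, (forall n, msupport mu (q n)) /\
    forall x (c : R), msupport mu x -> 0 < c -> exists n, mdist (q n) x < c.
  apply: separable_subset_seq (mms_separable X) _; apply/set0P/negP => /eqP SE.
  by move: M0; rewrite /M /mass -setC0 -SE S0/= ltxx.
have M1 : 0 < M + 1 by rewrite ltr_wpDl// ltW.
(* Error budget: with masses at most [M + 1], each Riemann error is at most [e / 8]. The remainders
   cost [e / 16] each plus [k0], the differing weights [N * k0], and the differing values
   [e1 * M <= e / 4]; the terms in [k0] add up to at most [e / 8]. *)
pose d := e / (16 * (M + 1)); have d0 : 0 < d by rewrite divr_gt0// mulr_gt0.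
have dM : d * (M + 1) = e / 16 by rewrite /d invfM mulrA divfK ?gt_eqF.
have [N rN] : exists N, \int[mu]_x rest d (dists q x) N <= e / 16.
  have e16 : 0 < e / 16 by rewrite divr_gt0.
  have /cvgrPdist_le/(_ _ e16)[N _ /(_ N (leqnn _))] := Rint_rest_cvg0 mS S0 d0 dq.
  by rewrite /= sub0r normrN => /(le_trans (ler_norm _)); exists N.
pose e1 := Num.min e (e / (4 * (M + 1))).
have e10 : 0 < e1 by rewrite lt_min e0 divr_gt0// mulr_gt0.
have e1e : e1 <= e by rewrite ge_min lexx.
have e1M : e1 * M <= e / 4.
  have : e1 <= e / (4 * (M + 1)) by rewrite ge_min lexx orbT.
  rewrite ler_pdivlMr ?mulr_gt0// mulrDr mulr1; have := ltW e10; lra.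
pose k0 := Num.min e1 (e / (8 * N.+1%:R)).
have k00 : 0 < k0 by rewrite lt_min e10 divr_gt0// mulr_gt0.
have k0e1 : k0 <= e1 by rewrite ge_min lexx.
have k0N : N.+1%:R * k0 <= e / 8.
  have : k0 <= e / (8 * N.+1%:R) by rewrite ge_min lexx orbT.
  rewrite ler_pdivlMr ?mulr_gt0// mulrCA => ?; rewrite ler_pdivlMr// mulrC.
  by rewrite [N.+1%:R * k0]mulrC.
(* Reversed, because [pts] reads a tuple from its end. *)
pose b : N.-tuple X := mktuple (fun i : 'I_N => q (N - i.+1)%N).
have Sb i : msupport mu (tnth b i) by rewrite tnth_mktuple.
have bq i : (i < N)%N -> pts b i.+1 = q i.
  move=> iN; have sb : size b = N := size_tuple b.
  rewrite -[LHS]/(nth point (rev b) i) nth_rev ?sb//.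
  have jN : (N - i.+1 < N)%N by rewrite ltn_subrL/= (leq_ltn_trans _ iN).
  rewrite -[(N - i.+1)%N]/(nat_of_ord (Ordinal jN)) -tnth_nth tnth_mktuple/=.
  by rewrite subnSK// subKn// ltnW.
exists e1, N, (pts b); split; first by rewrite e10.
have := sample_approx gw d0 k00 M0 Sb; have := gromov_weak_mass gw.
move=> /cvgrPdist_le/(_ 1 ltr01); apply: filterS2 => n Mn [a [Sa Da wa]].
have {}Mn : mass (mu_ n) <= M + 1 by move: Mn; rewrite ler_norml -/M; lra.
exists (pts a); split=> //.
- move=> i; split; first exact: pts_supp_root.
  by apply: pts_supp_root => j; exact: msupport_restr.
- by move=> i j iN jN; rewrite (le_trans (Da i j iN jN)).
move=> f g bf bg lf lg f1 g1 fg.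
pose pa i := pts a i.+1; pose pb i := pts b i.+1.
have SY : mu_ n (~` supp_root (X_ n)) = 0%E by exact: restr_supp_root_full.
have SX : mu (~` supp_root X) = 0%E by exact: restr_supp_root_full.
have d2 : 0 <= 2 * d by rewrite mulr_ge0// ltW.
have hY : `|\int[mu_ n]_x f x - \sum_(i < N) f (pa i) * \int[mu_ n]_x part d (dists pa x) i| <=
    (2 * d) * mass (mu_ n) + 1 * \int[mu_ n]_x rest d (dists pa x) N.
  apply: (@Rint_part _ _ _ (supp_root (X_ n)) _ _ _ _ (f \o pa)) => //.
    exact: measurable_supp_root.
  move=> i x _ Sx xi; rewrite (le_trans (lf _ _ Sx _))//.
    exact: pts_supp_root.
  by rewrite metric_sym.
have hX : `|\int[mu]_x g x - \sum_(i < N) g (pb i) * \int[mu]_x part d (dists pb x) i| <=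
    (2 * d) * M + 1 * \int[mu]_x rest d (dists pb x) N.
  apply: (@Rint_part _ _ _ (supp_root X) _ _ _ _ (g \o pb)) => //.
    exact: measurable_supp_root.
  move=> i x _ Sx xi; rewrite (le_trans (lg _ _ Sx _))//.
    by apply: pts_supp_root => j; exact: msupport_restr.
  by rewrite metric_sym.
have wpart i : (i < N)%N ->
    `|\int[mu_ n]_x part d (dists pa x) i - \int[mu]_x part d (dists pb x) i| <= k0.
  by move=> iN; have := wa i (ltnW iN); rewrite /wmean /wt iN.
have wrest : `|\int[mu_ n]_x rest d (dists pa x) N - \int[mu]_x rest d (dists pb x) N| <= k0.
  by have := wa N (leqnn N); rewrite /wmean /wt ltnn.
have restb : \int[mu]_x rest d (dists pb x) N <= e / 16.
  rewrite (le_trans _ rN)// le_eqVlt; apply/orP; left; apply/eqP.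
  by apply: eq_Rintegral => x _; apply: rest_local => j jN; rewrite /dists /pb bq.
have partb0 i : 0 <= \int[mu]_x part d (dists pb x) i.
  by apply: Rintegral_ge0 => x _; have /andP[] := part01 d (dists pb x) i.
have sumb : \sum_(i < N) \int[mu]_x part d (dists pb x) i <= M.
  rewrite -Rint_sum; last by move=> i; exact: bmeas_part.
  rewrite -[leRHS]mul1r -Rint_cst; apply: Rint_le; last 1 first.
  - move=> x; rewrite -(sum_part d (dists pb x) N) lerDl.
    by have /andP[] := rest01 d (dists pb x) N.
  - by apply: bmeas_sum => i; exact: bmeas_part.
  - exact: bmeas_cst.
have sums : `|\sum_(i < N) f (pa i) * \int[mu_ n]_x part d (dists pa x) i -
    \sum_(i < N) g (pb i) * \int[mu]_x part d (dists pb x) i| <= k0 *+ N + e1 * M.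
  rewrite -sumrB (le_trans (ler_norm_sum _ _ _))//.
  apply: (@le_trans _ _ (\sum_(i < N) (k0 + e1 * \int[mu]_x part d (dists pb x) i))).
    apply: ler_sum => i _; set u := \int[mu_ n]_x _; set v := \int[mu]_x _.
    rewrite (_ : _ - _ = f (pa i) * (u - v) + (f (pa i) - g (pb i)) * v); last by ring.
    rewrite (le_trans (ler_normD _ _))// !normrM lerD//.
      by rewrite (le_trans _ (wpart i (ltn_ord i)))// ler_piMl.
    rewrite [X in _ * X]ger0_norm; last exact: partb0.
    by rewrite ler_wpM2r//; [exact: partb0|exact: fg].
  by rewrite big_split/= sumr_const card_ord -mulr_sumr lerD2l ler_wpM2l// ltW.
have k0N1 : k0 *+ N + k0 <= e / 8 by rewrite -mulrSr -(mulr_natl k0).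
have t1 : 2 * d * mass (mu_ n) <= 2 * (e / 16).
  by rewrite -dM mulrA ler_wpM2l.
have t2 : 2 * d * M <= 2 * (e / 16).
  by rewrite -dM mulrA ler_wpM2l// lerDl.
move: hY hX wrest sums; rewrite !ler_norml => /andP[? ?] /andP[? ?] /andP[? ?] /andP[? ?].
apply/andP; split; lra.
Qed.

Lemma matching_eventually e : 0 < e -> exists e1, 0 < e1 <= e /\
  \forall n \near \oo, exists N a b, @matching (X_ n) X r e e1 N a b.
Proof.
move=> e0; have [M0|M0] := leP (mass mu) 0.
  exists e; split; first by rewrite e0 lexx.
  have {}M0 : mass mu = 0 by apply/eqP; rewrite eq_le M0 mass_ge0.
  apply: filterS (matching_null e0 M0) => n h.
  by exists 0%N, (fun=> point), (fun=> point).
have [e1 [N [b [e1e near_n]]]] := matching_pos e0 M0; exists e1; split => //.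
by apply: filterS near_n => n [a h]; exists N, a, b.
Qed.

End matching.

(** * Gluing spaces along approximate matchings *)

Section completion.
Context (R : realType) (Z : Type).

Definition pseudodist (d : Z -> Z -> R) := [/\ forall x, d x x = 0,
  forall x y, d x y = d y x & forall y x z, d x z <= d x y + d y z].

(* A point of the completion is represented by the function giving its distances
   to the points of [Z]. *)
Definition completion (d : Z -> Z -> R) (z0 : Z) (pd : pseudodist d) : Type :=
  {f : Z -> R | forall e, 0 < e -> exists z, forall w, `|f w - d z w| <= e}.

Variables (d : Z -> Z -> R) (z0 : Z) (pd : pseudodist d).
Local Notation E := (completion z0 pd).

HB.instance Definition _ := gen_eqMixin E.
HB.instance Definition _ := gen_choiceMixin E.

Definition to_completion (z : Z) : E.
Proof.
by exists (d z) => e e0; exists z => w; rewrite subrr normr0 ltW.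
Defined.

HB.instance Definition _ := isPointed.Build E (to_completion z0).

(** The supremum distance of the Kuratowski embedding. Points of [Z] at pseudodistance 0 have the
    same distance function, so they are identified without a separate quotient. *)
Definition cdist (f g : E) := sup [set `|sval f w - sval g w| | w in setT].

Let dC x y : d x y = d y x. Proof. by case: pd. Qed.
Let dxx x : d x x = 0. Proof. by case: pd. Qed.
Let dD y x z : d x z <= d x y + d y z. Proof. by case: pd. Qed.

Let dB x y w : `|d x w - d y w| <= d x y.
Proof.
have := dD y x w; have := dD x y w; rewrite [d y x]dC ler_norml; lra.
Qed.

Lemma cdist_has_sup (f g : E) : has_sup [set `|sval f w - sval g w| | w in setT].
Proof.
split; first by exists `|sval f z0 - sval g z0|, z0.
have [z fz] := svalP f 1 ltr01; have [z' gz'] := svalP g 1 ltr01.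
exists (1 + d z z' + 1) => _ [w _ <-].
have := fz w; have := gz' w; have := dB z z' w; rewrite !ler_norml; lra.
Qed.

Lemma cdist_ge (f g : E) w : `|sval f w - sval g w| <= cdist f g.
Proof. by apply: sup_upper_bound; [exact: cdist_has_sup|exists w]. Qed.

Lemma cdist_le (f g : E) c : (forall w, `|sval f w - sval g w| <= c) -> cdist f g <= c.
Proof.
move=> fgc; apply: ge_sup; first by have [] := cdist_has_sup f g.
by move=> _ [w _ <-].
Qed.

Let cdistxx f : cdist f f = 0.
Proof.
apply/eqP; rewrite eq_le; apply/andP; split.
  by apply: cdist_le => w; rewrite subrr normr0.
by rewrite (le_trans (normr_ge0 _) (cdist_ge f f z0)).
Qed.

Let cdist_pos f g : cdist f g = 0 -> f = g.
Proof.
move=> fg0; have {fg0} : sval f = sval g.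
  apply/funext => w; have := cdist_ge f g w.
  by rewrite fg0 normr_le0 subr_eq0 => /eqP.
by case: f => f pf; case: g => g pg /= fg; exact: eq_exist.
Qed.

Let cdistC f g : cdist f g = cdist g f.
Proof.
by congr (sup _); apply/seteqP; split => _ [w _ <-]; exists w => //; rewrite distrC.
Qed.

Let cdistD g f h : cdist f h <= cdist f g + cdist g h.
Proof.
apply: cdist_le => w; rewrite (le_trans (ler_distD (sval g w) _ _))//.
by rewrite lerD// cdist_ge.
Qed.

HB.instance Definition _ := isMetric.Build R E cdistxx cdist_pos cdistC cdistD.

Lemma completion_mdistE (f g : E) : mdist f g = cdist f g.
Proof. by []. Qed.

(** The pointwise limit of the distance functions is uniform, because the Cauchy bounds do not
    depend on the point [w]; hence the limit is again uniformly approximated by functions [d z]. *)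
Lemma completion_complete (F : set_system E) : ProperFilter F -> cauchy F -> cvg F.
Proof.
move=> PF /cauchyP cF.
have {}cF e : 0 < e -> exists x : E, F [set f | cdist x f < e].
  by move=> e0; have [x] := cF e e0; rewrite ballEmdist; exists x.
have /choice[g gF] (w : Z) : exists r : R, sval f w @[f --> F] --> r.
  apply/cvg_ex; apply: cauchy_cvg; apply: cauchy_exP => e e0.
  have [x Fx] := cF e e0; exists (sval x w).
  suff : F [set f | ball (sval x w) e (sval f w)] by [].
  apply: filterS Fx => f /= xf.
  by apply: le_lt_trans xf; exact: cdist_ge.
have gx (e : R) (x : E) : F [set f | cdist x f < e] -> forall w, `|sval x w - g w| <= e.
  move=> Fx w; apply: (@closed_cvg _ _ F _ (fun f : E => `|sval x w - sval f w|)
      [set y | y <= e]).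
  - exact: closed_le.
  - by apply: filterS Fx => f /= xf; rewrite (le_trans (cdist_ge _ _ _))// ltW.
  - by apply: cvg_norm; apply: cvgB; [exact: cvg_cst|exact: gF].
have gE e : 0 < e -> exists z, forall w, `|g w - d z w| <= e.
  move=> e0; have e2 : 0 < e / 2 by rewrite divr_gt0.
  have [x Fx] := cF _ e2; have [z xz] := svalP x _ e2; exists z => w.
  rewrite (le_trans (ler_distD (sval x w) _ _))// [leRHS]splitr lerD//.
  by rewrite distrC; exact: gx.
pose G : E := exist _ g gE.
apply/cvg_ex; exists G; apply/metricType_numDomainType.fcvgrPdist_lt => e e0.
have e2 : 0 < e / 2 by rewrite divr_gt0.
have [x Fx] := cF _ e2; near=> f; rewrite completion_mdistE.
rewrite (le_lt_trans (cdistD x _ _))// [ltRHS]splitr ler_ltD//; last by near: f.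
by rewrite cdistC; apply: cdist_le => w /=; exact: gx.
Unshelve. all: by end_near. Qed.

HB.instance Definition _ := Uniform_isComplete.Build E completion_complete.

Lemma to_completion_mdist x y : mdist (to_completion x) (to_completion y) = d x y.
Proof.
rewrite completion_mdistE; apply/eqP; rewrite eq_le; apply/andP; split.
  by apply: cdist_le => w /=; exact: dB.
have := cdist_ge (to_completion x) (to_completion y) y; rewrite /= dxx subr0.
exact/le_trans/ler_norm.
Qed.

Lemma to_completion_dense (f : E) e : 0 < e -> exists z, mdist f (to_completion z) <= e.
Proof.
move=> e0; have [z fz] := svalP f e e0; exists z.
by rewrite completion_mdistE; exact: cdist_le.
Qed.

Lemma completion_pseudo_separable : (exists q : nat -> Z, forall z (e : R), 0 < e ->
  exists n, d z (q n) < e) -> separable_space E.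
Proof.
move=> [q dq]; exists (range (to_completion \o q)); first
  exact: (card_image_le (to_completion \o q) [set: nat]).
move=> U [f Uf] oU; have [e e0 eU] := (open_mdistP U).1 oU f Uf.
have e2 : 0 < e / 2 by rewrite divr_gt0.
have [z fz] := to_completion_dense f e2; have [n zn] := dq z _ e2.
exists (to_completion (q n)); split; last by exists n.
apply: eU; rewrite (le_lt_trans (metric_triangle _ (to_completion z) _))//.
by rewrite [ltRHS]splitr ler_ltD// to_completion_mdist.
Qed.

End completion.

Section gluing.
Context (R : realType) (I : eqType) (T : I -> Type) (m : forall i, T i -> T i -> R).
Variables (C : Type) (mC : C -> C -> R) (c0 : C) (F : forall i, T i -> C -> R).
Arguments F {i}.
Arguments m {i}.

(* [F x] is a one-point extension of the central space [C] (a Katetov function);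
   two points of different spaces are joined through [C]. *)
Hypotheses (pm : forall i, pseudodist (@m i)).
Hypothesis F0 : forall i (x : T i) y, 0 <= F x y.
Hypothesis FC : forall i (x : T i) y z, F x y <= F x z + mC z y.
Hypothesis CF : forall i (x : T i) y z, mC y z <= F x y + F x z.
Hypothesis FT : forall i (x y : T i) z, F x z <= m x y + F y z.
Hypothesis TF : forall i (x y : T i) z, m x y <= F x z + F y z.

Definition bridge i j (x : T i) (y : T j) := inf [set F x z + F y z | z in setT].

Lemma bridge_le i j (x : T i) (y : T j) z : bridge x y <= F x z + F y z.
Proof.
apply: ge_inf; last by exists z.
by exists 0 => _ [w _ <-]; rewrite addr_ge0.
Qed.

Lemma bridge_ge i j (x : T i) (y : T j) b :
  (forall z, b <= F x z + F y z) -> b <= bridge x y.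
Proof.
by move=> h; apply: lb_le_inf; [exists (F x c0 + F y c0), c0|move=> _ [z _ <-]].
Qed.

Lemma bridgeC i j (x : T i) (y : T j) : bridge x y = bridge y x.
Proof. by congr (inf _); apply/seteqP; split => _ [z _ <-]; exists z => //; rewrite addrC. Qed.

(** If the two bridges at [y] pass through [u] and [v] in [C], then [CF] bounds the distance from
    [v] to [u] by the cost of the detour via [y], and [FC] moves [z] from one crossing to the
    other. *)
Lemma bridgeD i j k (x : T i) (y : T j) (z : T k) :
  bridge x z <= bridge x y + bridge y z.
Proof.
rewrite -lerBlDr; apply: bridge_ge => u; rewrite lerBlDr -lerBlDl.
apply: bridge_ge => v; have := bridge_le x z u.
by have := FC z u v; have := CF y v u; lra.
Qed.

Lemma bridge_dist i j (x y : T i) (z : T j) : bridge x z <= m x y + bridge y z.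
Proof.
rewrite -lerBlDl; apply: bridge_ge => u; have := bridge_le x z u.
by have := FT x y u; lra.
Qed.

Lemma dist_bridge i j (x z : T i) (y : T j) : m x z <= bridge x y + bridge y z.
Proof.
rewrite -lerBlDr; apply: bridge_ge => u; rewrite lerBlDr -lerBlDl.
apply: bridge_ge => v.
by have := TF x z u; have := FC z u v; have := CF y v u; lra.
Qed.

Definition glue_dist (u v : {i & T i}) :=
  if tag u == tag v then m (tagged u) (tagged_as u v) else bridge (tagged u) (tagged v).

Lemma glue_dist_same i (x y : T i) : glue_dist (Tagged T x) (Tagged T y) = m x y.
Proof. by rewrite /glue_dist/= eqxx tagged_asE. Qed.

Lemma glue_dist_neq i j (x : T i) (y : T j) : i != j ->
  glue_dist (Tagged T x) (Tagged T y) = bridge x y.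
Proof. by rewrite /glue_dist/= => /negPf ->. Qed.

Lemma glue_pseudodist : pseudodist glue_dist.
Proof.
split=> [[i x]|[i x] [j y]|[j y] [i x] [k z]].
- by rewrite glue_dist_same; have [] := pm i.
- have [ij|ij] := eqVneq i j; last first.
    by rewrite glue_dist_neq// glue_dist_neq 1?eq_sym// bridgeC.
  by subst j; rewrite !glue_dist_same; have [] := pm i.
have [ij|ij] := eqVneq i j; have [jk|jk] := eqVneq j k.
- by subst j k; rewrite !glue_dist_same; have [] := pm i.
- by subst j; rewrite glue_dist_same !glue_dist_neq//; exact: bridge_dist.
- subst k; rewrite glue_dist_same !glue_dist_neq//; have := bridge_dist z y x.
  rewrite (bridgeC z x) (bridgeC y x) addrC; have [_ -> _] := pm j; exact.
have [ik|ik] := eqVneq i k; last by rewrite !glue_dist_neq//; exact: bridgeD.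
by subst k; rewrite glue_dist_same !glue_dist_neq//; exact: dist_bridge.
Qed.

End gluing.

Section mms_gluing.
Context (R : realType) (X_ : nat -> mms R) (X : mms R).
Variables (e : nat -> R) (N : nat -> nat) (a : forall n, nat -> X_ n) (b : nat -> nat -> X).
Hypothesis e0 : forall n, 0 < e n.
Hypothesis a0 : forall n, a n 0%N = point /\ b n 0%N = point.
Hypothesis abS : forall n i, supp_root (X_ n) (a n i) /\ supp_root X (b n i).
Hypothesis abD : forall n i j, (i <= N n)%N -> (j <= N n)%N ->
  `|mdist (a n i) (a n j) - mdist (b n i) (b n j)| <= e n.

Let Y (p : option nat) : mms R := if p is Some n then X_ n else X.
Let T p := {x : Y p | supp_root (Y p) x}.
Let m p (x y : T p) : R := mdist (sval x) (sval y).

Let gap n i : R := if i is 0%N then 0 else e n.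

Let katetov n (x : X_ n) (y : X) : R :=
  inf [set mdist x (a n i) + mdist (b n i) y + gap n i | i in [set i | (i <= N n)%N]].

Let gap0 n i : 0 <= gap n i.
Proof. by case: i => [|i] //=; exact: ltW. Qed.

Let katetov_le n (x : X_ n) y i : (i <= N n)%N ->
  katetov x y <= mdist x (a n i) + mdist (b n i) y + gap n i.
Proof.
move=> iN; apply: ge_inf; last by exists i.
by exists 0 => _ [j _ <-]; rewrite !addr_ge0 ?mdist_ge0.
Qed.

Let katetov_ge n (x : X_ n) y c : (forall i, (i <= N n)%N ->
  c <= mdist x (a n i) + mdist (b n i) y + gap n i) -> c <= katetov x y.
Proof.
move=> h; apply: lb_le_inf; last by move=> _ [i iN <-]; exact: h.
by exists (mdist x (a n 0%N) + mdist (b n 0%N) y + gap n 0), 0%N.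
Qed.

(** The slack that the inequalities [CF] and [TF] require. It survives the zero gap of the roots:
    between two roots both distances vanish, and any other pair has at least one gap [e n]. *)
Let abG n i j : (i <= N n)%N -> (j <= N n)%N ->
  `|mdist (a n i) (a n j) - mdist (b n i) (b n j)| <= gap n i + gap n j.
Proof.
move=> iN jN; have := abD iN jN; have := e0 n; have [an bn] := a0 n.
case: i iN => [|i] iN; case: j jN => [|j] jN /=; rewrite ?an ?bn ?mdistxx ?subrr ?normr0; lra.
Qed.

(** For the limit itself, indexed by [None], the function is its own metric, so the bridge between
    [X_ n] and the limit is [katetov]. *)
Let F p : T p -> X -> R :=
  match p with
  | Some n => fun x => @katetov n (sval x)
  | None => fun x => mdist (sval x)
  end.

Let pm p : pseudodist (@m p).
Proof.
split=> [x|x y|y x z]; rewrite /m; [exact: mdistxx|exact: metric_sym|exact: metric_triangle].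
Qed.

Let F0 p (x : T p) y : 0 <= F x y.
Proof.
case: p x => [n|] x /=; last exact: mdist_ge0.
by apply: katetov_ge => i _; rewrite !addr_ge0 ?mdist_ge0.
Qed.

Let FC p (x : T p) y z : F x y <= F x z + mdist z y.
Proof.
case: p x => [n|] x /=; last exact: metric_triangle.
rewrite -lerBlDr; apply: katetov_ge => i iN; have := katetov_le (sval x) y iN.
by have := metric_triangle (b n i) z y; lra.
Qed.

Let CF p (x : T p) y z : mdist y z <= F x y + F x z.
Proof.
case: p x => [n|] x /=; last by rewrite [mdist _ y]metric_sym metric_triangle.
rewrite -lerBlDr; apply: katetov_ge => i iN; rewrite lerBlDr -lerBlDl.
apply: katetov_ge => j jN; have := abG iN jN; rewrite ler_norml => /andP[+ _].
have := metric_triangle y (b n i) z; have := metric_triangle (b n i) (b n j) z.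
have := metric_triangle (a n i) (sval x) (a n j).
rewrite [mdist y (b n i)]metric_sym [mdist (a n i) (sval x)]metric_sym; lra.
Qed.

Let FT p (x y : T p) z : F x z <= m x y + F y z.
Proof.
case: p x y => [n|] x y /=; last exact: metric_triangle.
rewrite -lerBlDl; apply: katetov_ge => i iN; have := katetov_le (sval x) z iN.
by have := metric_triangle (sval x) (sval y) (a n i); rewrite /m/=; lra.
Qed.

Let TF p (x y : T p) z : m x y <= F x z + F y z.
Proof.
case: p x y => [n|] x y /=; last by rewrite [mdist (sval y) z]metric_sym metric_triangle.
rewrite -lerBlDr; apply: katetov_ge => i iN; rewrite lerBlDr -lerBlDl.
apply: katetov_ge => j jN; have := abG iN jN; rewrite ler_norml => /andP[_ +].
have := metric_triangle (sval x) (a n i) (sval y).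
have := metric_triangle (a n i) (a n j) (sval y).
have := metric_triangle (b n i) z (b n j).
rewrite [mdist (sval y) (a n j)]metric_sym [mdist (b n j) z]metric_sym /m/=; lra.
Qed.

Let pd := glue_pseudodist point pm F0 FC CF FT TF.
Let root p : T p := exist _ point (supp_root_point (Y p)).
Let E : completeMetricType R := completion (Tagged T (root None)) pd.

Let phi p (x : Y p) : E :=
  if pselect (supp_root (Y p) x) is left h
  then to_completion (Tagged T (root None)) pd (Tagged T (exist _ x h : T p)) else point.

Lemma phiE p (x : Y p) (h : supp_root (Y p) x) :
  phi x = to_completion (Tagged T (root None)) pd (Tagged T (exist _ x h : T p)).
Proof. by rewrite /phi; case: pselect => // h'; rewrite (Prop_irrelevance h h'). Qed.

Let phi_iso p : isometric_on (supp_root (Y p)) (@phi p).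
Proof.
by move=> x y Sx Sy; rewrite (phiE Sx) (phiE Sy) to_completion_mdist glue_dist_same.
Qed.

(** The pair of index 0 joins the roots at cost 0, and the completion turns pseudodistance 0 into
    equality. *)
Let phi_root p : @phi p point = point.
Proof.
rewrite (phiE (supp_root_point _)); case: p => [n|]; last first.
  congr (to_completion _ _ (Tagged T (exist _ _ _ : T None))); exact: Prop_irrelevance.
apply: mdist_positivity; rewrite to_completion_mdist glue_dist_neq//.
apply/eqP; rewrite eq_le; apply/andP; split; last first.
  by apply: (bridge_ge point) => z; rewrite addr_ge0.
have := bridge_le F0 (exist _ point (supp_root_point (X_ n)) : T (Some n)) (root None) point.
rewrite /= mdistxx addr0 => /le_trans; apply.
have [an bn] := a0 n; have := @katetov_le n point point 0%N isT.
by rewrite an bn !mdistxx /= !addr0.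
Qed.

Let phi_close n i : (i <= N n)%N ->
  mdist (@phi (Some n) (a n i)) (@phi None (b n i)) <= e n.
Proof.
move=> iN; have [Sa Sb] := abS n i.
rewrite (@phiE (Some n) _ Sa) (@phiE None _ Sb) to_completion_mdist glue_dist_neq//.
have := bridge_le F0 (exist _ _ Sa : T (Some n)) (exist _ _ Sb : T None) (b n i).
rewrite /= mdistxx addr0 => /le_trans; apply.
rewrite (le_trans (katetov_le _ _ iN))// !mdistxx !add0r.
by case: (i) => [|j] //=; exact: ltW.
Qed.

Let phi_dense (x : E) (c : R) : 0 < c ->
  exists p, exists2 y : Y p, supp_root (Y p) y & mdist x (phi y) <= c.
Proof.
move=> c0; have [[p [y Sy]] xy] := to_completion_dense x c0.
by exists p, y => //; rewrite (phiE Sy).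
Qed.

Let E_separable : separable_space E.
Proof.
have ex_q p : exists q : nat -> Y p, (forall n, supp_root (Y p) (q n)) /\
    forall x (c : R), supp_root (Y p) x -> 0 < c -> exists n, mdist (q n) x < c.
  apply: separable_subset_seq; first exact: mms_separable.
  by exists point; exact: supp_root_point.
pose q p := sval (cid (ex_q p)); have hq p := svalP (cid (ex_q p)).
apply: completion_pseudo_separable.
exists (fun k => if unpickle k is Some (p, n)
  then Tagged T (exist _ (q p n) ((hq p).1 n) : T p) else Tagged T (root None)).
move=> [p [y Sy]] c c0; have [n yn] := (hq p).2 y c Sy c0.
by exists (pickle (p, n)); rewrite pickleK glue_dist_same /m/= metric_sym.
Qed.

(** The last clause records that [E] contains nothing beyond limits of image points; the total
    boundedness of bounded sets of [E] is read off from it. *)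
Lemma gluing_exists : exists (E : completeMetricType R) (phi_ : forall n, X_ n -> E)
  (phi : X -> E), [/\ separable_space E, forall n, root_embedding (phi_ n),
    root_embedding phi,
    forall n i, (i <= N n)%N -> mdist (phi_ n (a n i)) (phi (b n i)) <= e n &
    forall (x : E) (c : R), 0 < c ->
      (exists2 y, supp_root X y & mdist x (phi y) <= c) \/
      (exists n, exists2 y, supp_root (X_ n) y & mdist x (phi_ n y) <= c)].
Proof.
exists E, (fun n => @phi (Some n)), (@phi None); split.
- exact: E_separable.
- by move=> n; split; [exact: (@phi_iso (Some n))|exact: (@phi_root (Some n))].
- by split; [exact: (@phi_iso None)|exact: (@phi_root None)].
- exact: phi_close.
- move=> x c c0; have [[n|] xc] := phi_dense x c0; last by left.
  by right; exists n.
Qed.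

End mms_gluing.

(** [kappa n] is the largest level [k <= n] that holds at [n]; level 0 guarantees that there is
    one. *)
Lemma diagonal_sequence (P : nat -> nat -> Prop) : (forall n, P 0%N n) ->
  (forall k, \forall n \near \oo, P k n) ->
  exists kappa : nat -> nat, (forall n, P (kappa n) n) /\
    forall K, \forall n \near \oo, (K <= kappa n)%N.
Proof.
move=> P0 Pk.
exists (fun n => \max_(k < n.+1 | `[< P k n >]) (k : nat)); split => [n|K].
  have [k Pkn ->] := @eq_bigmax_cond _ (fun k : 'I_n.+1 => `[< P k n >])
    (fun k => k : nat) ltac:(by apply/card_gt0P; exists ord0; apply/asboolP; exact: P0).
  exact/asboolP.
near=> n; have PKn : P K n by near: n; exact: Pk.
have Kn : (K < n.+1)%N by rewrite ltnS; near: n; exact: nbhs_infty_ge.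
apply: (@leq_bigmax_cond _ (fun k : 'I_n.+1 => `[< P k n >]) (fun k => k : nat) (Ordinal Kn)).
exact/asboolP.
Unshelve. all: by end_near. Qed.

(** * The common space of a Gromov-vaguely convergent sequence *)

Section common_space.
Context (R : realType) (X_ : nat -> mms R) (X : mms R).

(** The tuple holds all the data of one gluing. The comparison of measures is demanded from level 1
    on, so that matching the roots alone always realises level 0. *)
Definition close_up_to (k n : nat) (r e : R) (D : R * nat * (nat -> X_ n) * (nat -> X)) :=
  let: (e1, N, a, b) := D in
  [/\ 0 < e1, a 0%N = point /\ b 0%N = point,
    forall i, supp_root (X_ n) (a i) /\ supp_root X (b i),
    forall i j, (i <= N)%N -> (j <= N)%N ->
        `|mdist (a i) (a j) - mdist (b i) (b j)| <= e1 &
    (0 < k)%N -> matching r e e1 N a b].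

Lemma gromov_vague_embedding : gromov_vague_cvg X_ X ->
  exists (E : completeMetricType R) (phi_ : forall n, X_ n -> E) (phi : X -> E)
    (rphi_ : forall n, root_embedding (phi_ n)) (rphi : root_embedding phi),
    [/\ separable_space E,
      lip_cvg (fun n => embedded (rphi_ n)) (embedded rphi) &
      forall (x : E) (c : R), 0 < c ->
        (exists2 y, supp_root X y & mdist x (phi y) <= c) \/
        (exists n, exists2 y, supp_root (X_ n) y & mdist x (phi_ n y) <= c)].
Proof.
move=> gv.
have /choice[r hr] (k : nat) : exists r : R, k%:R < r /\
    gromov_weak_cvg (fun n => mms_restr (X_ n) r) (mms_restr X r).
  have [r /andP[kr _] nbad] := countable_avoid k%:R gv; exists r; split => //.
  by apply: contrapT => ngw; apply: nbad; split => //; exact: le_lt_trans kr.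
(* Level [k] ties the precision [1 / (k + 1)] to a radius beyond [k]: a test of bounded support is
   eventually unaffected by the restriction, while its error tends to 0. *)
pose P k n := exists D, @close_up_to k n (r k) k.+1%:R^-1 D.
have P0 n : P 0%N n.
  exists (1, 0%N, fun=> point, fun=> point); split => //.
    by move=> i; split; exact: supp_root_point.
  by move=> i j _ _; rewrite !mdistxx subrr normr0.
have Pk k : \forall n \near \oo, P k n.
  have [e1 [/andP[e10 _] near_n]] :=
    matching_eventually (hr k).2 (ltac:(by []) : 0 < k.+1%:R^-1 :> R).
  apply: filterS near_n => n [N [a [b ab]]]; exists (e1, N, a, b).
  by have [? ? ? _] := ab.
have [kappa [Pkappa kappaoo]] := diagonal_sequence P0 Pk.
pose D n := sval (cid (Pkappa n)); have hD n := svalP (cid (Pkappa n)).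
pose e n := (D n).1.1.1; pose N n := (D n).1.1.2; pose a n := (D n).1.2; pose b n := (D n).2.
have {}hD n : @close_up_to (kappa n) n (r (kappa n)) (kappa n).+1%:R^-1 (e n, N n, a n, b n).
  by move: (hD n); rewrite /e /N /a /b /D; case: (sval _) => [[[]]].
have e0 n : 0 < e n by have [] := hD n.
have a0 n : a n 0%N = point /\ b n 0%N = point by have [] := hD n.
have abS n i : supp_root (X_ n) (a n i) /\ supp_root X (b n i) by have [] := hD n.
have abD n i j : (i <= N n)%N -> (j <= N n)%N ->
  `|mdist (a n i) (a n j) - mdist (b n i) (b n j)| <= e n by have [_ _ _ h _] := hD n; exact: h.
have [E [phi_ [phi [sepE rphi_ rphi close dense]]]] := gluing_exists e0 a0 abS abD.
exists E, phi_, phi, rphi_, rphi; split => //.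
move=> h ht; have [[l lh] h01 [s hs]] := ht; have bh := lip_test_bmeas ht.
(* Matchings compare functions that are 1-Lipschitz and bounded by 1; dividing by [L >= 1] achieves
   both, and [kc] below pays for undoing it. *)
pose L := Num.max l 1; have L0 : 0 < L by rewrite lt_max ltr01 orbT.
pose h' x := L^-1 * h x.
have h'lip x y : `|h' x - h' y| <= mdist x y.
  rewrite -mulrBr normrM gtr0_norm ?invr_gt0// mulrC ler_pdivrMr// mulrC.
  by rewrite (le_trans (lh x y))// ler_wpM2r ?mdist_ge0// le_max lexx.
have h'1 x : `|h' x| <= 1.
  have /andP[h0 h1] := h01 x; rewrite normrM !ger0_norm// ?invr_ge0 ?(ltW L0)//.
  by rewrite mulrC ler_pdivrMr// mul1r (le_trans h1)// le_max lexx orbT.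
have bh' : bmeas (h' : borel E -> R) by apply: bmeasM => //; exact: bmeas_cst.
apply/cvgrPdist_le => c c0; near=> n.
have kn1 : (0 < kappa n)%N by near: n; exact: kappaoo.
have ks : s <= (kappa n)%:R.
  apply: (@le_trans _ _ (Num.truncn `|s|).+1%:R).
    by rewrite (le_trans (ler_norm _))// ltW// truncnS_gt.
  by rewrite ler_nat; near: n; exact: kappaoo.
have kc : L / (kappa n).+1%:R <= c.
  rewrite ler_pdivrMr// -ler_pdivrMl// mulrC.
  apply: (@le_trans _ _ (Num.truncn (L / c)).+1%:R); first by rewrite ltW// truncnS_gt.
  by rewrite ler_nat leqW//; near: n; exact: kappaoo.
have [_ _ _ _ /(_ kn1)[_ _ _ hm]] := hD n.
have hsk x : r (kappa n) < mdist point x -> h x = 0.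
  by move=> rx; apply: hs; rewrite (le_lt_trans ks)// (lt_trans _ rx)//; case: (hr (kappa n)).
rewrite (Rint_embedded rphi bh hsk) (Rint_embedded (rphi_ n) bh hsk).
have lipe (Y : mms R) (psi : Y -> E) : root_embedding psi ->
    lip_on (supp_root Y) (fun x => h' (supp_ext psi x)).
  by move=> [iso _] x y Sx Sy; rewrite !supp_extE// -(iso x y Sx Sy).
have be (Y : mms R) (psi : Y -> E) : root_embedding psi ->
    bmeas (fun x : borel Y => h' (supp_ext psi x)).
  by move=> rpsi; apply: (bmeas_comp bh'); exact: measurable_supp_ext.
have := hm (fun x => h' (supp_ext (phi_ n) x)) (fun x => h' (supp_ext phi x))
  (be _ _ (rphi_ n)) (be _ _ rphi) (lipe _ _ (rphi_ n)) (lipe _ _ rphi)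
  (fun x => h'1 _) (fun x => h'1 _).
have [|+ _] := pselect (forall i, (i <= N n)%N ->
  `|h' (supp_ext (phi_ n) (a n i)) - h' (supp_ext phi (b n i))| <= e n); last first.
  case=> i iN; have [Sa Sb] := abS n i; rewrite !supp_extE//.
  exact: le_trans (h'lip _ _) (close n i iN).
move=> hab /(_ hab).
have bhe (Y : mms R) (psi : Y -> E) : root_embedding psi ->
    bmeas (fun x : borel Y => h (supp_ext psi x)).
  by move=> rpsi; apply: (bmeas_comp bh); exact: measurable_supp_ext.
rewrite /h' (Rint_Z _ _ (bhe _ _ (rphi_ n))) (Rint_Z _ _ (bhe _ _ rphi)) -mulrBr normrM.
rewrite ger0_norm ?invr_ge0 ?(ltW L0)// mulrC ler_pdivrMr// => hle.
by rewrite distrC (le_trans hle)// mulrC.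
Unshelve. all: by end_near. Qed.

End common_space.

(** * The Heine-Borel case *)

(** An ultrafilter on [A] contains a member of every finite cover by balls; having this at every
    radius, it is Cauchy. *)
Lemma closed_totally_bounded_compact (R : realType) (T : completeMetricType R) (A : set T) :
  closed A ->
  (forall e : R, 0 < e -> exists s : seq T, forall x, A x -> exists2 y, y \in s & mdist y x < e) ->
  compact A.
Proof.
move=> cA tb; rewrite compact_ultra => F UF FA.
have PF : ProperFilter F by exact: ultra_proper.
have small e : 0 < e -> exists x, F (ball x e).
  move=> e0; have [s sA] := tb e e0.
  have : F [set x | exists2 y, y \in s & mdist y x < e] by exact: filterS FA.
  elim: s {sA} => [|y s ih] Fs.
    by have [x []] := filter_ex Fs.
  have [Fy|Fy] := in_ultra_setVsetC (ball y e) UF; first by exists y.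
  apply: ih; apply: filterS2 Fy Fs => x /= yx [z].
  rewrite inE => /orP[/eqP -> zx|zs zx]; last by exists z.
  by case: yx; rewrite ballEmdist.
have /cvg_ex[t Ft] : cvg F by apply: cauchy_cvg; exact: cauchy_exP.
exists t; split => //; move: cA => /closure_id ->.
by move=> B /Ft FB; exact: (filter_ex (filterI FA FB)).
Qed.

Section nets.
Context (R : realType) (Y : mms R) (c dl : R).
Hypothesis c0 : 0 < c.
Local Notation mu := (mms_measure Y).

Let U (s : seq Y) : set (borel Y) := [set y | exists2 x, x \in s & mdist x y <= dl].

Let U_cons x s : U (x :: s) = cball x dl `|` U s.
Proof.
apply/seteqP; split => y; rewrite /U/cball/=.
  by move=> [z]; rewrite inE => /orP[/eqP ->|zs] zy; [left|right; exists z].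
by move=> [xy|[z zs zy]]; [exists x; rewrite ?inE ?eqxx|exists z; rewrite ?inE ?zs ?orbT].
Qed.

Let measurable_U s : measurable (U s).
Proof.
elim: s => [|x s ih]; last by rewrite U_cons; apply: measurableU => //; exact: measurable_cball.
by rewrite (_ : U [::] = set0)//; apply/seteqP; split => // y [].
Qed.

Let separated_mass (s : seq Y) :
  pairwise (fun x y => 2 * dl < mdist x y) s ->
  (forall x, x \in s -> (c%:E <= mu (cball x dl))%E) ->
  (((size s)%:R * c)%:E <= mu (U s))%E.
Proof.
elim: s => [|x s ih] /=; first by rewrite mul0r.
move=> /andP[/allP xs ss] cs; rewrite U_cons measureU//.
- rewrite -natr1 mulrDl mul1r addrC EFinD leeD//; first by rewrite cs ?inE ?eqxx.
  by apply: ih => // z zs; rewrite cs// inE zs orbT.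
- exact: measurable_cball.
apply/seteqP; split => // y [xy [z /xs + zy]]; rewrite ltNge => /negP[].
rewrite (le_trans (metric_triangle _ y _))// mulr_natl mulr2n lerD//.
by rewrite metric_sym.
Qed.

(** Otherwise points at mutual distance above [2 * dl] could be added forever. The balls of radius
    [dl] around them are disjoint, each has mass at least [c], and all lie in one ball of finite
    mass. *)
Lemma finite_net (P : set Y) rho : P `<=` cball point rho ->
  (forall x, P x -> (c%:E <= mu (cball x dl))%E) ->
  exists s : seq Y, (forall x, x \in s -> P x) /\
    forall x, P x -> exists2 y, y \in s & mdist y x <= 2 * dl.
Proof.
move=> Prho Pc; apply: contrapT => nonet.
have sep k : exists s : seq Y, [/\ size s = k, forall x, x \in s -> P x &
    pairwise (fun x y => 2 * dl < mdist x y) s].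
  elim: k => [|k [s [sk sP ss]]]; first by exists [::].
  have [x Px xs] : exists2 x, P x & forall y, y \in s -> 2 * dl < mdist y x.
    apply: contrapT => h; apply: nonet; exists s; split => // x Px.
    apply: contrapT => h'; apply: h; exists x => // y ys.
    by rewrite ltNge; apply/negP => yx; apply: h'; exists y.
  exists (x :: s); split => /=; first by rewrite sk.
    by move=> z; rewrite inE => /orP[/eqP ->//|]; exact: sP.
  by rewrite ss andbT; apply/allP => y ys; rewrite metric_sym xs.
have fin := mms_bounded_finite Y (rho + dl).
pose M := fine (mu (cball point (rho + dl))).
have [s [sk sP ss]] := sep (Num.truncn (M / c)).+1.
have := separated_mass ss (fun x xs => Pc x (sP x xs)); apply/negP; rewrite -ltNge.
apply: (@le_lt_trans _ _ (mu (cball point (rho + dl)))).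
  apply: le_measure; rewrite ?inE//; first exact: measurable_cball.
  move=> y [x xs xy]; rewrite /cball/= (le_trans (metric_triangle _ x _))// lerD//.
  exact: Prho (sP x xs).
rewrite -[mu _]fineK ?ge0_fin_numE// -/M lte_fin sk -ltr_pdivrMr//.
exact: truncnS_gt.
Qed.

Lemma Rint_ge_mass (g : Y -> R) x s : bmeas (g : borel Y -> R) -> (forall y, 0 <= g y) ->
  (forall y, supp_root Y y -> mdist x y <= dl -> 1 <= g y) ->
  mdist point x + dl <= s -> (c%:E <= mu (cball x dl))%E ->
  c <= \int[mrestrict Y s]_y g y.
Proof.
move=> bg g0 g1 xs cx.
have mB : measurable (cball x dl : set (borel Y)) by exact: measurable_cball.
have bI := @bmeas_indic _ _ R _ mB.
have h : `|\int[mrestrict Y s]_y \1_(cball x dl) y| <= \int[mrestrict Y s]_y g y.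
  apply: (@Rint_norm_le_on _ (borel Y) R (mrestrict Y s) (supp_root Y)) => //.
  - exact: measurable_supp_root.
  - exact: restr_supp_root_full.
  move=> y Sy; rewrite indicE; have [xy|xy] := leP (mdist x y) dl.
    by rewrite mem_set// normr1 g1.
  by rewrite memNset ?normr0// /cball/= leNgt xy.
apply: le_trans h; rewrite (le_trans _ (ler_norm _))//.
rewrite /Rintegral integral_indic ?setIT//.
rewrite -[leRHS]/(fine (mu (cball x dl `&` cball point s))) setIidl.
  have fin : (mu (cball x dl) < +oo)%E.
    apply: mms_boundedly_finite; first exact: measurable_cball.
    exact: metric_bounded_cball.
  by rewrite -lee_fin fineK// ge0_fin_numE.
by move=> y; rewrite /cball/= => xy;
  rewrite (le_trans (metric_triangle _ x _))// (le_trans _ xs)// lerD2l.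
Qed.

End nets.

Lemma local_lower_mass_real (R : realType) (X_ : nat -> mms R) (dl r : R) :
  local_lower_mass_bound X_ -> 0 < dl -> dl < r ->
  exists2 c : R, 0 < c & forall n x, msupport (mms_measure (X_ n)) x -> mdist point x < r ->
    (c%:E <= mms_measure (X_ n) (cball x dl))%E.
Proof.
move=> lb dl0 dlr; have := lb dl r dl0 dlr; set m := ereal_inf _ => m0.
(* The infimum is [+oo] when there are no centres at all; any positive constant then serves. *)
have [c c0 cm] : exists2 c : R, 0 < c & (c%:E <= m)%E.
  case: m m0 => [x| |]//; first by exists x.
  by exists 1 => //; rewrite leey.
exists c => // n x Sx xr; apply: (le_trans cm).
apply: (@le_trans _ _ (lower_mass (X_ n) dl r)); apply: ereal_inf_lbound; first by exists n.
by exists x => //; split => //; rewrite ballEmdist.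
Qed.

Section image_support.
Context (R : realType) (X : mms R) (E : completeMetricType R) (phi : X -> E).
Hypotheses (rphi : root_embedding phi) (sepE : separable_space E).

Lemma closed_image_supp_root (z : E) :
  (forall e : R, 0 < e -> exists2 x, supp_root X x & mdist z (phi x) < e) ->
  exists2 x, supp_root X x & phi x = z.
Proof.
move=> zx; have [iso _] := rphi.
have /choice[x hx] (n : nat) : exists x, supp_root X x /\ mdist z (phi x) < n.+1%:R^-1.
  by have [x Sx xz] := zx n.+1%:R^-1 ltac:(by []); exists x.
have Sx n : supp_root X (x n) := (hx n).1.
have small e : 0 < e -> \forall n \near \oo, mdist z (phi (x n)) < e.
  move=> e0; near=> n; rewrite (lt_le_trans (hx n).2)//.
  rewrite -[leRHS]invrK lef_pV2 ?posrE ?invr_gt0// (@le_trans _ _ n%:R) ?ler_nat//.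
  by near: n; exact: nbhs_infty_ger.
have /cvg_ex[y xy] : cvg (x n @[n --> \oo]).
  apply: cauchy_cvg; apply: cauchy_exP => e e0.
  have e2 : 0 < e / 2 by rewrite divr_gt0.
  have [N _ hN] := small _ e2; exists (x N).
  suff : \forall n \near \oo, ball (x N) e (x n) by [].
  exists N => // n Nn; rewrite ballEmdist /= -iso//.
  have := hN N (leqnn N); have := hN n Nn => /= h1 h2.
  rewrite (le_lt_trans (metric_triangle _ z _))// [ltRHS]splitr ltrD//.
  by rewrite metric_sym.
have Sy : supp_root X y.
  apply: (@closed_cvg _ _ \oo _ x); [exact: closed_supp_root|exact: nearW|exact: xy].
exists y => //; apply/esym/mdist_positivity/eqP; rewrite eq_le mdist_ge0 andbT.
apply/ler_addgt0Pl => e e0; rewrite addr0; have e2 : 0 < e / 2 by rewrite divr_gt0.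
have [n [zn yn]] : exists n, mdist z (phi (x n)) < e / 2 /\ mdist y (x n) < e / 2.
  have h := small _ e2; have /metricType_numDomainType.cvgrPdist_lt/(_ _ e2) h' := xy.
  by have [n [? ?]] := filter_ex (filterI h h'); exists n.
rewrite (le_trans (metric_triangle _ (phi (x n)) _))// [leRHS]splitr lerD ?ltW//.
by rewrite iso// metric_sym.
Unshelve. all: by end_near. Qed.

Let nu := embedded rphi.

Lemma embedded_boundedly_finite (A : set (borel E)) : measurable A -> metric_bounded A ->
  (nu A < +oo)%E.
Proof.
move=> mA [M AM]; have [->|/set0P[y Ay]] := eqVneq A set0; first by rewrite measure0.
apply: le_lt_trans (embedded_bounded_finite rphi (mdist point y + M)).
apply: le_measure; rewrite ?inE//; first exact: measurable_cball.
by move=> z Az; rewrite /cball/= (le_trans (metric_triangle _ y _))// lerD2l AM.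
Qed.

Definition embedded_mms : mms R := Mms E sepE nu embedded_boundedly_finite.

(** The support of an image measure is the closure of the image of the support, and the image, with
    the root added, is already closed. When [E] is Heine-Borel this makes it the required
    representative of the class of [X]. *)
Lemma embedded_mms_equiv : mms_equiv X embedded_mms.
Proof.
have [iso p0] := rphi; exists phi; split => //.
- apply/seteqP; split => [_ [x Sx <-]|z].
    case: Sx => [Sx|->]; last by right.
    left => U [oU Uz]; have [e e0 eU] := (open_mdistP U).1 oU _ Uz.
    suff : (0 < embedded_measure phi U)%E by rewrite -(embeddedE rphi).
    have mb : measurable ([set y | mdist x y < e] : set (borel X)).
      by apply: open_borel; exact: open_mball.
    apply: lt_le_trans (msupport_ball Sx e0) _.
    rewrite -(measure_setI_full (@measurable_supp_root _ X) mb (supp_root_full X)).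
    apply: le_measure.
    + by rewrite inE; apply: measurableI => //; exact: measurable_supp_root.
    + rewrite inE (_ : _ `&` _ = supp_root X `&` supp_ext phi @^-1` U).
        apply: measurableI; first exact: measurable_supp_root.
        rewrite -[Z in measurable Z]setTI; apply: measurable_supp_ext => //.
        exact: open_borel.
      by apply/seteqP; split => y /= [Sy]; rewrite supp_extE.
    + by move=> y /= [xy Sy]; split => //; apply: eU; rewrite iso//; left.
  case=> [Sz|->]; last by exists point => //; exact: supp_root_point.
  suff : forall e : R, 0 < e -> exists2 x, supp_root X x & mdist z (phi x) < e.
    by move=> /closed_image_supp_root[x]; exists x.
  move=> e e0.
  have h : (0 < embedded_measure phi [set y | (mdist z y < e)%R])%E.
    by rewrite -(embeddedE rphi); exact: (msupport_ball Sz e0).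
  apply: contrapT => no; move: h; rewrite /embedded_measure /pushforward_on.
  rewrite (_ : _ `&` _ = set0) ?measure0 ?ltxx//; apply/seteqP; split => // x [Sx zx].
  by apply: no; exists x.
- by move=> A mA; rewrite -[RHS]/(nu A) /nu embeddedE.
Qed.

End image_support.

Lemma lip_test_bump (R : realType) (E : completeMetricType R) d (p : E) : 0 < d ->
  lip_test (fun z => bump d (mdist p z)).
Proof.
move=> d0; split; last first.
- exists (mdist point p + 2 * d) => x px; apply: bump_far => //.
  by have := metric_triangle point p x; lra.
- by move=> x; exact: bump01.
exists d^-1 => x y; rewrite (le_trans (bump_lip _ _ d0))//.
rewrite ler_wpM2l ?invr_ge0 ?(ltW d0)//.
by have := mdist_klip p x y; rewrite mul1r.
Qed.

Lemma cvg_ge_real (R : realType) (u : nat -> R) (l c : R) : u n @[n --> \oo] --> l ->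
  (\forall n \near \oo, c <= u n) -> c <= l.
Proof.
move=> ul cu; apply/ler_addgt0Pl => e e0.
have /cvgrPdist_le/(_ _ e0) h := ul; have [n [h1 h2]] := filter_ex (filterI h cu).
by move: h1 h2; rewrite /= ler_norml; lra.
Qed.

Section heine_borel_limit.
Context (R : realType) (X_ : nat -> mms R) (X : mms R) (E : completeMetricType R).
Variables (phi_ : forall n, X_ n -> E) (phi : X -> E).
Hypotheses (rphi_ : forall n, root_embedding (@phi_ n)) (rphi : root_embedding phi).
Hypothesis cnu : lip_cvg (fun n => embedded (rphi_ n)) (embedded rphi).
Hypothesis lb : local_lower_mass_bound X_.

Lemma msupport_restr_full (Y : mms R) r : mrestrict Y r (~` msupport (mms_measure Y)) = 0%E.
Proof.
apply/eqP; rewrite eq_le measure_ge0 andbT.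
rewrite -(msupport_full (mms_measure Y) (mms_separable Y)).
have mS := measurableC (measurable_msupport (mms_measure Y)).
by apply: le_measure; rewrite ?inE//; apply: measurableI => //; exact: measurable_cball.
Qed.

Lemma Rint_embedded_eq0 (Y : mms R) (psi : Y -> E) (rpsi : root_embedding psi) h :
  lip_test h -> (forall y, msupport (mms_measure Y) y -> h (psi y) = 0) ->
  \int[embedded rpsi]_x h x = 0.
Proof.
move=> ht h0; have [_ _ [s hs]] := ht; have bh := lip_test_bmeas ht.
rewrite (Rint_embedded rpsi bh hs) -[RHS](mul0r (mass (mrestrict Y s))) -Rint_cst.
apply: (@Rint_eq_on _ (borel Y) R (mrestrict Y s) (msupport (mms_measure Y))).
- exact: measurable_msupport.
- exact: msupport_restr_full.
- by apply: (bmeas_comp bh); exact: measurable_supp_ext.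
- exact: bmeas_cst.
- by move=> y Sy; rewrite supp_extE ?h0//; left.
Qed.

Lemma Rint_embedded_ge_mass (Y : mms R) (psi : Y -> E) (rpsi : root_embedding psi) h x c dl :
  lip_test h -> (c%:E <= mms_measure Y (cball x dl))%E ->
  (forall y, supp_root Y y -> mdist x y <= dl -> 1 <= h (psi y)) ->
  c <= \int[embedded rpsi]_z h z.
Proof.
move=> ht cx h1; have [_ h01 [s hs]] := ht; have bh := lip_test_bmeas ht.
pose s' := Num.max s (mdist point x + dl).
rewrite (@Rint_embedded _ _ _ _ rpsi _ s' bh); last first.
  by move=> z; rewrite gt_max => /andP[/hs].
apply: (@Rint_ge_mass _ Y c dl _ x) => //.
- by apply: (bmeas_comp bh); exact: measurable_supp_ext.
- by move=> y; have /andP[] := h01 (supp_ext psi y).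
- by move=> y Sy xy; rewrite supp_extE// h1.
- by rewrite le_max lexx orbT.
Qed.

(** Eventually some support point [y] of [X_ n] lies within [dl] of [x] in [E]. Its ball of radius
    [dl] has mass at least [c] and lies where the bump of scale [2 * dl] around [x] is 1; that bump
    vanishes from distance [4 * dl] on. *)
Lemma limit_lower_mass dl rho : 0 < dl -> 0 < rho -> exists2 c : R, 0 < c &
  forall x, msupport (mms_measure X) x -> mdist point x < rho ->
    (c%:E <= mms_measure X (cball x (4 * dl)))%E.
Proof.
move=> dl0 rho0; have drho : dl < rho + dl by rewrite ltrDr.
have [c c0 hc] := local_lower_mass_real lb dl0 drho.
exists c => // x Sx xrho.
have Srx : supp_root X x by left.
have dl2 : 0 < dl / 2 by rewrite divr_gt0.
have ddl : 0 < 2 * dl by rewrite mulr_gt0.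
have mB e : measurable (cball x e : set (borel X)) by exact: measurable_cball.
have fB e : (mms_measure X (cball x e) < +oo)%E.
  by apply: mms_boundedly_finite => //; exact: metric_bounded_cball.
(* The bump of scale [dl / 2] around [phi x] has positive integral in the limit, so it cannot vanish
   on the whole support of [X_ n]. *)
have near_pt : \forall n \near \oo, exists2 y, msupport (mms_measure (X_ n)) y &
    mdist (phi x) (phi_ y) < dl.
  have ht := lip_test_bump (phi x) dl2.
  have h0 : 0 < \int[embedded rphi]_z bump (dl / 2) (mdist (phi x) z).
    apply: (@lt_le_trans _ _ (fine (mms_measure X (cball x (dl / 2))))).
      apply: fine_gt0; rewrite fB andbT.
      apply: lt_le_trans (msupport_ball Sx dl2) _.
      apply: le_measure; rewrite ?inE//; first by apply: open_borel; exact: open_mball.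
      by move=> y /= /ltW.
    apply: (Rint_embedded_ge_mass rphi (x := x) (dl := dl / 2) ht).
      by rewrite fineK// ge0_fin_numE.
    move=> y Sy xy; have [iso _] := rphi.
    by rewrite iso// bump_near.
  have := cnu ht => /cvgrPdist_lt/(_ _ h0); apply: filterS => n hn.
  apply: contrapT => no; move: hn; rewrite (Rint_embedded_eq0 (rphi_ n) ht).
    by rewrite subr0 gtr0_norm// ltxx.
  move=> y Sy; apply: bump_far => //; rewrite leNgt; apply/negP => xy; apply: no.
  by exists y => //; move: xy; rewrite mulrC divfK.
have ht2 := lip_test_bump (phi x) ddl.
have ge2 : c <= \int[embedded rphi]_z bump (2 * dl) (mdist (phi x) z).
  apply: cvg_ge_real (cnu ht2) _; apply: filterS near_pt => n [y Sy xy].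
  apply: (Rint_embedded_ge_mass (rphi_ n) (x := y) (dl := dl) ht2).
    apply: hc => //; have Sry : supp_root (X_ n) y by left.
    have ex : mdist point (phi x) = mdist point x by rewrite -supp_extE// mdist_supp_ext.
    have ey : mdist point (phi_ y) = mdist point y by rewrite -supp_extE// mdist_supp_ext.
    have := metric_triangle (point : E) (phi x) (phi_ y); rewrite ex ey; lra.
  move=> z Sz yz; rewrite bump_near//.
  have [iso_ _] := rphi_ n; have := metric_triangle (phi x) (phi_ y) (phi_ z).
  rewrite [mdist (phi_ y) _]iso_//; last by left.
  lra.
rewrite -[mms_measure X _]fineK ?ge0_fin_numE// lee_fin (le_trans ge2)//.
have [_ h01 [s hs]] := ht2; have bh := lip_test_bmeas ht2.
rewrite (Rint_embedded rphi bh hs).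
apply: (@le_trans _ _ (\int[mrestrict X s]_y \1_(cball x (4 * dl)) y)).
  apply: (le_trans (ler_norm _)).
  apply: (@Rint_norm_le_on _ (borel X) R (mrestrict X s) (supp_root X)).
  - exact: measurable_supp_root.
  - exact: restr_supp_root_full.
  - by apply: (bmeas_comp bh); exact: measurable_supp_ext.
  - exact: bmeas_indic.
  move=> y Sy; rewrite supp_extE//; have [iso _] := rphi; rewrite iso// indicE.
  have /andP[b0 b1] := bump01 (2 * dl) (mdist x y); rewrite ger0_norm//.
  have [xy|xy] := leP (mdist x y) (4 * dl); first by rewrite mem_set.
  by rewrite bump_far ?ler0n//; lra.
have sub : (mrestrict X s (cball x (4 * dl)) <= mms_measure X (cball x (4 * dl)))%E.
  apply: le_measure; rewrite ?inE//.
  by apply: measurableI => //; exact: measurable_cball.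
rewrite /Rintegral integral_indic ?setIT//; apply: fine_le => //.
- by rewrite ge0_fin_numE//; exact: le_lt_trans sub (fB _).
- by rewrite ge0_fin_numE.
Qed.

(** The limit has a finite net of mesh [8 * dl], and the test [h] vanishes on its support, so the
    integrals of [h] over [X_ n] tend to 0. Around a point farther than [17 * dl] from the net, a
    ball of radius [dl] stays beyond [16 * dl], where [h] is 1, and would contribute at least
    [c]. *)
Lemma uniform_net dl rho : 0 < dl -> 0 < rho -> exists s : seq E,
  (forall y, msupport (mms_measure X) y -> mdist point y <= rho ->
     exists2 p, p \in s & mdist p (phi y) <= 17 * dl) /\
  \forall n \near \oo, forall y, msupport (mms_measure (X_ n)) y -> mdist point y <= rho ->
     exists2 p, p \in s & mdist p (phi_ y) <= 17 * dl.
Proof.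
move=> dl0 rho0; have [iso p0] := rphi.
(* The outer cut-off in [h], of scale [rho + dl], reaches to twice that scale, so the net has to
   cover the limit support up to there. *)
pose rho2 := 2 * (rho + dl) + 1; have rho20 : 0 < rho2 by rewrite /rho2; lra.
have [c1 c10 hc1] := limit_lower_mass dl0 rho20.
pose P x := msupport (mms_measure X) x /\ mdist point x < rho2.
have [s0 [s0P hs0]] := @finite_net R X c1 (4 * dl) c10 P rho2
  (fun x Px => ltW Px.2) (fun x Px => hc1 x Px.1 Px.2).
pose q i := phi (nth point s0 i); pose N := size s0.
have Sq i : supp_root X (nth point s0 i).
  have [iN|Ni] := ltnP i N; last by rewrite nth_default//; exact: supp_root_point.
  by left; case: (s0P _ (mem_nth point iN)).
have dl8 : 0 < 8 * dl by rewrite mulr_gt0.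
have near0 x : P x -> exists2 i, (i < N)%N & mdist (q i) (phi x) <= 8 * dl.
  move=> Px; have [y ys yx] := hs0 x Px; exists (index y s0); first by rewrite index_mem.
  have Sx : supp_root X x by left; case: Px.
  by rewrite iso// nth_index//; lra.
pose h (z : E) := Num.min (bump (rho + dl) (mdist point z)) (rest (8 * dl) (dists q z) N).
have rd0 : 0 < rho + dl by rewrite addr_gt0.
have ht : lip_test h.
  have [[k1 k1h] _ [s hs]] := lip_test_bump (point : E) rd0.
  split; last first.
  - by exists s => x sx; rewrite /h hs// min_l//; case/andP: (rest01 (8 * dl) (dists q x) N).
  - move=> x; have /andP[? ?] := bump01 (rho + dl) (mdist point x).
    have /andP[? ?] := rest01 (8 * dl) (dists q x) N; rewrite /h le_min ge_min.
    by apply/andP; split; [apply/andP|apply/orP; left].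
  have restk : klip ((8 * dl)^-1 *+ N) (fun z => rest (8 * dl) (dists q z) N).
    move=> x y; rewrite [leRHS]mulrnAl; apply: rest_lip => // i _.
    by have := mdist_klip (q i) x y; rewrite mul1r.
  exists (Num.max k1 ((8 * dl)^-1 *+ N)); apply: klip_min.
    by apply: klip_le k1h; rewrite le_max lexx.
  by apply: klip_le restk; rewrite le_max lexx orbT.
exists (map phi s0); split.
  move=> y Sy yrho; have [|i iN yi] := near0 y; first by split => //; rewrite /rho2; lra.
  by exists (q i); [apply: map_f; exact: mem_nth|lra].
have ddl : dl < rho + dl by rewrite ltrDr.
have [c c0 hc] := local_lower_mass_real lb dl0 ddl.
have I0 : \int[embedded rphi]_z h z = 0.
  apply: Rint_embedded_eq0 => // x Sx; have Srx : supp_root X x by left.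
  have [xr|xr] := ltP (mdist point x) rho2.
    have [i iN xi] := near0 x (conj Sx xr); rewrite /h (rest_near dl8 iN xi) min_r//.
    by case/andP: (bump01 (rho + dl) (mdist point (phi x))).
  rewrite /h bump_far//; first by rewrite min_l//; case/andP: (rest01 (8 * dl) (dists q (phi x)) N).
  rewrite -supp_extE// mdist_supp_ext//; apply: le_trans xr; rewrite /rho2; lra.
have := cnu ht; rewrite I0 => /cvgrPdist_lt/(_ _ c0); apply: filterS => n.
rewrite sub0r normrN => hn y Sy yrho; apply: contrapT => no.
have Sry : supp_root (X_ n) y by left.
have [ison _] := rphi_ n.
have cy : c <= \int[embedded (rphi_ n)]_z h z.
  apply: (Rint_embedded_ge_mass (rphi_ n) (x := y) (dl := dl) ht).
    by apply: hc => //; rewrite (le_lt_trans yrho)// ltrDl.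
  move=> z Sz yz; have zr : mdist point z <= rho + dl.
    by rewrite (le_trans (metric_triangle _ y _))// lerD.
  rewrite /h bump_near//; last by rewrite -supp_extE// mdist_supp_ext.
  rewrite le_min lexx/= /rest big1// => i _; rewrite bump_far ?subr0//.
  have qi : 17 * dl < mdist (q i) (phi_ y).
    rewrite ltNge; apply/negP => yi; apply: no; exists (q i) => //.
    by apply: map_f; exact: mem_nth.
  have := metric_triangle (q i) (phi_ z) (phi_ y); rewrite /dists.
  by rewrite [mdist (phi_ z) _]metric_sym ison//; lra.
by move: hn; rewrite ltNge (le_trans cy (ler_norm _)).
Qed.

Hypothesis dense : forall (x : E) (c : R), 0 < c ->
  (exists2 y, supp_root X y & mdist x (phi y) <= c) \/
  (exists n, exists2 y, supp_root (X_ n) y & mdist x (@phi_ n y) <= c).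

(** From some index on all spaces share one net with the limit; each of the finitely many earlier
    spaces has a finite net of its own by the lower mass bound. *)
Lemma heine_borel_embedding : heine_borel E.
Proof.
move=> A cA [M AM]; apply: closed_totally_bounded_compact => // e e0.
have [->|/set0P[x0 Ax0]] := eqVneq A set0; first by exists [::].
(* Nets have mesh at most [17 * dl], and approximating by an image point costs another [dl], which
   together stay below [e]. *)
pose dl := e / 40; have dl0 : 0 < dl by rewrite divr_gt0.
pose rho := `|mdist point x0 + M| + 1 + dl.
have rho0 : 0 < rho by rewrite /rho; have := normr_ge0 (mdist point x0 + M); lra.
have Arho x : A x -> mdist point x + dl <= rho.
  move=> Ax; have := metric_triangle point x0 x; have := AM _ _ Ax0 Ax.
  have := ler_norm (mdist point x0 + M); rewrite /rho; lra.
have ddl : dl < rho + dl by rewrite ltrDr.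
have [c c0 hc] := local_lower_mass_real lb dl0 ddl.
have [s [sX [n0 _ sn]]] := uniform_net dl0 rho0.
have net n : exists t : seq (X_ n), (forall x, x \in t ->
      msupport (mms_measure (X_ n)) x /\ mdist point x <= rho) /\
    forall x, msupport (mms_measure (X_ n)) x /\ mdist point x <= rho ->
      exists2 y, y \in t & mdist y x <= 2 * dl.
  apply: (finite_net c0 (rho := rho)) => [x []//|x [Sx xr]].
  by apply: hc => //; rewrite (le_lt_trans xr)// ltrDl.
pose t n := sval (cid (net n)); have ht n := svalP (cid (net n)).
(* The root is listed separately because it need not belong to any support. *)
exists (point :: s ++ flatten [seq map (@phi_ n) (t n) | n <- iota 0 n0]) => x Ax.
have close p (z : E) : mdist x z <= dl -> mdist p z <= 17 * dl -> mdist p x < e.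
  have := metric_triangle p z x; rewrite [mdist z x]metric_sym /dl; lra.
have root_case : mdist x point <= dl ->
    exists2 y, y \in point :: s ++ flatten [seq map (@phi_ n) (t n) | n <- iota 0 n0] &
      mdist y x < e.
  by move=> xp; exists point; rewrite ?inE ?eqxx// metric_sym; move: xp; rewrite /dl; lra.
have bound (Y : mms R) (psi : Y -> E) y : root_embedding psi -> supp_root Y y ->
    mdist x (psi y) <= dl -> mdist point y <= rho.
  move=> rpsi Sy xy; rewrite -(mdist_supp_ext rpsi Sy) supp_extE//.
  by have := Arho x Ax; have := metric_triangle point x (psi y); lra.
have [[y Sy xy]|[n [y Sy xy]]] := dense x dl0.
  have [_ p0] := rphi; case: (Sy) => [My|yp]; last by rewrite yp p0 in xy; exact: root_case.
  have [p ps py] := sX y My (bound _ _ _ rphi Sy xy).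
  by exists p; [rewrite inE mem_cat ps orbT|exact: close xy py].
have [ison p0] := rphi_ n; case: (Sy) => [My|yp]; last by rewrite yp p0 in xy; exact: root_case.
have yr := bound _ _ _ (rphi_ n) Sy xy.
have [nn0|nn0] := leqP n0 n.
  have [p ps py] := sn n nn0 y My yr.
  by exists p; [rewrite inE mem_cat ps orbT|exact: close xy py].
have [p pt py] := (ht n).2 y (conj My yr).
exists (@phi_ n p).
  rewrite inE mem_cat; apply/orP; right; apply/orP; right; apply/flattenP.
  exists (map (@phi_ n) (t n)); last exact: map_f.
  by apply/mapP; exists n => //; rewrite mem_iota.
apply: close xy _; rewrite ison//; last by left; case: ((ht n).1 p pt).
by rewrite (le_trans py)//; move: dl0; lra.
Qed.

End heine_borel_limit.

Theorem proposition4p1 (R : realType) (X_ : nat -> mms R) (Xoo : mms R) :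
  [/\ gromov_vague_cvg X_ Xoo <->
        (exists (E : completeMetricType R) (phi_ : forall n, X_ n -> E)
           (phioo : Xoo -> E),
          [/\ separable_space E,
              forall n, root_embedding (phi_ n),
              root_embedding phioo &
              local_weak_cvg (fun n => embedded_measure (phi_ n))
                             (embedded_measure phioo)]),
      gromov_vague_cvg X_ Xoo -> local_lower_mass_bound X_ ->
        in_mms_HB Xoo /\
        (exists (E : completeMetricType R) (phi_ : forall n, X_ n -> E)
           (phioo : Xoo -> E),
          [/\ separable_space E /\ heine_borel E,
              forall n, root_embedding (phi_ n),
              root_embedding phioo &
              local_weak_cvg (fun n => embedded_measure (phi_ n))
                             (embedded_measure phioo)]) &
      forall (E : completeMetricType R) (phi_ : forall n, X_ n -> E)
          (phioo : Xoo -> E),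
        separable_space E -> heine_borel E ->
        (forall n, root_embedding (phi_ n)) -> root_embedding phioo ->
        (local_weak_cvg (fun n => embedded_measure (phi_ n))
                        (embedded_measure phioo) <->
         vague_cvg (fun n => embedded_measure (phi_ n))
                   (embedded_measure phioo))].
Proof.
have seqE (E : completeMetricType R) (phi_ : forall n, X_ n -> E)
    (rphi_ : forall n, root_embedding (phi_ n)) :
    (fun n => embedded_measure (phi_ n)) =
    (fun n => embedded (rphi_ n) : set (borel E) -> \bar R).
  by apply/funext => n; rewrite embeddedE.
split.
- split=> [gv|[E [phi_ [phi [sepE rphi_ rphi cw]]]]].
    have [E [phi_ [phi [rphi_ [rphi [sepE cnu _]]]]]] := gromov_vague_embedding gv.
    exists E, phi_, phi; split => //; rewrite (seqE _ _ rphi_) -(embeddedE rphi).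
    exact: (lip_cvg_local_weak (fun n => embedded_bounded_finite (rphi_ n))
      (embedded_bounded_finite rphi)).
  exact: (local_weak_gromov_vague sepE rphi_ rphi).
- move=> gv lb.
  have [E [phi_ [phi [rphi_ [rphi [sepE cnu dns]]]]]] := gromov_vague_embedding gv.
  have hbE : heine_borel E by exact: heine_borel_embedding cnu lb dns.
  split; first by exists (embedded_mms rphi sepE) => //; exact: embedded_mms_equiv.
  exists E, phi_, phi; split => //; rewrite (seqE _ _ rphi_) -(embeddedE rphi).
  exact: (lip_cvg_local_weak (fun n => embedded_bounded_finite (rphi_ n))
    (embedded_bounded_finite rphi)).
- move=> E phi_ phi sepE hbE rphi_ rphi; rewrite (seqE _ _ rphi_) -(embeddedE rphi).
  have bnu_ n := embedded_bounded_finite (rphi_ n).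
  have bnu := embedded_bounded_finite rphi.
  by split; [exact: local_weak_vague|exact: vague_local_weak].
Qed.
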